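(* Let $f \in \mathbb{R}\langle\!\langle T\rangle\!\rangle$ be non-zero with $f \not\asymp T^k$ for all $k \in \mathbb{N}$, and let $x,\delta \in \mathbb{U}$ with $x > \mathbb{R}$, $x + \delta > \mathbb{R}$, $x + \delta \asymp x$, and $\frac{f' \circ x}{f \circ x}\,\delta \preceq 1$. Then for all $n \geq 0$, $$ f \circ (x + \delta) = \sum_{i = 0}^{n - 1} \frac{f^{(i)} \circ x}{i!}\,\delta^i + O\left((f^{(n)} \circ x)\,\delta^n\right). $$
   Context: Fields of transseries. Let $\mathfrak{M}$ be a multiplicatively written ordered abelian group, whose elements are called monomials. $\mathbb{R}(\!(\mathfrak{M})\!)_{\mathbf{On}}$ denotes the ordered field of all formal series $f=\sum_{i<\alpha} r_i\mathfrak{m}_i$ with $\alpha$ an ordinal, $r_i \in \mathbb{R}\setminus\{0\}$, $\mathfrak{m}_i\in\mathfrak{M}$ and $\mathfrak{m}_i>\mathfrak{m}_j$ whenever $i<j$, with the usual Hahn series operations and order ($f\neq 0$ is positive iff $r_0>0$). The support of $f$ is $\{\mathfrak{m}_i : i<\alpha\}$ and, for $f \ne 0$, $r_0\mathfrak{m}_0$ is the leading term and $\mathfrak{m}_0$ the leading monomial. A family of series is summable if the union of the supports is a set in which every non-empty subset has a maximum, and each monomial lies in only finitely many of the supports; its (infinite) sum is then computed monomial by monomial. Such a field is a field of transseries if $\mathfrak{M}$ is equipped with an isomorphism of ordered groups $\log:(\mathfrak{M},\cdot)\to (\mathbb{J}_{\mathfrak{M}},+)$, where $\mathbb{J}_{\mathfrak{M}}=\mathbb{R}(\!(\mathfrak{M}^{>1})\!)_{\mathbf{On}}$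 is the group of series with support in $\mathfrak{M}^{>1}$, such that $\log(\mathfrak{m})^n<\mathfrak{m}$ for all $\mathfrak{m}\in \mathfrak{M}^{>1}$ and $n\in\mathbb{N}$. (Then $\mathfrak{M}$ is a proper class; to avoid this one may require, for instance, that the ordinals $\alpha$ are always countable.) The inverse of $\log$ is $\exp$, and $e^\gamma=\exp(\gamma)$. One extends $\log$ to all positive series: for $f=r\mathfrak{m}(1+\varepsilon)$ with $r\mathfrak{m}$ the leading term of $f$, $r>0$, $\varepsilon$ infinitesimal, $\log(f)=\log(\mathfrak{m})+\log(r)+\sum_{n\ge1}(-1)^{n+1}\varepsilon^n/n$; $\exp$ extends to all series as the inverse of this map. $\log^{\circ n}$ is the $n$-fold composition of $\log$. A monomial $\mathfrak{m}>1$ is log-atomic if $\log^{\circ n}(\mathfrak{m})\in\mathfrak{M}$ for all $n\in\mathbb{N}$. Omega-series. Let $T$ be a log-atomic element of some field of transseries. $\mathbb{R}\langle\!\langle T\rangle\!\rangle$ (omega-series in $T$) is the smallest subclass of that field containing $\mathbb{R}$ and $T$ and closed under $\exp$, $\log$ (of positive elements) and sums $\sum_{i<\alpha}r_i\mathfrak{m}_i$ of terms whose monomials $\mathfrak{m}_i$ lie in it. It has the form $\mathbb{R}(\!(\mathfrak{O})\!)_{\mathbf{On}}$ for a subgroup $\mathfrak{O}\le\mathfrak{M}$; write $\mathbb{J}=\mathbb{R}(\!(\mathfrak{O}^{>1})\!)_{\mathbf{On}}$ for its subgroup of purely infinite series. It carries a unique derivation $f\mapsto f'$ with $T'=1$,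 $(e^\gamma)'=e^\gamma\gamma'$ for $\gamma\in\mathbb{J}$, and which is strongly $\mathbb{R}$-linear, i.e. $(\sum_{i<\alpha} r_i\mathfrak{m}_i)'=\sum_{i<\alpha} r_i\mathfrak{m}_i'$; $f^{(n)}$ is the $n$-th iterated derivative. The field $\mathbb{U}$ and composition. $\mathbb{U}$ is a fixed field of transseries that is confluent: for every $x\in\mathbb{U}$ with $x>\mathbb{R}$ there is $n\in\mathbb{N}$ such that the leading term of $\log^{\circ n}(x)$ is log-atomic. Here $x>\mathbb{R}$ means $x>r$ for all $r\in\mathbb{R}$, and $\mathbb{U}^{>\mathbb{R}}$ is the class of such $x$. For every $x\in\mathbb{U}^{>\mathbb{R}}$ there is a unique map $\mathbb{R}\langle\!\langle T\rangle\!\rangle\to\mathbb{U}$, $f\mapsto f\circ x$, with $T\circ x=x$, $e^\gamma\circ x=e^{\gamma\circ x}$ for $\gamma\in\mathbb{J}$, and $(\sum_{i<\alpha} r_i\mathfrak{m}_i)\circ x=\sum_{i<\alpha} r_i(\mathfrak{m}_i\circ x)$; it is an embedding of ordered fields preserving infinite sums, $\exp$ and $\log$. (More generally, $\mathbb{U}$ may be any field of transseries equipped with such a composition $(f,x)\mapsto f\circ x$ preserving infinite sums, multiplication by real scalars, $\exp$ and $\log$.) Dominance. In an ordered field: $a\preceq b$ means $|a|\le n|b|$ for some $n\in\mathbb{N}$; $a\asymp b$ means $a\preceq b$ and $b\preceq a$. $O(b)$ stands for an unspecified element of $\{a: a\preceq b\}$. *)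

(* Defs.v *)
From HB Require Import structures.
From mathcomp Require Import all_boot all_order all_algebra.
From mathcomp Require Import all_classical all_reals exp.
Set Implicit Arguments.
Unset Strict Implicit.
Unset Printing Implicit Defensive.
Import Order.TTheory GRing.Theory Num.Theory.
Local Open Scope classical_set_scope.
Local Open Scope ring_scope.

(* A restriction on the size of supports.  [small T] reads "T is a set" when
   monomials form a proper class (so that all ordinal lengths are allowed);
   countability is another instance.  Some restriction is unavoidable: no
   nontrivial ordered group is isomorphic to the group of all its purely
   infinite series with arbitrary well-based support. *)
Record sizeClass := SizeClass {
  small :> Type -> Prop;
  small_nat : small nat;
  small_inj : forall (A B : Type) (f : A -> B),
    injective f -> small B -> small A;
  small_sigma : forall (I : Type) (F : I -> Type),
    small I -> (forall i, small (F i)) -> small {i : I & F i}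
}.

Definition small_set (S : sizeClass) (T : Type) (A : set T) : Prop :=
  S {x : T | A x}.

Lemma sval_inj_eq (T : Type) (P : T -> Prop) (x y : {x | P x}) :
  sval x = sval y -> x = y.
Proof. by move: x y => [a Pa] [b Pb] /= ab; subst b; congr exist; exact: Prop_irrelevance. Qed.

Section SizeTheory.
Variable S : sizeClass.

Lemma small_surj (A B : Type) (f : A -> B) :
  (forall b, exists a, f a = b) -> S A -> S B.
Proof.
move=> /choice[g gK]; apply: (@small_inj S B A g).
by move=> x y /(congr1 f); rewrite !gK.
Qed.

Lemma small_subset (T : Type) (A B : set T) :
  A `<=` B -> small_set S B -> small_set S A.
Proof.
move=> AB.
apply: (@small_inj S _ _ (fun x : {x | A x} => exist B (sval x) (AB _ (svalP x)))).
by move=> x y [] xy; apply: sval_inj_eq.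
Qed.

Lemma small_image (T U : Type) (A : set T) (f : T -> U) :
  small_set S A -> small_set S (f @` A).
Proof.
apply: (@small_surj _ _ (fun x : {x | A x} =>
  exist (f @` A) (f (sval x)) (ex_intro2 _ _ _ (svalP x) erefl))).
move=> [y yA]; have [x Ax xy] := yA; exists (exist _ x Ax).
exact: sval_inj_eq.
Qed.

Lemma small_bigcup (I T : Type) (F : I -> set T) :
  S I -> (forall i, small_set S (F i)) -> small_set S (\bigcup_i F i).
Proof.
move=> SI SF; have := small_sigma SI SF.
apply: (@small_surj _ _ (fun p : {i : I & {x | F i x}} =>
  exist (\bigcup_i F i) (sval (projT2 p))
    (ex_intro2 _ _ (projT1 p) Logic.I (svalP (projT2 p))))).
move=> [y yA]; have [i _ Fi] := yA.
by exists (existT _ i (exist _ y Fi)); apply: sval_inj_eq.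
Qed.

Lemma small_bool : S bool.
Proof. by apply: (@small_inj S _ _ nat_of_bool) (small_nat S) => -[] []. Qed.

Lemma small_setU (T : Type) (A B : set T) :
  small_set S A -> small_set S B -> small_set S (A `|` B).
Proof.
move=> SA SB.
have := @small_bigcup _ T (fun b : bool => if b then A else B) small_bool.
move=> /(_ (fun b => if b return small_set S (if b then A else B) then SA else SB)).
apply: small_subset => x [Ax|Bx]; [by exists true|by exists false].
Qed.

Lemma small_set1 (T : Type) (x : T) : small_set S [set x].
Proof.
apply: (@small_inj S _ _ (fun=> 0%N)) (small_nat S) => -[a Aa] [b Bb] _.
by apply: sval_inj_eq; rewrite /= Aa Bb.
Qed.

Lemma small_set0 (T : Type) : small_set S (@set0 T).
Proof. by apply: (@small_inj S _ _ (fun=> 0%N)) (small_nat S) => -[a []]. Qed.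

Lemma small_setX (T U : Type) (A : set T) (B : set U) :
  small_set S A -> small_set S B -> small_set S (A `*` B).
Proof.
move=> SA SB; have := small_sigma SA (fun=> SB).
apply: (@small_surj _ _ (fun p : {_ : {x | A x} & {x | B x}} =>
  exist (A `*` B) (sval (projT1 p), sval (projT2 p))
     (conj (svalP (projT1 p)) (svalP (projT2 p))))).
move=> [[a b] ab]; have [Aa Bb] := ab.
by exists (existT _ (exist _ a Aa) (exist _ b Bb)); apply: sval_inj_eq.
Qed.

End SizeTheory.

HB.mixin Record isOrderedAbGroup (d : Order.disp_t) T
    of Order.Total d T & Group T := {
  mulgC_oag : forall x y : T, (x * y = y * x)%g;
  lemul2l_oag : forall z x y : T, (x <= y)%O -> (z * x <= z * y)%O%g
}.

#[short(type="oagType")]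
HB.structure Definition OrderedAbGroup (d : Order.disp_t) :=
  {T of Order.Total d T & Group T & isOrderedAbGroup d T}.

(* reverse well-ordered: a decreasing enumeration by an ordinal exists *)
Definition well_based d (M : orderType d) (A : set M) : Prop :=
  forall C : set M, C `<=` A -> C !=set0 ->
    exists2 m, C m & forall n, C n -> (n <= m)%O.

Section OagTheory.
Variables (d : Order.disp_t) (M : oagType d).
Implicit Types (a b c m : M) (A B C : set M).

Local Notation "a * b" := (a * b)%g : ring_scope.
Local Notation "a ^-1" := (a^-1)%g : ring_scope.
Local Notation "1" := (1%g) : ring_scope.
Local Notation "a <= b" := (a <= b)%O : ring_scope.
Local Notation "a < b" := (a < b)%O : ring_scope.

Lemma oagC a b : a * b = b * a.
Proof. exact: mulgC_oag. Qed.

Lemma oag_le2l c a b : (c * a <= c * b) = (a <= b).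
Proof.
apply/idP/idP => [|/lemul2l_oag //].
by move=> /(lemul2l_oag c^-1); rewrite !mulKg.
Qed.

Lemma oag_lt2l c a b : (c * a < c * b) = (a < b).
Proof. by rewrite !ltNge oag_le2l. Qed.

Lemma oag_le2r c a b : (a * c <= b * c) = (a <= b).
Proof. by rewrite ![_ * c]oagC oag_le2l. Qed.

Lemma oag_lt2r c a b : (a * c < b * c) = (a < b).
Proof. by rewrite !ltNge oag_le2r. Qed.

Lemma oag_leM a b a' b' : a <= a' -> b <= b' -> a * b <= a' * b'.
Proof.
by move=> aa bb; rewrite (@le_trans _ _ (a * b')) ?oag_le2l ?oag_le2r.
Qed.

Lemma well_based_sub A B : A `<=` B -> well_based B -> well_based A.
Proof. by move=> AB wB C CA; apply: wB; exact: subset_trans AB. Qed.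

Lemma well_basedU A B : well_based A -> well_based B -> well_based (A `|` B).
Proof.
move=> wA wB C CAB C0.
have [CA0|CA0] := pselect ((C `&` A) !=set0); last first.
  apply: wB => // c Cc; have [Ac|//] := CAB _ Cc.
  by exfalso; apply: CA0; exists c.
have [CB0|CB0] := pselect ((C `&` B) !=set0); last first.
  apply: wA => // c Cc; have [//|Ac] := CAB _ Cc.
  by exfalso; apply: CB0; exists c.
have [a [Ca _] amax] := wA _ (@subIsetr _ C A) CA0.
have [b [Cb _] bmax] := wB _ (@subIsetr _ C B) CB0.
have [ab|/ltW ba] := leP a b.
- exists b => // n Cn; have [An|Bn] := CAB _ Cn; last exact: bmax.
  by apply: le_trans ab; exact: amax.
- exists a => // n Cn; have [An|Bn] := CAB _ Cn; first exact: amax.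
  by apply: le_trans ba; exact: bmax.
Qed.

Lemma well_based1 a : well_based [set a].
Proof. by move=> C C1 [c Cc]; exists c => // n /C1 ->; rewrite (C1 _ Cc). Qed.

Definition mulset A B : set M := [set m | exists a b, [/\ A a, B b & m = a * b]].

Lemma well_based_mul A B : well_based A -> well_based B ->
  well_based (mulset A B).
Proof.
move=> wA wB.
pose D C := [set a | A a /\ exists2 b, B b & C (a * b)].
pose bad b := exists C, [/\ C `<=` mulset A B, C !=set0,
  ~ (exists2 m, C m & forall n, C n -> n <= m) &
  exists a, [/\ D C a, forall a', D C a' -> a' <= a, C (a * b), B b &
     forall b', B b' -> C (a * b') -> b' <= b]].
have key C : C `<=` mulset A B -> C !=set0 -> exists a b,
   [/\ D C a, forall a', D C a' -> a' <= a, C (a * b), B b &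
     forall b', B b' -> C (a * b') -> b' <= b].
  move=> CAB [c Cc].
  have [a Da amax] : exists2 m, D C m & forall n, D C n -> n <= m.
    apply: wA; first by move=> a [].
    have [a [b [Aa Bb cE]]] := CAB _ Cc.
    by exists a; split=> //; exists b; rewrite // -cE.
  have [Aa [b Bb Cab]] := Da.
  have [b0 [Bb0 Cb0] b0max] : exists2 m, (B `&` [set b | C (a * b)]) m &
      forall n, (B `&` [set b | C (a * b)]) n -> n <= m.
    by apply: wB; [exact: subIsetl|exists b].
  exists a, b0; split=> // b' Bb' Cb'; exact: b0max.
have nobad : ~ (bad !=set0).
  move=> [b0 bb0].
  have [b1 [[C [CAB C0 Cmax [a [Da amax Cab Bb bmax]]]] Bb1] b1max] :
      exists2 m, (bad `&` B) m & forall n, (bad `&` B) n -> n <= m.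
    apply: wB; first exact: subIsetr.
    by exists b0; split=> //; case: bb0 => C [_ _ _ [a []]].
  pose C' := C `&` [set c | a * b1 < c].
  have [C'0|C'0] := pselect (C' !=set0); last first.
    apply: Cmax; exists (a * b1) => // n Cn; rewrite leNgt; apply/negP => lt.
    by apply: C'0; exists n.
  have C'AB : C' `<=` mulset A B by move=> c [/CAB].
  have [a' [b' [Da' amax' Cab' Bb' bmax']]] := key C' C'AB C'0.
  have lt_b : b1 < b'.
    case: Cab' => Cab'' lt.
    have le_a : a' <= a by apply: amax; case: Da' => ? _; split=> //; exists b'.
    by rewrite -(oag_lt2l a) (lt_le_trans lt)// oag_le2r.
  have : ~ (bad `&` B) b'.
    by move=> /b1max; rewrite leNgt lt_b.
  apply; split=> //; exists C'; split=> //; last by exists a'.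
  move=> [m [Cm ltm] mmax]; apply: Cmax; exists m => // n Cn.
  have [ltn|nle] := ltP (a * b1) n; first exact: mmax.
  exact: le_trans (ltW ltm).
move=> C CAB C0; apply: contrapT => Cmax.
have [a [b ab]] := key C CAB C0; apply: nobad.
by exists b, C; split=> //; exists a.
Qed.

(* A monomial has finitely many factorisations along two well-based sets. *)
Lemma mulset_finite A B m : well_based A -> well_based B ->
  finite_set (A `&` [set a | B (a^-1 * m)]).
Proof.
move=> wA wB; set X := _ `&` _.
have Xmax : well_based X by apply: well_based_sub wA; exact: subIsetl.
have Xmin C : C `<=` X -> C !=set0 -> exists2 a, C a & forall b, C b -> a <= b.
  move=> CX [c Cc].
  have [] := wB [set b | C (m * b^-1)].
  - move=> b /= /CX[_ /=].
    by rewrite invgM invgK -mulgA mulVg mulg1.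
  - by exists (c^-1 * m); rewrite /= invgM invgK mulVKg.
  move=> b Cb bmax; exists (m * b^-1) => // a Ca.
  have : a^-1 * m <= b by apply: bmax; rewrite /= invgM invgK mulVKg.
  by rewrite -(oag_le2l a (a^-1 * m)) mulVKg -(oag_le2r b^-1 m) mulgK.
apply: contrapT => Xinf.
pose Y := X `&` [set a | infinite_set (X `&` [set b | a <= b])].
have X0 : X !=set0.
  by apply/set0P; apply/negP => /eqP X0; apply: Xinf; rewrite X0.
have [x0 Xx0 x0min] := Xmin X (fun _ h => h) X0.
have Y0 : Y x0.
  split=> // fin; apply: Xinf; apply: sub_finite_set fin => b Xb; split=> //.
  exact: x0min.
have [y [Xy Yy] ymax] := Xmax Y (@subIsetl _ _ _) (ex_intro _ _ Y0).
have [Z0|Z0] := pselect ((X `&` [set b | y < b]) !=set0); last first.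
  apply: Yy; apply: (@sub_finite_set _ _ [set y]) => // b [Xb /= yb].
  apply: contrapT => /eqP by_; apply: Z0; exists b; split=> //=.
  by rewrite lt_neqAle eq_sym by_.
have [z [Xz /= yz] zmin] := Xmin _ (@subIsetl _ _ _) Z0.
have finz : finite_set (X `&` [set b | z <= b]).
  apply: contrapT => infz; have : Y z by split.
  by move=> /ymax; rewrite leNgt yz.
apply: Yy; apply: (@sub_finite_set _ _ ([set y] `|` (X `&` [set b | z <= b]))).
  move=> b [Xb /=]; rewrite le_eqVlt => /predU1P[->|yb]; first by left.
  by right; split=> //; exact: zmin.
by rewrite finite_setU; split.
Qed.

Lemma well_based_no_incr A (u : nat -> M) : well_based A ->
  (forall n, A (u n)) -> (forall n, u n < u n.+1) -> False.
Proof.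
move=> wA Au ui; have [||_ [n _ <-] nmax] := wA (range u).
- by move=> _ [n _ <-].
- by exists (u 0%N); exists 0%N.
by have := nmax _ (ex_intro2 _ _ n.+1 I erefl); rewrite leNgt ui.
Qed.

Lemma no_incr_well_based A :
  (forall u : nat -> M, (forall n, A (u n)) -> (forall n, u n < u n.+1) -> False) ->
  well_based A.
Proof.
move=> noinc C CA [c0 Cc0]; apply: contrapT => nomax.
have /choice[f fP] (c : {c | C c}) : exists c' : {c | C c}, sval c < sval c'.
  apply: contrapT => nc; apply: nomax; exists (sval c); first exact: svalP.
  move=> n Cn; rewrite leNgt; apply/negP => lt; apply: nc.
  by exists (exist _ n Cn).
apply: (noinc (fun n => sval (iter n f (exist _ c0 Cc0)))) => n /=.
  by apply: CA; exact: svalP.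
exact: fP.
Qed.

Lemma nonincr_subseq A (u : nat -> M) : well_based A -> (forall n, A (u n)) ->
  exists phi : nat -> nat, (forall n, (phi n < phi n.+1)%N) /\
    (forall n, u (phi n.+1) <= u (phi n)).
Proof.
move=> wA Au.
have /choice[g gP] k : exists i, (k <= i)%N /\
    forall n, (k <= n)%N -> u n <= u i.
  have [||_ [i /= ki <-] imax] := wA (u @` [set i | (k <= i)%N]).
  - by move=> _ [n _ <-].
  - by exists (u k); exists k => //=; exact: leqnn.
  by exists i; split=> // n kn; apply: imax; exists n.
pose phi n := iter n (fun k => g k.+1) (g 0%N).
have phiS n : (phi n < phi n.+1)%N by rewrite /phi iterS; case: (gP (phi n).+1).
exists phi; split=> // n.
case: n => [|n]; first by case: (gP 0%N) => _; exact.
rewrite {2}/phi iterS -/(phi n); case: (gP (phi n).+1) => _; apply.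
exact: ltn_trans (phiS _) (phiS _).
Qed.

(* products of exactly n elements of A *)
Fixpoint powset A n : set M :=
  if n is n'.+1 then mulset A (powset A n') else [set 1].

Definition genset A := \bigcup_n powset A n.

(* Neumann's lemma: the monoid generated by a well-based set of infinitesimal
   monomials is well-based, and each element is reached in finitely many
   lengths. *)
Section Neumann.
Variable A : set M.
Hypotheses (wA : well_based A) (A_lt1 : forall a, A a -> a < 1).

Let N := genset A.

Lemma genset_le1 a : N a -> a <= 1.
Proof.
move=> [n _]; elim: n a => [a ->//|n IH a [s [v [As /IH v1 ->]]]].
by rewrite -[leRHS](mulg1 1) oag_leM// ltW// A_lt1.
Qed.

Let is_len w n := powset A n w /\ forall k, powset A k w -> (n <= k)%N.
Let len w := xget 0%N (is_len w).

Lemma lenP w : N w -> is_len w (len w).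
Proof.
move=> [n _ pn]; apply: (@xgetPex _ 0%N (is_len w)).
have ex : exists n, `[< powset A n w >] by exists n; apply/asboolP.
case: (ex_minnP ex) => k /asboolP pk kmin; exists k; split=> // j pj.
by apply: kmin; apply/asboolP.
Qed.

Let bad (u : nat -> M) := (forall n, N (u n)) /\ (forall n, u n < u n.+1).

Lemma minimal_bad : (exists u, bad u) -> exists v, bad v /\
  forall k w, bad w -> (forall i, (i < k)%N -> w i = v i) -> (len (v k) <= len (w k))%N.
Proof.
move=> [u0 bu0].
have /choice[F FP] (ku : nat * {u | bad u}) : exists v : {u | bad u},
    (forall i, (i < ku.1)%N -> sval v i = sval ku.2 i) /\
    forall w, bad w -> (forall i, (i < ku.1)%N -> w i = sval ku.2 i) ->
      (len (sval v ku.1) <= len (w ku.1))%N.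
  case: ku => k [u bu] /=.
  pose P l := exists2 v, bad v & (forall i, (i < k)%N -> v i = u i) /\ len (v k) = l.
  have ex : exists l, `[< P l >] by exists (len (u k)); apply/asboolP; exists u.
  case: (ex_minnP ex) => l /asboolP[v bv [vu vl]] lmin.
  exists (exist _ v bv); split=> // w bw wu /=; rewrite vl.
  by apply: lmin; apply/asboolP; exists w.
pose U := fix U n := if n is k.+1 then F (k.+1, U k)
                     else F (0%N, exist _ u0 bu0).
have agree1 n i : (i <= n)%N -> sval (U n.+1) i = sval (U n) i.
  by move=> le_in; case: (FP (n.+1, U n)) => /= + _; apply.
have agree n j i : (i <= n)%N -> (n <= j)%N -> sval (U j) i = sval (U n) i.
  move=> le_in /subnKC <-; elim: (j - n)%N => [|k IH]; first by rewrite addn0.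
  by rewrite addnS agree1// (leq_trans le_in)// leq_addr.
exists (fun n => sval (U n) n); split.
  split=> n; first by case: (svalP (U n)).
  rewrite -(agree n n.+1 n)//.
  by case: (svalP (U n.+1)).
case=> [|k] w bw wv.
  by case: (FP (0%N, exist _ u0 bu0)) => /= _; apply.
case: (FP (k.+1, U k)) => /= _; apply=> // i ik.
by rewrite wv// (agree i k i).
Qed.

Lemma genset_well_based : well_based N.
Proof.
apply: no_incr_well_based => u Nu uinc.
have [v [[Nv vinc] vmin]] : exists v, bad v /\ forall k w, bad w ->
    (forall i, (i < k)%N -> w i = v i) -> (len (v k) <= len (w k))%N.
  by apply: minimal_bad; exists u.
have /choice[st stP] n : exists st : M * M,
    [/\ A st.1, N st.2, v n = st.1 * st.2 & (len st.2 < len (v n))%N].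
  have := lenP (Nv n); case: (len (v n)) => [|l] [pl lmin].
    by have := vinc n; rewrite pl ltNge genset_le1.
  have [s [t [As pt vE]]] := pl.
  have Nt : N t by exists l.
  exists (s, t); split=> //=; rewrite ltnS.
  by case: (lenP Nt) => _; apply.
pose s n := (st n).1; pose t n := (st n).2.
have [phi [phiS sphi]] : exists phi : nat -> nat,
    (forall n, (phi n < phi n.+1)%N) /\ (forall n, s (phi n.+1) <= s (phi n)).
  by apply: nonincr_subseq wA _ => n; case: (stP n).
have phi_inc i j : (i < j)%N -> (phi i < phi j)%N.
  by apply: (@homo_ltn _ phi (fun x y => x < y)%N) => // ? ? ?; exact: ltn_trans.
have v_inc i j : (i < j)%N -> v i < v j.
  by apply: (@homo_ltn _ v (fun x y => x < y)) => // ? ? ?; exact: lt_trans.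
pose w i := if (i < phi 0)%N then v i else t (phi (i - phi 0)%N).
have bw : bad w.
  split=> n; rewrite /w; first by case: ifP => _ //; case: (stP (phi (n - phi 0)%N)).
  case: ltnP => [n0|n0].
    case: ltnP => // n1.
    have -> : (n.+1 - phi 0)%N = 0%N by apply/eqP; rewrite subn_eq0.
    apply: lt_le_trans (v_inc _ _ n0) _.
    case: (stP (phi 0)) => As _ -> _.
    by rewrite -[leRHS]mul1g oag_le2r ltW// A_lt1.
  rewrite ltnNge (leq_trans n0)//= subSn//; set i := (n - _)%N.
  have := v_inc _ _ (phiS i).
  case: (stP (phi i)) => _ _ -> _; case: (stP (phi i.+1)) => _ _ -> _.
  rewrite -/(s _) -/(t _) -/(s _) -/(t _) => lt.
  rewrite -(oag_lt2l (s (phi i))); apply: lt_le_trans lt _.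
  by rewrite oag_le2r.
have /(vmin (phi 0) w bw) : forall i, (i < phi 0)%N -> w i = v i.
  by move=> i i0; rewrite /w i0.
rewrite /w ltnn subnn leqNgt.
by case: (stP (phi 0)) => _ _ _ ->.
Qed.

Lemma genset_finite m : finite_set [set n | powset A n m].
Proof.
apply: contrapT => inf.
pose X := N `&` [set m | infinite_set [set n | powset A n m]].
have Xm : X m.
  split=> //; apply: contrapT => Nm; apply: inf.
  suff -> : [set n | powset A n m] = set0 by exact: finite_set0.
  by apply/seteqP; split=> // n pn; apply: Nm; exists n.
have [x [Nx Xx] xmax] := genset_well_based (@subIsetl _ _ _) (ex_intro _ _ Xm).
apply: Xx.
have fins := mulset_finite x wA genset_well_based.
apply: (@sub_finite_set _ _ ([set 0%N] `|`
  \bigcup_(s in A `&` [set a | N (a^-1 * x)])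
     [set n.+1 | n in [set n | powset A n (s^-1 * x)]])).
  case=> [|n]; first by left.
  move=> [s [v [As pv xE]]]; right.
  have sx : s^-1 * x = v by rewrite xE mulKg.
  exists s; first by split=> //=; rewrite sx; exists n.
  by exists n => //=; rewrite sx.
rewrite finite_setU; split=> //; apply: bigcup_finite => // s [As Ns].
apply: finite_image; apply: contrapT => infs.
have : X (s^-1 * x) by split.
move=> /xmax; rewrite leNgt; apply: negP; rewrite negbK.
by rewrite -(oag_lt2l s) mulVKg -[ltRHS]mul1g oag_lt2r A_lt1.
Qed.

End Neumann.

End OagTheory.

(* The sum of the r_i m_i over i < alpha is encoded by its coefficient function;
   alpha is the order type of the support under the reversed order. *)
Record hahnSeries (S : sizeClass) (R : realType) (d : Order.disp_t) (M : oagType d) :=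
  HahnSeries {
    hcoef :> M -> R;
    _ : small_set S [set m | hcoef m != 0];
    _ : well_based [set m | hcoef m != 0]
  }.

Definition supp S R d (M : oagType d) (f : hahnSeries S R M) : set M :=
  [set m | f m != 0].

Section SeriesRing.
Variables (S : sizeClass) (R : realType) (d : Order.disp_t) (M : oagType d).
Local Notation V := (hahnSeries S R M).
Implicit Types (f g h : V) (a b m : M).

HB.instance Definition _ := gen_eqMixin V.
HB.instance Definition _ := gen_choiceMixin V.

Lemma supp_small f : small_set S (supp f). Proof. by case: f. Qed.
Lemma supp_wb f : well_based (supp f). Proof. by case: f. Qed.

Lemma series_eqP f g : (forall m, f m = g m) -> f = g.
Proof.
case: f g => [f sf wf] [g sg wg] /= /funext fg; subst g.
by congr HahnSeries; exact: Prop_irrelevance.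
Qed.

Lemma suppPn f m : ~ supp f m -> f m = 0.
Proof. by rewrite /supp /= => /negP; rewrite negbK => /eqP. Qed.

Definition is_supp (A : set M) := small_set S A /\ well_based A.

Lemma mk_series_proof (c : M -> R) (A : set M) : is_supp A ->
  (forall m, c m != 0 -> A m) ->
  small_set S [set m | c m != 0] /\ well_based [set m | c m != 0].
Proof.
move=> [sA wA] cA; have cA' : [set m | c m != 0] `<=` A by [].
split; first exact: small_subset cA' sA.
exact: well_based_sub cA' wA.
Qed.

Definition mk_series (c : M -> R) (A : set M) (hA : is_supp A)
    (cA : forall m, c m != 0 -> A m) : V :=
  HahnSeries (mk_series_proof hA cA).1 (mk_series_proof hA cA).2.

Lemma is_supp_supp f : is_supp (supp f).
Proof. by split; [exact: supp_small|exact: supp_wb]. Qed.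

Lemma is_suppU A B : is_supp A -> is_supp B -> is_supp (A `|` B).
Proof.
by move=> [sA wA] [sB wB]; split; [exact: small_setU|exact: well_basedU].
Qed.

Lemma is_supp1 a : is_supp [set a].
Proof. by split; [exact: small_set1|exact: well_based1]. Qed.

Lemma small_mulset (A B : set M) :
  small_set S A -> small_set S B -> small_set S (mulset A B).
Proof.
move=> sA sB; have := small_image (fun p => p.1 * p.2)%g (small_setX sA sB).
by apply: small_subset => _ [a [b [Aa Bb ->]]]; exists (a, b).
Qed.

Lemma is_supp_mul A B : is_supp A -> is_supp B -> is_supp (mulset A B).
Proof.
by move=> [sA wA] [sB wB]; split; [exact: small_mulset|exact: well_based_mul].
Qed.

Lemma is_supp_gen A : is_supp A -> (forall a, A a -> (a < 1%g)%O) ->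
  is_supp (genset A).
Proof.
move=> [sA wA] A1; split; last exact: genset_well_based.
apply: small_bigcup; first exact: small_nat.
elim=> [|n IH] /=; first exact: small_set1.
exact: small_mulset.
Qed.

Fact add_series_subproof f g m : f m + g m != 0 -> (supp f `|` supp g) m.
Proof.
move=> fg; apply: contrapT => /not_orP[/suppPn fm /suppPn gm].
by move: fg; rewrite fm gm addr0 eqxx.
Qed.

Fact opp_series_subproof f m : - f m != 0 -> supp f m.
Proof. by rewrite oppr_eq0. Qed.

Fact monom_subproof (r : R) a m : (if m == a then r else 0) != 0 -> [set a] m.
Proof. by rewrite /=; case: (eqVneq m a) => // _; rewrite eqxx. Qed.

Definition hterm (r : R) a : V := mk_series (is_supp1 a) (@monom_subproof r a).

Definition add_series f g : V :=
  mk_series (is_suppU (is_supp_supp f) (is_supp_supp g)) (@add_series_subproof f g).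

Definition opp_series f : V :=
  mk_series (is_supp_supp f) (@opp_series_subproof f).

Definition zero_series : V := hterm 0 1%g.

Fact series_addA : associative add_series.
Proof. by move=> f g h; apply: series_eqP => m /=; rewrite addrA. Qed.
Fact series_addC : commutative add_series.
Proof. by move=> f g; apply: series_eqP => m /=; rewrite addrC. Qed.
Fact series_add0 : left_id zero_series add_series.
Proof. by move=> f; apply: series_eqP => m /=; rewrite if_same add0r. Qed.
Fact series_addN : left_inverse zero_series opp_series add_series.
Proof. by move=> f; apply: series_eqP => m /=; rewrite if_same addNr. Qed.

HB.instance Definition _ :=
  GRing.isZmodule.Build V series_addA series_addC series_add0 series_addN.

Lemma hcoef0 m : (0 : V) m = 0. Proof. by rewrite /= if_same. Qed.
Lemma hcoefD f g m : (f + g) m = f m + g m. Proof. by []. Qed.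
Lemma hcoefN f m : (- f) m = - f m. Proof. by []. Qed.
Lemma hcoefB f g m : (f - g) m = f m - g m. Proof. by []. Qed.
Lemma hcoef_term r a m : hterm r a m = if m == a then r else 0. Proof. by []. Qed.

(* a sum with finite support, by [mul_fin] *)
Definition mul_coef f g m : R := \sum_(a \in [set: M]) f a * g (a^-1 * m)%g.

Lemma mul_fin f g m :
  finite_set (supp f `&` [set a | supp g (a^-1 * m)%g]).
Proof. by apply: mulset_finite; exact: supp_wb. Qed.

Lemma mul_coefE f g m (F : set M) :
  (supp f `&` [set a | supp g (a^-1 * m)%g]) `<=` F ->
  mul_coef f g m = \sum_(a \in F) f a * g (a^-1 * m)%g.
Proof.
move=> sF; apply/esym/fsbig_widen => // a [_ Fa] /=.
apply: contrapT => /eqP; rewrite mulf_eq0 negb_or => /andP[fa ga].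
by apply: Fa; apply: sF.
Qed.

Fact mul_series_subproof f g m :
  mul_coef f g m != 0 -> mulset (supp f) (supp g) m.
Proof.
move=> fg; apply: contrapT => nm; move: fg.
rewrite (@mul_coefE f g m set0) ?fsbig_set0 ?eqxx// => a [fa ga]; apply: nm.
by exists a, (a^-1 * m)%g; split=> //; rewrite mulVKg.
Qed.

Definition mul_series f g : V :=
  mk_series (is_supp_mul (is_supp_supp f) (is_supp_supp g))
    (@mul_series_subproof f g).

Lemma inv_mul_bij m : bijective (fun a : M => a^-1 * m)%g.
Proof.
exists (fun b : M => m * b^-1)%g => a; first by rewrite invgM invgK mulVKg.
by rewrite invgM invgK -mulgA mulVg mulg1.
Qed.

Lemma mul_bij a : bijective (fun b : M => a^-1 * b)%g.
Proof. by exists (fun b : M => a * b)%g => b; rewrite ?mulVKg ?mulKg. Qed.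

Fact mul_seriesC : commutative mul_series.
Proof.
move=> f g; apply: series_eqP => m /=; rewrite /mul_coef.
rewrite (reindex_fsbigT _ _ (inv_mul_bij m)); apply: eq_fsbigr => a _.
by rewrite invgM invgK -mulgA [(a * m)%g]oagC mulKg mulrC.
Qed.

Fact mul_seriesDl : left_distributive mul_series add_series.
Proof.
move=> f g h; apply: series_eqP => m /=.
pose F := (supp f `&` [set a | supp h (a^-1 * m)%g]) `|`
          (supp g `&` [set a | supp h (a^-1 * m)%g]).
have Ffin : finite_set F by rewrite finite_setU; split; exact: mul_fin.
rewrite (@mul_coefE (add_series f g) h m F); last first.
  by move=> a [/add_series_subproof[fa|ga] ha]; [left|right].
rewrite (@mul_coefE f h m F) ?(@mul_coefE g h m F); last 2 first.
- exact: subsetUr.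
- exact: subsetUl.
rewrite -fsbig_split//; apply: eq_fsbigr => a _; exact: mulrDl.
Qed.

Definition one_series : V := hterm 1 1%g.

Lemma mul_termE (r : R) a f m : mul_series (hterm r a) f m = r * f (a^-1 * m)%g.
Proof.
rewrite /= (@mul_coefE _ _ _ [set a]); last first.
  by move=> b [] /monom_subproof.
by rewrite fsbig_set1 /= eqxx.
Qed.

Fact mul_series1 : left_id one_series mul_series.
Proof.
by move=> f; apply: series_eqP => m; rewrite mul_termE mul1r invg1 mul1g.
Qed.

Fact mul_seriesA : associative mul_series.
Proof.
move=> f g h; apply: series_eqP => m.
pose B := mulset (supp f) (supp g) `&` [set b | supp h (b^-1 * m)%g].
have finB : finite_set B.
  by apply: mulset_finite; [apply: well_based_mul|]; exact: supp_wb.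
pose A := \bigcup_(b in B) (supp f `&` [set a | supp g (a^-1 * b)%g]).
have finA : finite_set A by apply: bigcup_finite => // b _; exact: mul_fin.
transitivity (\sum_(a \in A) \sum_(b \in B)
     f a * (g (a^-1 * b)%g * h (b^-1 * m)%g)).
  rewrite /= (@mul_coefE _ _ _ A); last first.
    move=> a [fa /mul_series_subproof[c [e [gc he E]]]].
    exists (a * c)%g; last by split=> //=; rewrite mulKg.
    split; first by exists a, c.
    by rewrite /= invgM -mulgA E mulKg.
  apply: eq_fsbigr => a _.
  have [->|fa] := eqVneq (f a) 0.
    by rewrite mul0r fsbig1// => b _; rewrite mul0r.
  rewrite -fsbig_distrr//; congr (_ * _).
  rewrite /= /mul_coef (reindex_fsbigT _ _ (mul_bij a)).
  have -> : \sum_(b \in B) g (a^-1 * b)%g * h (b^-1 * m)%g =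
      \sum_(b \in [set: M]) g (a^-1 * b)%g * h (b^-1 * m)%g.
    apply: fsbig_widen => // b [_ nB] /=.
    apply: contrapT => /eqP; rewrite mulf_eq0 negb_or => /andP[gb hb].
    apply: nB; split=> //; exists a, (a^-1 * b)%g; split=> //.
    by rewrite mulVKg.
  apply: eq_fsbigr => b _; congr (_ * h _).
  by rewrite invgM invgK -mulgA mulVKg.
rewrite exchange_fsbig// /= (@mul_coefE _ _ _ B); last first.
  by move=> b [/mul_series_subproof].
apply: eq_fsbigr => b; rewrite inE => Bb.
rewrite /= (@mul_coefE f g b A); last first.
  by move=> a fga; exists b.
rewrite mulr_fsuml; apply: eq_fsbigr => a _; exact: mulrA.
Qed.

Fact one_series_neq0 : one_series != 0.
Proof.
apply/eqP => /(congr1 (fun f : V => f 1%g)); rewrite hcoef0 /= eqxx.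
by move/eqP; rewrite oner_eq0.
Qed.

HB.instance Definition _ := GRing.Zmodule_isComNzRing.Build V
  mul_seriesA mul_seriesC mul_series1 mul_seriesDl one_series_neq0.

Lemma hcoefM f g m : (f * g) m = \sum_(a \in [set: M]) f a * g (a^-1 * m)%g.
Proof. by []. Qed.

Lemma hcoefM_term r a f m : (hterm r a * f) m = r * f (a^-1 * m)%g.
Proof. exact: mul_termE. Qed.

(* leading monomial and leading coefficient; lmon 0 = 1 and lcoef 0 = 0 *)
Definition lmon f : M :=
  xget 1%g [set m | supp f m /\ forall n, supp f n -> (n <= m)%O].

Definition lcoef f : R := f (lmon f).

Lemma series_neq0 f : f != 0 -> supp f !=set0.
Proof.
move=> f0; apply: contrapT => nf; move/eqP: f0; apply.
apply: series_eqP => m; rewrite hcoef0; apply: suppPn => fm.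
by apply: nf; exists m.
Qed.

Lemma lmonP f : f != 0 ->
  supp f (lmon f) /\ forall n, supp f n -> (n <= lmon f)%O.
Proof.
move=> /series_neq0 f0; rewrite /lmon.
apply: (@xgetPex _ _ [set m | supp f m /\ forall n, supp f n -> (n <= m)%O]).
by have [m fm mmax] := @supp_wb f _ (@subset_refl _ _) f0; exists m.
Qed.

Lemma lcoef_eq0 f : (lcoef f == 0) = (f == 0).
Proof.
have [->|f0] := eqVneq f 0; first by rewrite /lcoef hcoef0 eqxx.
by have [/negPf -> _] := lmonP f0.
Qed.

Lemma hcoef_gt_lmon f m : (lmon f < m)%O -> f m = 0.
Proof.
have [->|f0] := eqVneq f 0; first by rewrite hcoef0.
move=> lt; apply: suppPn => /(lmonP f0).2; by rewrite leNgt lt.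
Qed.

Lemma lmon_eq f m : f m != 0 -> (forall n, (m < n)%O -> f n = 0) -> lmon f = m.
Proof.
move=> fm gt0; have f0 : f != 0.
  by apply: contraNneq fm => ->; rewrite hcoef0.
have [/= fl lmax] := lmonP f0; apply/eqP; rewrite eq_le (lmax m fm) andbT.
by rewrite leNgt; apply/negP => /gt0 E; rewrite /supp /= E eqxx in fl.
Qed.

Lemma hcoefM_lead f g : (f * g) (lmon f * lmon g)%g = lcoef f * lcoef g.
Proof.
have [->|f0] := eqVneq f 0; first by rewrite mul0r hcoef0 /lcoef hcoef0 mul0r.
rewrite hcoefM -/(mul_coef _ _ _) (@mul_coefE _ _ _ [set lmon f]).
  by rewrite fsbig_set1 mulKg.
move=> a [fa /= ga]; apply/eqP; rewrite eq_le (lmonP f0).2//=.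
rewrite leNgt; apply/negP => lt; move/eqP: ga; apply; apply: hcoef_gt_lmon.
by rewrite -(oag_lt2l a) mulVKg oag_lt2r.
Qed.

Lemma hcoefM_gt_lead f g m : (lmon f * lmon g < m)%O%g -> (f * g) m = 0.
Proof.
move=> lt; rewrite hcoefM -/(mul_coef _ _ _) (@mul_coefE _ _ _ set0).
  by rewrite fsbig_set0.
move=> a [fa ga]; move: lt; rewrite ltNge -[m](mulVKg a).
rewrite oag_leM// leNgt; apply/negP => /hcoef_gt_lmon E.
  by move: fa; rewrite /supp /= E eqxx.
by move: ga; rewrite /supp /= E eqxx.
Qed.

Lemma lcoefM f g : lcoef (f * g) = lcoef f * lcoef g.
Proof.
have [->|f0] := eqVneq f 0; first by rewrite mul0r /lcoef !hcoef0 mul0r.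
have [->|g0] := eqVneq g 0; first by rewrite mulr0 /lcoef !hcoef0 mulr0.
rewrite -hcoefM_lead {1}/lcoef; congr (_ _); apply: lmon_eq.
  by rewrite hcoefM_lead mulf_eq0 !lcoef_eq0 (negPf f0).
exact: hcoefM_gt_lead.
Qed.

Lemma one_sub_inv (e : V) : (forall m, supp e m -> (m < 1%g)%O) ->
  exists y : V, y * (1 - e) = 1.
Proof.
move=> e1; pose G := genset (supp e).
have hG : is_supp G by apply: is_supp_gen => //; exact: is_supp_supp.
have pow_supp n m : (e ^+ n) m != 0 -> powset (supp e) n m.
  elim: n m => [|n IH] m; first by rewrite expr0 => /monom_subproof.
  rewrite exprS => /mul_series_subproof[a [b [ea eb ->]]].
  by exists a, b; split=> //; exact: IH.
have fin m := genset_finite (@supp_wb e) e1 m.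
pose c m := \sum_(n \in [set: nat]) (e ^+ n) m.
have cE m (F : set nat) : [set n | powset (supp e) n m] `<=` F ->
    c m = \sum_(n \in F) (e ^+ n) m.
  move=> sF; apply/esym/fsbig_widen => // n [_ Fn] /=.
  by apply: contrapT => /eqP /pow_supp /sF.
have cG m : c m != 0 -> G m.
  move=> cm; apply: contrapT => Gm; move: cm.
  rewrite (@cE m set0) ?fsbig_set0 ?eqxx// => n pn.
  by apply: Gm; exists n.
pose y := mk_series hG cG.
exists y; rewrite mulrBr mulr1; apply: series_eqP => m.
rewrite [y * e]mulrC.
pose A := supp e `&` [set a | G (a^-1 * m)%g].
have finA : finite_set A.
  by apply: mulset_finite; [exact: supp_wb|exact: hG.2].
pose N := [set n | powset (supp e) n m] `|`
  \bigcup_(a in A) [set n | powset (supp e) n (a^-1 * m)%g].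
have finN : finite_set N.
  by rewrite finite_setU; split=> //; apply: bigcup_finite.
have [k Nk] : exists k, forall n, N n -> (n < k)%N.
  have /finite_seqP[s Ns] := finN; exists (\max_(n <- s) n).+1 => n.
  by rewrite Ns /= => sn; rewrite ltnS; exact: (@leq_bigmax_seq _ s xpredT id).
pose P := \sum_(n < k) e ^+ n.
have PE b : [set n | powset (supp e) n b] `<=` N -> c b = P b.
  move=> bN; rewrite (@cE b `I_k); last by move=> n /bN /Nk.
  rewrite -fsbig_ord /P; elim/big_rec2 : _ => [|n x z _ ->]; first by rewrite hcoef0.
  by rewrite hcoefD.
have -> : (y - e * y) m = (P - e * P) m.
  rewrite !hcoefB; congr (_ - _).
    by rewrite -PE//; exact: subsetUl.
  rewrite !hcoefM -!/(mul_coef _ _ _) !(@mul_coefE _ _ _ A).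
  - apply: eq_fsbigr => a; rewrite inE => Aa; congr (_ * _).
    by rewrite -PE// => n pn; right; exists a.
  - move=> a [ea Pa]; split=> //=; apply: contrapT => nG; move: Pa.
    rewrite /supp /= -PE => [Pa|n pn]; first exact: nG (cG _ Pa).
    by exfalso; apply: nG; exists n.
  - by move=> a [ea ya]; split=> //=; exact: (cG _ ya).
have -> : P - e * P = 1 - e ^+ k.
  by rewrite -[X in X - _ = _]mul1r -mulrBl -opprB mulNr -subrX1 opprB.
rewrite hcoefB; suff -> : (e ^+ k) m = 0 by rewrite subr0.
apply: contrapT => /eqP /pow_supp pk.
by have := Nk k (or_introl pk); rewrite ltnn.
Qed.

Lemma series_has_inv f : f != 0 -> exists g, g * f = 1.
Proof.
move=> f0; have [fl lmax] := lmonP f0.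
pose t := hterm (lcoef f)^-1 (lmon f)^-1%g.
have l0 : lcoef f != 0 by rewrite lcoef_eq0.
have [|y ye] := @one_sub_inv (1 - t * f).
  move=> m tm; have {}tm : (1 - t * f) m != 0 by [].
  rewrite ltNge; apply/negP => m1; move: tm.
  rewrite hcoefB hcoefM_term invgK.
  move: m1; rewrite le_eqVlt => /predU1P[<-|m1].
    by rewrite mulg1 mulVf// [(1 : V) _]hcoef_term eqxx subrr eqxx.
  rewrite [f _]hcoef_gt_lmon ?mulr0 ?subr0; last by rewrite -{1}[lmon f]mulg1 oag_lt2l.
  by rewrite [(1 : V) _]hcoef_term (gt_eqF m1) eqxx.
exists (y * t); rewrite -mulrA -[RHS]ye; congr (_ * _).
by rewrite opprB addrC subrK.
Qed.

Definition inv_series f : V :=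
  if f == 0 then 0 else xget 0 [set g | g * f = 1].

Fact inv_seriesP f : f != 0 -> inv_series f * f = 1.
Proof.
move=> f0; rewrite /inv_series (negPf f0).
exact: (@xgetPex _ _ [set g | g * f = 1] (series_has_inv f0)).
Qed.

Fact inv_series0 : inv_series 0 = 0.
Proof. by rewrite /inv_series eqxx. Qed.

HB.instance Definition _ :=
  GRing.ComNzRing_isField.Build V inv_seriesP inv_series0.

Definition lt_series f g : bool := 0 < lcoef (g - f).
Definition le_series f g : bool := (f == g) || lt_series f g.
Definition norm_series f : V := if le_series 0 f then f else - f.

Lemma lcoefN f : lcoef (- f) = - lcoef f.
Proof.
have [->|f0] := eqVneq f 0; first by rewrite oppr0 /lcoef !hcoef0 oppr0.
suff E : lmon (- f) = lmon f by rewrite /lcoef E hcoefN.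
apply: lmon_eq => [|n lt]; rewrite hcoefN ?oppr_eq0 ?lcoef_eq0//.
by rewrite hcoef_gt_lmon ?oppr0.
Qed.

Fact lt0_series f : lt_series 0 f = (0 < lcoef f).
Proof. by rewrite /lt_series subr0. Qed.

Fact lt_series0 f : lt_series f 0 = (lcoef f < 0).
Proof. by rewrite /lt_series sub0r lcoefN oppr_gt0. Qed.

Fact lt_series_add f g : lt_series 0 f -> lt_series 0 g -> lt_series 0 (f + g).
Proof.
rewrite !lt0_series; wlog le_fg : f g / (lmon f <= lmon g)%O => [hw|] pf pg.
  have [|/ltW] := leP (lmon f) (lmon g); first by move=> /hw; apply.
  by move=> /hw; rewrite [f + g]addrC; apply.
have fg : 0 < (f + g) (lmon g).
  rewrite hcoefD ltr_wpDl//; move: le_fg; rewrite le_eqVlt => /predU1P[<-|lt].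
    exact: ltW.
  by rewrite hcoef_gt_lmon.
suff E : lmon (f + g) = lmon g by rewrite /lcoef E.
apply: lmon_eq => [|n lt]; first exact: lt0r_neq0.
by rewrite hcoefD !hcoef_gt_lmon ?addr0// (le_lt_trans le_fg).
Qed.

Fact lt_series_mul f g : lt_series 0 f -> lt_series 0 g -> lt_series 0 (f * g).
Proof. by rewrite !lt0_series lcoefM; exact: mulr_gt0. Qed.

Fact lt_series_ngt f : lt_series 0 f -> ~~ lt_series f 0.
Proof. by rewrite lt0_series lt_series0 -leNgt => /ltW. Qed.

Fact lt_series_sub f g : lt_series 0 (g - f) = lt_series f g.
Proof. by rewrite lt0_series. Qed.

Fact lt_series_total f : f != 0 -> lt_series 0 f || lt_series f 0.
Proof. by rewrite lt0_series lt_series0 -lcoef_eq0 orbC -neq_lt. Qed.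

Fact norm_seriesN f : norm_series (- f) = norm_series f.
Proof.
rewrite /norm_series /le_series !lt0_series lcoefN oppr_gt0 ![0 == _]eq_sym.
have [->|f0] := eqVneq f 0; first by rewrite !oppr0 eqxx.
rewrite oppr_eq0 (negPf f0) /=; move: f0; rewrite -lcoef_eq0.
by case: ltgtP => //= _ _; rewrite opprK.
Qed.

Fact norm_series_ge0 f : le_series 0 f -> norm_series f = f.
Proof. by rewrite /norm_series => ->. Qed.

HB.instance Definition _ := Num.IntegralDomain_isLtReal.Build V
  lt_series_add lt_series_mul lt_series_ngt lt_series_sub lt_series_total
  norm_seriesN norm_series_ge0 (fun _ _ => erefl).

End SeriesRing.

Section Dominance.
Variable K : realFieldType.
Implicit Types a b : K.

Definition dominated a b : Prop := exists n : nat, `|a| <= n%:R * `|b|.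

Definition asymp_eq a b : Prop := dominated a b /\ dominated b a.

End Dominance.

Section Summation.
Variables (S : sizeClass) (R : realType) (d : Order.disp_t) (M : oagType d).
Local Notation V := (hahnSeries S R M).

Definition const (r : R) : V := hterm S r 1%g.

Definition monomial (m : M) : V := hterm S 1 m.

Definition summable_family (I : choiceType) (F : I -> V) : Prop :=
  [/\ small_set S (\bigcup_i supp (F i)),
      well_based (\bigcup_i supp (F i)) &
      forall m, finite_set [set i | supp (F i) m]].

Definition sums_to (I : choiceType) (F : I -> V) (s : V) : Prop :=
  summable_family F /\ forall m, s m = \sum_(i \in [set: I]) F i m.

(* total version of the infinite sum, with value 0 on non-summable families *)
Definition infsum (I : choiceType) (F : I -> V) : V :=
  xget 0 [set s | sums_to F s].

Definition purely_infinite : set V :=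
  [set g | forall m, supp g m -> (1%g < m)%O].

Definition above_reals (x : V) : Prop := forall r : R, const r < x.

End Summation.

Arguments const {S R d M} r.
Arguments monomial {S R d M} m.

Record transseriesField (S : sizeClass) (R : realType) := TransseriesField {
  mdisp : Order.disp_t;
  mon : oagType mdisp;
  mlog : mon -> hahnSeries S R mon;
  mlogM : forall m n, mlog (m * n)%g = mlog m + mlog n;
  mlog_le : forall m n, (mlog m <= mlog n) = (m <= n)%O;
  mlog_range : range mlog = @purely_infinite _ _ _ _;
  mlog_growth : forall (m : mon) (n : nat),
    (1%g < m)%O -> mlog m ^+ n < monomial m
}.

Definition carrier S R (V : transseriesField S R) : Type := hahnSeries S R (mon V).
Coercion carrier : transseriesField >-> Sortclass.

Section Transseries.
Variables (S : sizeClass) (R : realType) (V : transseriesField S R).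
Implicit Types (f g : V) (m : mon V).

(* meaningful for f > 0 only *)
Definition tlog f : V :=
  let eps := f / hterm S (lcoef f) (lmon f) - 1 in
  mlog (lmon f) + const (ln (lcoef f)) +
  infsum (fun n : nat => const ((-1) ^+ n / n.+1%:R) * eps ^+ n.+1).

(* inverse of the bijection [tlog] from the positive elements onto V *)
Definition texp f : V := xget 0 [set g : V | 0 < g /\ tlog g = f].

Definition log_atomic m : Prop :=
  (1%g < m)%O /\
  forall n : nat, exists a : mon V, iter n tlog (monomial m) = monomial a.

End Transseries.

Section OmegaSeries.
Variables (S : sizeClass) (R : realType) (V : transseriesField S R) (t : mon V).
Implicit Types (f g : V) (m : mon V).

(* omega-series in T = [monomial t], for t log-atomic.  A normal form is the
   sum of its own terms, so closure under such sums is [omega_sum]. *)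
Inductive omega_series : V -> Prop :=
  | omega_const (r : R) : omega_series (const r)
  | omega_var : omega_series (monomial t)
  | omega_exp f : omega_series f -> omega_series (texp f)
  | omega_log f : 0 < f -> omega_series f -> omega_series (tlog f)
  | omega_sum f :
      (forall m, supp f m -> omega_series (monomial m)) -> omega_series f.

(* the group J of purely infinite omega-series *)
Definition omega_J : set V :=
  [set g | forall m, supp g m -> (1%g < m)%O /\ omega_series (monomial m)].

(* Maps on the subclass of omega-series are represented by maps on the whole
   field whose values elsewhere are unconstrained. *)
Record is_omega_derivation (D : V -> V) : Prop := IsOmegaDerivation {
  omega_deriv_closed : forall f, omega_series f -> omega_series (D f);
  omega_derivD : forall f g, omega_series f -> omega_series g -> D (f + g) = D f + D g;
  omega_derivM : forall f g, omega_series f -> omega_series g ->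
    D (f * g) = D f * g + f * D g;
  omega_deriv_var : D (monomial t) = 1;
  omega_deriv_exp : forall g, omega_J g -> D (texp g) = texp g * D g;
  omega_deriv_sum : forall f, omega_series f ->
    sums_to (fun m : mon V => const (f m) * D (monomial m)) (D f)
}.

Variable U : transseriesField S R.

(* f o x is [comp f x]; as for derivations, only omega-series f matter, and only
   x > R.  The three conditions determine f o x for such f and x. *)
Record is_omega_composition (comp : V -> U -> U) : Prop := IsOmegaComposition {
  omega_comp_var : forall x, above_reals x -> comp (monomial t) x = x;
  omega_comp_exp : forall g x, omega_J g -> above_reals x ->
    comp (texp g) x = texp (comp g x);
  omega_comp_sum : forall f x, omega_series f -> above_reals x ->
    sums_to (fun m : mon V => const (f m) * comp (monomial m) x) (comp f x)
}.

End OmegaSeries.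

(* Main.v *)
(* Composition at x is an embedding of ordered fields, because positive
   omega-series have square roots.  On monomials the derivation is monotone for
   dominance (m < n and n <> 1 imply that m' is dominated strictly by n'); this is
   shown by closing a set of monomials under exponentiation.

   The Taylor remainder of f is a strongly linear map of f, so it suffices to bound
   the remainder of each monomial m in the support of f by f^(n)(x) delta^n.  If
   m'/m delta is bounded at x, write m = e^g: every monomial of g satisfies the same
   condition, so by structural induction the remainder of g is controlled, and the
   exponential of the Taylor polynomial of g gives that of m.  The induction starts
   at the iterated logarithms of T, where the step from m to log m inverts the
   exponential one.  If m'/m delta is unbounded at x, it is also unbounded at
   x + delta, and then m is already small enough at both points.  Finally,
   the bounds obtained for m are compared with its n-th derivative; this is where
   powers of T are exceptional. *)

Require Import Defs.
From mathcomp Require Import all_boot all_order all_algebra.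
From mathcomp Require Import all_classical all_reals sequences exp.
From mathcomp Require Import ring.
Set Implicit Arguments.
Unset Strict Implicit.
Unset Printing Implicit Defensive.
Import Order.TTheory GRing.Theory Num.Theory.
Local Open Scope classical_set_scope.
Local Open Scope ring_scope.

(** The condition on f'/f does not pass to the monomials of f: a smaller m may have a larger
    logarithmic derivative, as e^(-e^T) has against 1/T. Hence two kinds of terms. What all m ≼ f
    share is m^(n) ≼ f^(n), and powers of T would destroy this: differentiation is monotone only
    below a g that is not of the size of 1, and T^k reaches that size after k derivations. The
    induction over log m carries two parameters. K bounds at x all logarithmic derivatives that
    occur, and also 1/x, because log T and its iterated logarithms have derivatives ≼ 1/T; w bounds
    the first derivative and becomes m(x) w under exponentiation. The bound w K^j for Taylor
    coefficients of order j + 1 is stable under products because w ≼ K. A composition is only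
    assumed to respect infinite sums and exponentials of purely infinite series; multiplicativity is
    deduced from strong linearity and the laws of exp. Estimates of iterated derivatives involve
    only dominance, so they are proved for abstract ordered fields, where x and x + delta can
    exchange roles, with -delta in place of delta. *)

Local Notation "a <~ b" := (dominated a b) (at level 70, no associativity) : ring_scope.
(** Strict dominance is the failure of the reverse dominance; the order being total, it implies
    [a <~ b], and it forces [b] to be non-zero. *)
Local Notation "a <<~ b" := (~ dominated b a) (at level 70, no associativity) : ring_scope.
Local Notation "a >~< b" := (asymp_eq a b) (at level 70, no associativity) : ring_scope.

(** * Calculus of dominance in an ordered field *)

Section DominanceTheory.
Variable K : realFieldType.
Implicit Types a b c d : K.

Lemma domP a b : a <~ b <-> exists n : nat, `|a| <= n%:R * `|b|.
Proof. by []. Qed.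

Lemma dom_le a b : `|a| <= `|b| -> a <~ b.
Proof. by exists 1%N; rewrite mul1r. Qed.

Lemma dom_refl a : a <~ a.
Proof. exact: dom_le. Qed.
Hint Resolve dom_refl : core.

Lemma dom_trans b a c : a <~ b -> b <~ c -> a <~ c.
Proof.
move=> [m am] [n bn]; exists (m * n)%N; rewrite natrM -mulrA.
by apply: le_trans am _; rewrite ler_wpM2l.
Qed.

Lemma dom0l a : 0 <~ a.
Proof. by apply: dom_le; rewrite normr0. Qed.
Hint Resolve dom0l : core.

Lemma dom0r a : a <~ 0 -> a = 0.
Proof. by move=> [n]; rewrite normr0 mulr0 normr_le0 => /eqP. Qed.

Lemma dom_total a b : a <~ b \/ b <~ a.
Proof.
by have /orP[|] := le_total `|a| `|b| => h; [left|right]; exact: dom_le.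
Qed.

Lemma sdomW a b : a <<~ b -> a <~ b.
Proof. by have [|] := dom_total a b. Qed.

Lemma domM a b c d : a <~ b -> c <~ d -> a * c <~ b * d.
Proof.
move=> [m am] [n bn]; exists (m * n)%N.
by rewrite !normrM natrM mulrACA ler_pM.
Qed.

Lemma domMl c a b : a <~ b -> c * a <~ c * b.
Proof. exact: domM. Qed.

Lemma domMr c a b : a <~ b -> a * c <~ b * c.
Proof. by move=> ab; apply: domM. Qed.

Lemma domD a b c : a <~ c -> b <~ c -> a + b <~ c.
Proof.
move=> [m am] [n bn]; exists (m + n)%N.
by rewrite natrD mulrDl (le_trans (ler_normD _ _))// lerD.
Qed.

Lemma domN a b : a <~ b -> - a <~ b.
Proof. by move=> [n h]; exists n; rewrite normrN. Qed.

Lemma domNr a b : a <~ b -> a <~ - b.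
Proof. by move=> [n h]; exists n; rewrite normrN. Qed.

Lemma domB a b c : a <~ c -> b <~ c -> a - b <~ c.
Proof. by move=> ac bc; apply: domD => //; apply: domN. Qed.

Lemma dom_sum I (r : seq I) (P : pred I) (F : I -> K) b :
  (forall i, P i -> F i <~ b) -> \sum_(i <- r | P i) F i <~ b.
Proof. by move=> Fb; elim/big_rec: _ => // i s Pi sb; apply: domD => //; exact: Fb. Qed.

Lemma domX n a b : a <~ b -> a ^+ n <~ b ^+ n.
Proof. by move=> ab; elim: n => [|n IH]; rewrite ?expr0// !exprS; apply: domM. Qed.

Lemma domMnl n a b : a <~ b -> a *+ n <~ b.
Proof.
by move=> ab; elim: n => [|n IH]; rewrite ?mulr0n// mulrSr; apply: domD.
Qed.

Lemma dom_nat n : n%:R <~ (1 : K).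
Proof. exact: domMnl. Qed.


Lemma dom_mul2l c a b : c != 0 -> c * a <~ c * b -> a <~ b.
Proof.
by move=> c0 /(domMl c^-1); rewrite !mulKf.
Qed.

Lemma dom_mul2r c a b : c != 0 -> a * c <~ b * c -> a <~ b.
Proof. by move=> c0; rewrite ![_ * c]mulrC; exact: dom_mul2l. Qed.

Lemma dom_neq0 a b : a <~ b -> a != 0 -> b != 0.
Proof. by move=> ab; apply: contra_neq => b0; move: ab; rewrite b0 => /dom0r. Qed.

Lemma sdom_neq0 a b : a <<~ b -> b != 0.
Proof. by move=> ab; apply/eqP => b0; apply: ab; rewrite b0. Qed.

Lemma domV a b : a != 0 -> a <~ b -> b^-1 <~ a^-1.
Proof.
move=> a0 ab; have b0 := dom_neq0 ab a0.
apply: (@dom_mul2l (a * b)); first exact: mulf_neq0.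
by rewrite mulfK// mulrAC divff// mul1r.
Qed.

Lemma dom_sdom_trans b a c : a <~ b -> b <<~ c -> a <<~ c.
Proof. by move=> ab bc ca; apply: bc; apply: dom_trans ab. Qed.

Lemma sdom_dom_trans b a c : a <<~ b -> b <~ c -> a <<~ c.
Proof. by move=> ab bc ca; apply: ab; apply: dom_trans ca. Qed.

Lemma sdomD a b c : a <<~ c -> b <<~ c -> a + b <<~ c.
Proof.
move=> ac bc; have [ab|ba] := dom_total a b => h.
- by apply: bc; apply: dom_trans h (domD _ _).
- by apply: ac; apply: dom_trans h (domD _ _).
Qed.

Lemma sdomN a b : a <<~ b -> - a <<~ b.
Proof. by move=> ab /domNr; rewrite opprK. Qed.

Lemma sdomB a b c : a <<~ c -> b <<~ c -> a - b <<~ c.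
Proof. by move=> ac bc; apply: sdomD => //; apply: sdomN. Qed.

Lemma sdomM a b c d : a <<~ b -> c <<~ d -> a * c <<~ b * d.
Proof.
move=> ab cd; have b0 := sdom_neq0 ab; have d0 := sdom_neq0 cd => h.
apply: cd; apply: (dom_mul2l b0); apply: dom_trans h _; apply: domMr.
exact: sdomW.
Qed.

Lemma sdomMl c a b : c != 0 -> a <<~ b -> c * a <<~ c * b.
Proof. by move=> c0 ab /(dom_mul2l c0). Qed.

Lemma sdomMr c a b : c != 0 -> a <<~ b -> a * c <<~ b * c.
Proof. by move=> c0 ab /(dom_mul2r c0). Qed.


Lemma asymp_refl a : a >~< a. Proof. by []. Qed.

Lemma asymp_sym a b : a >~< b -> b >~< a. Proof. by case. Qed.

Lemma asymp_trans b a c : a >~< b -> b >~< c -> a >~< c.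
Proof. by move=> [ab ba] [bc cb]; split; [exact: dom_trans bc|exact: dom_trans ba]. Qed.

Lemma asympM a b c d : a >~< b -> c >~< d -> a * c >~< b * d.
Proof. by move=> [ab ba] [bc cb]; split; apply: domM. Qed.


Lemma asymp_neq0 a b : a >~< b -> a != 0 -> b != 0.
Proof. by move=> [/dom_neq0 h _]. Qed.

Lemma asympV a b : a >~< b -> a != 0 -> a^-1 >~< b^-1.
Proof. by move=> ab a0; split; apply: domV; case: ab => // /dom_neq0 ->. Qed.

Lemma asympDl a b : a <<~ b -> a + b >~< b.
Proof.
move=> ab; split; first by apply: domD => //; exact: sdomW.
have [//|h] := dom_total b (a + b).
apply: contrapT => nb; have : (a + b) - a <<~ b by apply: sdomB.
by rewrite addrC addKr; apply.
Qed.

Lemma asympDr a b : a <<~ b -> b + a >~< b.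
Proof. by rewrite addrC; exact: asympDl. Qed.

Lemma asympN a : - a >~< a.
Proof. by split; [exact: domN|exact: domNr]. Qed.

Lemma sdomX n a b : a <<~ b -> (0 < n)%N -> a ^+ n <<~ b ^+ n.
Proof.
move=> ab; case: n => // n _; elim: n => [|n IH]; first by rewrite !expr1.
by rewrite [a ^+ _]exprS [b ^+ _]exprS; apply: sdomM.
Qed.

Lemma sdom1_nasymp a : 1 <<~ a -> ~ a >~< 1.
Proof. by move=> h []. Qed.

Lemma natr_asymp n : (0 < n)%N -> n%:R >~< (1 : K).
Proof.
move=> n0; split; first exact: dom_nat.
by apply: dom_le; rewrite normr1 normr_nat ler1n.
Qed.


End DominanceTheory.
#[export] Hint Resolve dom_refl dom0l asymp_refl : core.
(* [dominated] and the series operations are sealed: comparing two series by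
   unfolding down to their coefficients does not terminate in practice. *)
Opaque dominated.

(** * Dominance of Hahn series through leading monomials *)

Section HahnDominance.
Variables (S : sizeClass) (R : realType) (d : Order.disp_t) (M : oagType d).
Local Notation H := (hahnSeries S R M).
Implicit Types (f g h : H) (a b m n : M) (r : R).

Lemma series_gt0 f : (0 < f) = (0 < lcoef f).
Proof. exact: lt0_series. Qed.

Lemma supp0 m : ~ supp (0 : H) m.
Proof. by rewrite /supp /= if_same eqxx. Qed.

Lemma supp_neq0 f m : supp f m -> f != 0.
Proof. by move=> fm; apply/eqP => f0; rewrite f0 in fm; exact: supp0 fm. Qed.

Lemma hcoef_sum I (s : seq I) (P : pred I) (F : I -> H) m :
  (\sum_(i <- s | P i) F i) m = \sum_(i <- s | P i) F i m.
Proof. by elim/big_rec2: _ => [|i x y Pi <-]; rewrite ?hcoef0. Qed.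

Lemma hcoefMn f k m : (f *+ k) m = f m *+ k.
Proof. by elim: k => [|k IH]; rewrite ?mulr0n ?hcoef0// !mulrS hcoefD IH. Qed.

Lemma hcoef_const r f m : (const r * f) m = r * f m.
Proof. by rewrite hcoefM_term invg1 mul1g. Qed.

Lemma hcoef_monomial a f m : (monomial a * f) m = f (a^-1 * m)%g.
Proof. by rewrite hcoefM_term mul1r. Qed.

Lemma lmon_term r a : r != 0 -> lmon (hterm S r a) = a.
Proof.
move=> r0; apply: lmon_eq => [|n an]; first by rewrite hcoef_term eqxx.
by rewrite hcoef_term (gt_eqF an).
Qed.

Lemma lcoef_term r a : lcoef (hterm S r a) = r.
Proof.
have [->|r0] := eqVneq r 0; first by rewrite /lcoef hcoef_term if_same.
by rewrite /lcoef lmon_term// hcoef_term eqxx.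
Qed.

Lemma term_eq0 r a : (hterm S r a == 0) = (r == 0).
Proof. by rewrite -lcoef_eq0 lcoef_term. Qed.

Lemma lmonM f g : f != 0 -> g != 0 -> lmon (f * g) = (lmon f * lmon g)%g.
Proof.
move=> f0 g0; apply: lmon_eq; last by move=> n; exact: hcoefM_gt_lead.
by rewrite hcoefM_lead mulf_neq0// lcoef_eq0.
Qed.

Lemma lmonN f : lmon (- f) = lmon f.
Proof.
have [->|f0] := eqVneq f 0; first by rewrite oppr0.
apply: lmon_eq => [|n lt]; first by rewrite hcoefN oppr_eq0 lcoef_eq0.
by rewrite hcoefN hcoef_gt_lmon ?oppr0.
Qed.

Lemma lmon_norm f : lmon `|f| = lmon f.
Proof. by case: (ger0P f); rewrite ?lmonN. Qed.

Lemma lcoef_norm f : lcoef `|f| = `|lcoef f|.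
Proof.
have [f0|f0] := ger0P f.
  rewrite ger0_norm//; move: f0; rewrite le_eqVlt => /predU1P[<-|].
    by rewrite /lcoef hcoef0.
  by rewrite series_gt0 => /ltW.
rewrite lcoefN ler0_norm//.
by move: f0; rewrite -oppr_gt0 series_gt0 lcoefN oppr_gt0 => /ltW.
Qed.

Lemma lmonMn f k : (0 < k)%N -> lmon (f *+ k) = lmon f.
Proof.
move=> k0; have [->|f0] := eqVneq f 0; first by rewrite mul0rn.
apply: lmon_eq => [|n lt]; first by rewrite hcoefMn mulrn_eq0 lcoef_eq0 negb_or -lt0n k0.
by rewrite hcoefMn hcoef_gt_lmon ?mul0rn.
Qed.

Lemma lmon_lt_le f g : 0 < g -> (lmon f < lmon g)%O -> f < g.
Proof.
move=> g0 lt; rewrite -subr_gt0 series_gt0 /lcoef.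
have gl : 0 < (g - f) (lmon g).
  by rewrite hcoefB (hcoef_gt_lmon lt) subr0 -/(lcoef g) -series_gt0.
rewrite (@lmon_eq _ _ _ _ _ (lmon g))//; first exact: lt0r_neq0.
by move=> n ln; rewrite hcoefB !hcoef_gt_lmon ?subr0// (lt_trans lt).
Qed.

Lemma dom_lmon f g : g != 0 -> f != 0 -> f <~ g <-> (lmon f <= lmon g)%O.
Proof.
move=> g0 f0; split=> [/domP[k fg]|fg].
  rewrite leNgt; apply/negP => lt; have k0 : (0 < k)%N.
    case: k fg => // ; rewrite mul0r normr_le0 => /eqP f1.
    by rewrite f1 eqxx in f0.
  move: fg; apply/negP; rewrite -ltNge; apply: lmon_lt_le; first by rewrite normr_gt0.
  by rewrite mulr_natl lmonMn// !lmon_norm.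
have lg : 0 < `|lcoef g| by rewrite normr_gt0 lcoef_eq0.
(* The ratio of the real leading coefficients is bounded by an integer; the successor keeps [k]
   positive. *)
pose k := (Num.bound (`|lcoef f| / `|lcoef g|)).+1.
apply/domP; exists k; rewrite mulr_natl.
move: fg; rewrite le_eqVlt => /predU1P[E|lt]; last first.
  by rewrite ltW// lmon_lt_le ?pmulrn_lgt0 ?normr_gt0// lmonMn// !lmon_norm.
have P : 0 < (`|g| *+ k - `|f|) (lmon g).
  have gE : `|g| (lmon g) = `|lcoef g| by rewrite -lcoef_norm /lcoef lmon_norm.
  have fE : `|f| (lmon g) = `|lcoef f| by rewrite -lcoef_norm /lcoef lmon_norm E.
  rewrite hcoefB hcoefMn gE fE subr_gt0 -[ltRHS]mulr_natl -ltr_pdivrMr//.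
  apply: lt_trans (archi_boundP _) _; first by rewrite divr_ge0.
  by rewrite ltr_nat.
rewrite -subr_ge0 ltW// series_gt0 /lcoef (@lmon_eq _ _ _ _ _ (lmon g))//.
  exact: lt0r_neq0.
move=> n ln.
have gn : `|g| n = 0 by apply: hcoef_gt_lmon; rewrite lmon_norm.
have fn : `|f| n = 0 by apply: hcoef_gt_lmon; rewrite lmon_norm E.
by rewrite hcoefB hcoefMn gn fn mul0rn subr0.
Qed.

Lemma monomial_neq0 m : monomial m != 0 :> H.
Proof. by rewrite term_eq0 oner_eq0. Qed.

Lemma lmon_monomial m : lmon (monomial m : H) = m.
Proof. by rewrite lmon_term ?oner_eq0. Qed.

Lemma lcoef_monomial m : lcoef (monomial m : H) = 1.
Proof. exact: lcoef_term. Qed.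

Lemma monomial_gt0 m : 0 < (monomial m : H).
Proof. by rewrite series_gt0 lcoef_monomial. Qed.

Lemma dom_monomial a b : (monomial a : H) <~ monomial b <-> (a <= b)%O.
Proof. by rewrite dom_lmon ?monomial_neq0// !lmon_monomial. Qed.

Lemma sdom_monomial a b : (monomial a : H) <<~ monomial b <-> (a < b)%O.
Proof. by rewrite dom_monomial ltNge; split=> /negP. Qed.

Lemma asymp_lmon f : f != 0 -> f >~< monomial (lmon f).
Proof.
by move=> f0; split; apply/dom_lmon; rewrite ?monomial_neq0 ?lmon_monomial.
Qed.

(** Dominance depends on leading monomials alone, so it can be tested monomial by monomial, without
    uniform multipliers. All termwise bounds of infinite sums rest on this. *)
Lemma dom_supp f g : f <~ g <-> (forall m, supp f m -> monomial m <~ g).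
Proof.
split=> [fg m fm|fg].
  have f0 := supp_neq0 fm.
  apply: dom_trans fg; apply: dom_trans (asymp_lmon f0).2.
  by apply/dom_monomial; exact: (lmonP f0).2.
have [->//|f0] := eqVneq f 0.
by apply: dom_trans (asymp_lmon f0).1 _; apply: fg; exact: (lmonP f0).1.
Qed.

Lemma sdom_supp f g : g != 0 ->
  (forall m, supp f m -> monomial m <<~ g) -> f <<~ g.
Proof.
move=> g0 fg; have [->|f0] := eqVneq f 0; first by move=> /dom0r /eqP; apply/negP.
by apply: dom_sdom_trans (asymp_lmon f0).1 _; apply: fg; exact: (lmonP f0).1.
Qed.

Lemma supp_dom f m : supp f m -> monomial m <~ f.
Proof. by move: m; apply/dom_supp. Qed.

Lemma supp_lmon f : f != 0 -> supp f (lmon f).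
Proof. by move=> /lmonP[]. Qed.

Lemma sums_to_supp (I : choiceType) (F : I -> H) s m :
  sums_to F s -> supp s m -> exists i, supp (F i) m.
Proof.
move=> [_ sE] sm; apply: contrapT => nF; move: sm; rewrite /supp /= sE fsbig1 ?eqxx//.
by move=> i _; apply: suppPn => Fm; apply: nF; exists i.
Qed.

Lemma sums_to_dom (I : choiceType) (F : I -> H) s g :
  sums_to F s -> (forall i, F i <~ g) -> s <~ g.
Proof.
move=> Fs Fg; apply/dom_supp => m /(sums_to_supp Fs)[i Fm].
exact: dom_trans (supp_dom Fm) (Fg i).
Qed.

Lemma sums_to_sdom (I : choiceType) (F : I -> H) s g :
  g != 0 -> sums_to F s -> (forall i, F i <<~ g) -> s <<~ g.
Proof.
move=> g0 Fs Fg; apply: sdom_supp => // m /(sums_to_supp Fs)[i Fm].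
exact: dom_sdom_trans (supp_dom Fm) (Fg i).
Qed.

Lemma sums_to_uniq (I : choiceType) (F : I -> H) s s' :
  sums_to F s -> sums_to F s' -> s = s'.
Proof. by move=> [_ E] [_ E']; apply: series_eqP => m; rewrite E E'. Qed.

Lemma sums_to_infsum (I : choiceType) (F : I -> H) s :
  sums_to F s -> infsum F = s.
Proof.
move=> Fs; apply: (sums_to_uniq _ Fs).
exact: (@xgetPex _ 0 [set s | sums_to F s] (ex_intro _ s Fs)).
Qed.

Lemma monomialM a b : monomial (a * b)%g = monomial a * monomial b :> H.
Proof.
apply: series_eqP => m; rewrite hcoef_monomial !hcoef_term.
congr (if _ then _ else _); apply/eqP/eqP => [->|<-]; rewrite ?mulKg ?mulVKg//.
Qed.

Lemma term1 : hterm S 1 1%g = 1 :> H. Proof. by []. Qed.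
Lemma monomial1 : monomial 1%g = 1 :> H. Proof. by []. Qed.

Lemma monomialV a : monomial a^-1%g = (monomial a)^-1 :> H.
Proof.
apply: (mulfI (monomial_neq0 a)); rewrite divff ?monomial_neq0//.
by rewrite -monomialM mulgV.
Qed.

Lemma const0 : const 0 = 0 :> H.
Proof. by apply: series_eqP => m; rewrite /= if_same. Qed.
Lemma const1 : const 1 = 1 :> H. Proof. by []. Qed.
Lemma constM r r' : const (r * r') = const r * const r' :> H.
Proof.
by apply: series_eqP => m; rewrite hcoef_const !hcoef_term; case: ifP; rewrite ?mulr0.
Qed.
Lemma constD r r' : const (r + r') = const r + const r' :> H.
Proof.
by apply: series_eqP => m; rewrite hcoefD !hcoef_term; case: ifP; rewrite ?addr0.
Qed.
Lemma constN r : const (- r) = - const r :> H.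
Proof. by apply: series_eqP => m; rewrite hcoefN !hcoef_term; case: ifP; rewrite ?oppr0. Qed.
Lemma const_nat k : const k%:R = k%:R :> H.
Proof. by elim: k => [|k IH]; rewrite ?const0// -addn1 !natrD constD IH. Qed.
Lemma const_eq0 r : (const r == 0 :> H) = (r == 0).
Proof. exact: term_eq0. Qed.
Lemma constV r : const r^-1 = (const r)^-1 :> H.
Proof.
have [->|r0] := eqVneq r 0; first by rewrite invr0 const0 invr0.
have c0 : const r != 0 :> H by rewrite const_eq0.
by apply: (mulfI c0); rewrite divff// -constM divff.
Qed.
Lemma const_asymp r : r != 0 -> (const r : H) >~< 1.
Proof.
move=> r0; have := @asymp_lmon (const r); rewrite const_eq0 lmon_term//.
by move=> /(_ r0).
Qed.
Lemma const_dom r : (const r : H) <~ 1.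
Proof.
have [->|/const_asymp[]//] := eqVneq r 0; rewrite const0//.
Qed.
Lemma dom_constM r f g : f <~ g -> const r * f <~ g.
Proof. by move=> fg; rewrite -[g]mul1r; apply: domM => //; exact: const_dom. Qed.
Lemma sdom_constM r f g : f <<~ g -> const r * f <<~ g.
Proof. by move=> fg; apply: dom_sdom_trans fg; apply: dom_constM. Qed.

Lemma term_const r a : hterm S r a = const r * monomial a.
Proof.
by apply: series_eqP => m; rewrite hcoef_const !hcoef_term; case: ifP; rewrite ?mulr1 ?mulr0.
Qed.

Lemma suppD f g m : supp (f + g) m -> supp f m \/ supp g m.
Proof. exact: add_series_subproof. Qed.
Lemma suppN f m : supp (- f) m -> supp f m.
Proof. by rewrite /supp /mkset hcoefN oppr_eq0. Qed.
Lemma suppM f g m : supp (f * g) m -> mulset (supp f) (supp g) m.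
Proof. exact: mul_series_subproof. Qed.
Lemma supp_const r m : supp (const r : H) m -> m = 1%g.
Proof. exact: monom_subproof. Qed.
Lemma supp_monomial a : supp (monomial a : H) a.
Proof. by rewrite /supp /= eqxx oner_eq0. Qed.
Lemma supp_monomialE a m : supp (monomial a : H) m -> m = a.
Proof. exact: monom_subproof. Qed.
Lemma supp_constM r f m : supp (const r * f) m -> supp f m.
Proof. by rewrite /supp /mkset hcoef_const mulf_eq0 negb_or => /andP[]. Qed.

Definition infinitesimal f := f <<~ 1.

Lemma infinitesimalP f : infinitesimal f <-> (forall m, supp f m -> (m < 1)%O%g).
Proof.
split=> [f1 m fm|f1].
  by apply/sdom_monomial; apply: dom_sdom_trans f1; apply: supp_dom.
by apply: sdom_supp; rewrite ?oner_neq0// => m /f1 /sdom_monomial.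
Qed.

Lemma dom1_split f : f <~ 1 -> exists r e, [/\ f = const r + e & infinitesimal e].
Proof.
move=> f1; exists (f 1%g), (f - const (f 1%g)); split; first by rewrite addrC subrK.
apply/infinitesimalP => m fm; rewrite lt_neqAle; apply/andP; split.
  apply: contraTneq fm => ->; rewrite /supp /mkset hcoefB hcoef_term eqxx subrr.
  by apply/negP; rewrite eqxx.
apply/dom_monomial; apply: dom_trans (supp_dom fm) _.
by apply: domB; [exact: f1|exact: const_dom].
Qed.

End HahnDominance.

Opaque zero_series one_series add_series opp_series mul_series inv_series lt_series le_series norm_series.

(** * Iterated derivatives in an asymptotic differential field *)

(** What the study of iterated derivatives requires of omega-series: [om] is the subfield, [cst]
    embeds the reals, [l] stands for log T. [ad_log_exists] replaces log |h|, known only up to the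
    size of its derivative. *)
Record asymptotic_derivation (R V : realFieldType) (om : V -> Prop) (cst : R -> V)
    (D : V -> V) (T l : V) : Prop := AsymptoticDerivation {
  ad_omD : forall f g, om f -> om g -> om (f + g);
  ad_omN : forall f, om f -> om (- f);
  ad_omM : forall f g, om f -> om g -> om (f * g);
  ad_omV : forall f, om f -> om f^-1;
  ad_om_cst : forall r, om (cst r);
  ad_cst1 : cst 1 = 1;
  ad_cstN : forall r, cst (- r) = - cst r;
  ad_cstD : forall a b, cst (a + b) = cst a + cst b;
  ad_cst_asymp : forall r, r != 0 -> cst r >~< 1;
  ad_std_part : forall f, f <~ 1 -> exists r, f - cst r <<~ 1;
  ad_om_D : forall f, om f -> om (D f);
  ad_deriv_add : forall f g, om f -> om g -> D (f + g) = D f + D g;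
  ad_deriv_mul : forall f g, om f -> om g -> D (f * g) = D f * g + f * D g;
  ad_deriv_cst : forall r, D (cst r) = 0;
  ad_deriv_dom : forall f g, om f -> om g -> f <~ g -> ~ g >~< 1 -> D f <~ D g;
  ad_deriv_sdom : forall f g, om f -> om g -> f <<~ g -> ~ g >~< 1 -> D f <<~ D g;
  ad_log_exists : forall h, om h -> h != 0 -> ~ h >~< 1 ->
    exists g, [/\ om g, 1 <<~ g & D g >~< D h / h];
  ad_logder_dom : forall f g, om f -> om g -> 1 <<~ f -> f <~ g -> D f / f <~ D g / g;
  ad_omT : om T;
  ad_T1 : 1 <<~ T;
  ad_DT : D T = 1;
  ad_oml : om l;
  ad_l1 : 1 <<~ l;
  ad_Dl : D l = T^-1
}.

Section IteratedDerivatives.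
Variables (R V : realFieldType) (om : V -> Prop) (cst : R -> V) (D : V -> V) (T l : V).
Hypothesis ad : asymptotic_derivation om cst D T l.
Implicit Types (f g h : V) (a b r : R).

Let omD := ad_omD ad.
Let omN := ad_omN ad.
Let omM := ad_omM ad.
Let omV := ad_omV ad.
Let om_cst := ad_om_cst ad.
Let cst1 := ad_cst1 ad.
Let cstN := ad_cstN ad.
Let cstD := ad_cstD ad.
Let cst_asymp := ad_cst_asymp ad.
Let std_part := ad_std_part ad.
Let om_D := ad_om_D ad.
Let deriv_add := ad_deriv_add ad.
Let deriv_mul := ad_deriv_mul ad.
Let deriv_cst := ad_deriv_cst ad.
Let deriv_dom := ad_deriv_dom ad.
Let deriv_sdom := ad_deriv_sdom ad.
Let log_exists := ad_log_exists ad.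
Let logder_dom := ad_logder_dom ad.
Let omT := ad_omT ad.
Let T1 := ad_T1 ad.
Let DT := ad_DT ad.
Let oml := ad_oml ad.
Let l1 := ad_l1 ad.
Let Dl := ad_Dl ad.

Lemma cst0 : cst 0 = 0.
Proof. by have := cstD 0 0; rewrite addr0 => /eqP; rewrite -subr_eq subrr => /eqP <-. Qed.

Lemma om_one : om 1. Proof. by rewrite -cst1. Qed.

Lemma om_zero : om 0. Proof. by rewrite -(subrr 1); apply: omD om_one (omN om_one). Qed.

Lemma om_exp f n : om f -> om (f ^+ n).
Proof. by move=> fo; elim: n => [|n IH]; rewrite ?expr0 ?exprS; [exact: om_one|exact: omM]. Qed.

Lemma om_iter n f : om f -> om (iter n D f).
Proof. by move=> fo; elim: n => //= n; exact: om_D. Qed.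

Lemma deriv_zero : D 0 = 0.
Proof. by rewrite -{1}cst0 deriv_cst. Qed.


Lemma deriv_one : D 1 = 0. Proof. by rewrite -cst1. Qed.

Lemma derivV f : om f -> f != 0 -> D f^-1 = - D f / f ^+ 2.
Proof.
move=> fo f0; have := deriv_mul fo (omV fo); rewrite divff// deriv_one => /esym/eqP.
rewrite addrC addr_eq0 => /eqP h; apply: (mulfI f0); rewrite h.
by field.
Qed.

Lemma T_neq0 : T != 0. Proof. exact: sdom_neq0 T1. Qed.
Lemma l_neq0 : l != 0. Proof. exact: sdom_neq0 l1. Qed.

Lemma deriv_neq0 f : om f -> f != 0 -> ~ f >~< 1 -> D f != 0.
Proof.
move=> fo f0 f1; apply/eqP => Df.
apply: (deriv_sdom om_zero fo _ f1); last by rewrite Df.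
by move=> /dom0r/eqP; apply/negP.
Qed.

Lemma deriv_asymp f g : om f -> om g -> f >~< g -> ~ g >~< 1 -> D f >~< D g.
Proof.
move=> fo go fg g1; split; first by apply: deriv_dom => //; case: fg.
by apply: deriv_dom => //; [case: fg|move=> f1; apply: g1; exact: asymp_trans (asymp_sym fg) f1].
Qed.

Lemma deriv_small f : om f -> f <<~ 1 -> D f <<~ T^-1.
Proof.
move=> fo f1; rewrite -Dl; apply: deriv_sdom => //; last exact: sdom1_nasymp.
exact: sdom_dom_trans f1 (sdomW l1).
Qed.

Lemma sdomV f g : f != 0 -> f <<~ g -> g^-1 <<~ f^-1.
Proof.
move=> f0 fg h; apply: fg; have fV : f^-1 != 0 by rewrite invr_eq0.
by have := domV fV h; rewrite !invrK.
Qed.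

Lemma logder_mul f g : om f -> om g -> f != 0 -> g != 0 ->
  D (f * g) / (f * g) = D f / f + D g / g.
Proof. by move=> fo go f0 g0; rewrite deriv_mul//; field; rewrite ?f0 ?g0. Qed.

Lemma deriv_logder h : om h -> h != 0 -> D (D h) = D (D h / h) * h + (D h / h) * D h.
Proof.
move=> ho h0; rewrite -deriv_mul//; first by rewrite divfK.
by apply: omM; [exact: om_D|exact: omV].
Qed.

(** Put g = h'/h. From 1/g ≺ T follows (1/g)' ≺ T' = 1, that is g' ≺ g^2; hence h''/h' = g + g'/g ≍
    g. *)
Lemma big_logder h : om h -> h != 0 -> T^-1 <<~ D h / h ->
  D h != 0 /\ D (D h) / D h >~< D h / h.
Proof.
move=> ho h0; set g := D h / h => gT; have g0 : g != 0 by exact: sdom_neq0 gT.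
have Dh0 : D h != 0 by apply: contra_neq g0 => Dh0; rewrite /g Dh0 mul0r.
split=> //; have go : om g by apply: omM; [exact: om_D|exact: omV].
have gT' : g^-1 <<~ T by rewrite -[T]invrK; apply: sdomV => //; rewrite invr_eq0 T_neq0.
have g2 : D g <<~ g ^+ 2.
  have := deriv_sdom (omV go) omT gT' (sdom1_nasymp T1).
  rewrite derivV// DT => h2 h3; apply: h2; rewrite mulNr; apply: domNr.
  by rewrite -(divff (expf_neq0 2 g0)); exact: domMr.
have -> : D (D h) / D h = D g / g + g.
  rewrite deriv_logder// -/g; have -> : D h = g * h by rewrite /g divfK.
  by field; rewrite ?h0 ?g0.
apply: asympDl => h2; apply: g2; rewrite expr2.
by have := domMr g h2; rewrite divfK.
Qed.

Lemma big_deriv_logder h : om h -> h != 0 -> T^-1 <<~ D h / h ->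
  D (D h / h) / (D h / h) <~ D h / h.
Proof.
move=> ho h0 gT; have g0 : D h / h != 0 by exact: sdom_neq0 gT.
have [Dh0 hg] := big_logder ho h0 gT.
have -> : D (D h / h) / (D h / h) = D (D h) / D h - D h / h.
  rewrite logder_mul ?invr_eq0//; [|exact: om_D|exact: omV].
  by rewrite derivV//; field; rewrite ?h0 ?Dh0.
by apply: domB; [case: hg|exact: dom_refl].
Qed.

Lemma big_iter n h : om h -> h != 0 -> T^-1 <<~ D h / h ->
  [/\ iter n D h != 0, iter n D h >~< h * (D h / h) ^+ n &
      D (iter n D h) / iter n D h >~< D h / h].
Proof.
move=> ho h0 hT; elim: n => [|n [i0 i1 i2]] /=; first by rewrite expr0 mulr1.
have hn := om_iter n ho.
have [|j0 j1] := big_logder hn i0; first exact: sdom_dom_trans hT i2.2.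
split=> //; last exact: asymp_trans j1 i2.
rewrite exprSr mulrA -[D _](divfK i0) mulrC; exact: asympM.
Qed.

(* T h'/h has standard part b, as for h = T^b times a slowly varying factor. *)
Definition lim_logder h b := h != 0 /\ T * (D h / h) - cst b <<~ 1.

Lemma lim_logder_exists h : h != 0 -> D h / h <~ T^-1 -> exists b, lim_logder h b.
Proof.
move=> h0 hT; have [b hb] : exists b, T * (D h / h) - cst b <<~ 1.
  by apply: std_part; have := domMl T hT; rewrite divff ?T_neq0.
by exists b.
Qed.

Lemma lim_logder_dom h b : lim_logder h b -> D h / h <~ T^-1.
Proof.
move=> [h0 hb]; apply: (dom_mul2l T_neq0); rewrite divff ?T_neq0//.
rewrite -[X in X <~ _](subrK (cst b)); apply: domD; first exact: sdomW.
have [->|/cst_asymp[]//] := eqVneq b 0.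
by rewrite cst0; exact: dom0l.
Qed.

Lemma lim_step_asymp h b : lim_logder h b -> b != 0 -> D h >~< h / T.
Proof.
move=> [h0 hb] b0; have hc : T * (D h / h) >~< 1.
  apply: (asymp_trans _ (cst_asymp b0)); rewrite -[X in X >~< _](subrK (cst b)).
  by apply: asympDl; apply: (sdom_dom_trans hb); case: (cst_asymp b0).
have -> : D h = (h / T) * (T * (D h / h)) by field; rewrite ?h0 ?T_neq0.
by rewrite -[X in _ >~< X]mulr1; exact: asympM.
Qed.

(** Monotonicity of logarithmic derivatives for 1 ≺ 1/e ≼ l^2 gives e'/e ≼ 2 l'/l = 2 / (l T), which
    is ≺ 1/T as l is infinite. *)
Lemma small_logder e : om e -> e != 0 -> e <<~ 1 -> (l ^+ 2)^-1 <<~ e ->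
  D e / e <<~ T^-1.
Proof.
move=> eo e0 e1 el; have q1 : 1 <<~ e^-1 by rewrite -invr1; exact: sdomV.
have l20 : l ^+ 2 != 0 by rewrite expf_neq0 ?l_neq0.
have ql : e^-1 <~ l ^+ 2.
  by apply: sdomW; rewrite -[l ^+ 2]invrK; apply: sdomV => //; rewrite invr_eq0.
have := logder_dom (omV eo) (om_exp 2 oml) q1 ql.
have -> : D e^-1 / e^-1 = - (D e / e) by rewrite derivV//; field.
have -> : D (l ^+ 2) / l ^+ 2 = (l^-1 *+ 2) * T^-1.
  by rewrite expr2 logder_mul ?l_neq0// Dl; field; rewrite ?l_neq0 ?T_neq0.
move=> h; have {}h : D e / e <~ (l^-1 *+ 2) * T^-1 by rewrite -[X in X <~ _]opprK; exact: domN.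
apply: (dom_sdom_trans h); rewrite -[X in _ <<~ X]mul1r.
apply: sdomMr; first by rewrite invr_eq0 T_neq0.
apply: (@dom_sdom_trans _ l^-1); first exact: domMnl.
by rewrite -invr1; apply: sdomV; rewrite ?oner_neq0.
Qed.

(* When b = 0, h'/h is at least the derivative of - 1 / log T since log |h| is
   infinite; thus e = T h'/h varies slowly, see [small_logder]. *)
Lemma lim_step h b : om h -> lim_logder h b -> (b != 0 \/ ~ h >~< 1) ->
  lim_logder (D h) (b - 1).
Proof.
move=> ho [h0 hb] bh; set e := T * (D h / h) - cst b in hb.
have eo : om e.
  apply: omD; last exact/omN/om_cst.
  by apply: omM => //; apply: omM; [exact: om_D|exact: omV].
set c := cst b + e; have co : om c by apply: omD.
have cE : T * (D h / h) = c by rewrite /c /e; ring.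
have Dc : D c = D e by rewrite /c deriv_add// deriv_cst add0r.
have DhE : D h = c * h / T by rewrite -cE; field; rewrite ?h0 ?T_neq0.
have De : D e <<~ T^-1 by exact: deriv_small.
have [c0 key] : c != 0 /\ T * (D e / c) <<~ 1.
  have [b0|b0] := eqVneq b 0; last first.
    have c1 : c >~< 1.
      apply: (asymp_trans _ (cst_asymp b0)); apply: asympDr; apply: (sdom_dom_trans hb).
      by case: (cst_asymp b0).
    have c0 : c != 0 by apply: asymp_neq0 (asymp_sym c1) _; exact: oner_neq0.
    split=> //; rewrite mulrA => h1; apply: De.
    have h2 := dom_trans c1.1 (dom_trans (dom_refl 1) h1).
    apply: (dom_mul2l T_neq0); rewrite divff ?T_neq0//.
    have := domMr c h1; rewrite divfK// mul1r => h3; exact: dom_trans c1.2 h3.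
  have h1 : ~ h >~< 1 by case: bh; rewrite // b0 eqxx.
  have Dh0 := deriv_neq0 ho h0 h1.
  have ce : c = e by rewrite /c b0 cst0 add0r.
  have e0 : e != 0.
    by rewrite -ce; apply: contra_neq Dh0 => c0; rewrite DhE c0 !mul0r.
  rewrite ce; split=> //.
  have [g [go g1 gh]] := log_exists ho h0 h1.
  have el : (l ^+ 2)^-1 <<~ e.
    have lo := omV oml.
    have lg : l^-1 <<~ g.
      apply: sdom_dom_trans (sdomW g1); rewrite -invr1; apply: sdomV => //.
      exact: oner_neq0.
    have := deriv_sdom lo go lg (sdom1_nasymp g1); rewrite derivV ?l_neq0// Dl.
    move=> h2 h3; apply: h2; apply: (dom_trans gh.1); apply: (dom_mul2l T_neq0).
    rewrite cE ce (_ : T * _ = - (l ^+ 2)^-1); first exact: domNr.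
    by field; rewrite l_neq0 T_neq0.
  have := small_logder eo e0 hb el => h2 h3; apply: h2.
  by apply: (dom_mul2l T_neq0); rewrite divff ?T_neq0.
have Dh0 : D h != 0 by rewrite DhE !mulf_neq0 ?invr_eq0 ?T_neq0.
split=> //.
(* Since h' = c h / T, the factor 1/T contributes the -1 that lowers the exponent b, and T c'/c is
   the new error. *)
have DDh : T * (D (D h) / D h) = c + T * (D e / c) - 1.
  have To := omV omT.
  have -> : D (D h) / D h = D c / c + D h / h + D T^-1 / T^-1.
    rewrite {1 2}DhE logder_mul ?mulf_neq0 ?invr_eq0 ?T_neq0//; last exact: omM.
    by rewrite logder_mul.
  rewrite derivV ?T_neq0// DT Dc -cE; field.
  by rewrite T_neq0 h0 (_ : D h != 0) // -cE in c0 *; rewrite T_neq0.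
rewrite DDh cstD cstN cst1 (_ : _ - _ = e + T * (D e / c)); last by rewrite /c; ring.
exact: sdomD.
Qed.

Definition non_power f := forall k : nat, ~ f >~< T ^+ k.

Lemma non_power1 f : non_power f -> ~ f >~< 1.
Proof. by move=> /(_ 0%N); rewrite expr0. Qed.

Lemma deriv_T_exp k : D (T ^+ k.+1) = k.+1%:R * T ^+ k.
Proof.
elim: k => [|k IH]; first by rewrite expr1 DT expr0 mulr1.
rewrite exprS deriv_mul ?IH ?DT//; last exact: om_exp.
by rewrite exprS -[k.+2]add1n natrD; ring.
Qed.

Lemma T_exp_nasymp k : ~ T ^+ k.+1 >~< 1.
Proof. by apply: sdom1_nasymp; rewrite -[1](expr1n _ k.+1); apply: sdomX. Qed.

Lemma deriv_T_exp_asymp k : D (T ^+ k.+1) >~< T ^+ k.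
Proof.
by rewrite deriv_T_exp -[X in _ >~< X]mul1r; apply: asympM => //; exact: natr_asymp.
Qed.

(** Strict monotonicity of D excludes both f ≺ T^(k+1) and f ≻ T^(k+1). Consequently [non_power] is
    stable under D, and no iterated derivative of such an f has the size of 1. *)
Lemma asymp_primitive f k : om f -> D f >~< T ^+ k -> f >~< T ^+ k.+1.
Proof.
move=> fo fk; have To := om_exp k.+1 omT; have Tk := T_exp_nasymp (k := k).
split; apply: contrapT => h.
- have Tf : D (T ^+ k.+1) <<~ D f.
    apply: deriv_sdom => // f1; apply: (sdom1_nasymp _ f1).
    apply: sdom_dom_trans (sdomW h); rewrite -[1](expr1n _ k.+1).
    exact: sdomX.
  by apply: Tf; apply: (dom_trans fk.1); case: (deriv_T_exp_asymp k).
- have fT : D f <<~ D (T ^+ k.+1) by exact: deriv_sdom.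
  by apply: fT; apply: (dom_trans (deriv_T_exp_asymp k).1); case: fk.
Qed.

Lemma non_power_deriv f : om f -> non_power f -> non_power (D f).
Proof. by move=> fo fn k /(asymp_primitive fo); exact: fn. Qed.

Lemma non_power_iter n f : om f -> non_power f -> non_power (iter n D f).
Proof.
by move=> fo fn; elim: n => //= n; apply: non_power_deriv; exact: om_iter.
Qed.

Lemma non_power_iter1 n f : om f -> non_power f -> ~ iter n D f >~< 1.
Proof. by move=> fo fn; apply: non_power1; exact: non_power_iter. Qed.

Lemma iter_neq0 n f : om f -> f != 0 -> non_power f -> iter n D f != 0.
Proof.
move=> fo f0 fn; elim: n => //= n IH; apply: deriv_neq0 => //; first exact: om_iter.
exact: non_power_iter1.
Qed.

(** The exclusion of powers of T enters here: each step uses monotonicity of D below an iterate of g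
    that must not be ≍ 1. *)
Lemma iter_dom n f g : om f -> om g -> non_power g -> f <~ g -> iter n D f <~ iter n D g.
Proof.
move=> fo go gn fg; elim: n => //= n IH; apply: deriv_dom => //; try exact: om_iter.
exact: non_power_iter1.
Qed.

Lemma subrS a n : a - n.+1%:R = a - n%:R - 1.
Proof. by rewrite -addn1 natrD opprD addrA. Qed.

Lemma lim_iter n h a : om h -> lim_logder h a -> (forall j : nat, (j < n)%N -> a != j%:R) ->
  lim_logder (iter n D h) (a - n%:R) /\ iter n D h >~< h / T ^+ n.
Proof.
move=> ho ha; elim: n => [|n IH] an; first by rewrite subr0 expr0 divr1.
have [|i1 i2] := IH; first by move=> j jn; apply: an; exact: ltnW.
have b0 : a - n%:R != 0 by rewrite subr_eq0; exact: an.
have hn := om_iter n ho; split.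
  by rewrite subrS; apply: lim_step => //; left.
apply: (asymp_trans (lim_step_asymp i1 b0)).
by rewrite exprSr invfM mulrA; exact: asympM.
Qed.

Lemma lim_iter_non_power n h a : om h -> non_power h -> lim_logder h a ->
  lim_logder (iter n D h) (a - n%:R).
Proof.
move=> ho hn ha; elim: n => [|n IH]; first by rewrite subr0.
rewrite subrS; apply: lim_step => //; first exact: om_iter.
by right; exact: non_power_iter1.
Qed.

Lemma iter_logder n f : om f -> f != 0 -> non_power f ->
  D (iter n D f) / iter n D f <~ D f / f \/ D (iter n D f) / iter n D f <~ T^-1.
Proof.
move=> fo f0 fn; have [fT|fT] := pselect (D f / f <~ T^-1).
  right; have [a fa] := lim_logder_exists f0 fT.
  exact: lim_logder_dom (lim_iter_non_power n fo fn fa).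
by left; have [_ _ []] := big_iter n fo f0 fT.
Qed.

(** The first k derivations each cost a factor T, so h^(k) ≍ q = h / T^k and h^(k+1) ≍ q'. From
    there on the standard part of the logarithmic derivative times T starts at -1 and never meets 0,
    so each further derivation again costs exactly a factor T. *)
Lemma lim_iter_nat n k h : om h -> non_power h -> lim_logder h k%:R -> (k < n)%N ->
  iter n D h * T ^+ n >~< T ^+ k.+1 * D (h / T ^+ k).
Proof.
move=> ho hn hk kn; have Tk n' : T ^+ n' != 0 by rewrite expf_neq0 ?T_neq0.
have [|h1 h2] := @lim_iter k h k%:R ho hk.
  by move=> j jk; rewrite eqr_nat gtn_eqF.
have oq : om (h / T ^+ k) by apply: omM => //; apply: omV; exact: om_exp.
have q1 : ~ h / T ^+ k >~< 1.
  move=> q1; apply: (hn k); have := asympM q1 (asymp_refl (T ^+ k)).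
  by rewrite divfK// mul1r.
have h3 : iter k.+1 D h >~< D (h / T ^+ k) by apply: deriv_asymp => //; exact: om_iter.
have := lim_iter_non_power k.+1 ho hn hk.
rewrite (_ : _ - _ = -1); last by rewrite -addn1 natrD; ring.
move=> h4; have [|_] := @lim_iter (n - k.+1) _ _ (om_iter k.+1 ho) h4.
  move=> j _; rewrite eq_sym -subr_eq0 opprK -[X in _ + X]/(1%:R) -natrD pnatr_eq0.
  by rewrite addn1.
rewrite -iterD subnK// => h5.
have := asympM (asymp_trans h5 (asympM h3 (asymp_refl (T ^+ (n - k.+1))^-1))) (asymp_refl (T ^+ n)).
have -> : D (h / T ^+ k) / T ^+ (n - k.+1) * T ^+ n = T ^+ k.+1 * D (h / T ^+ k).
  by rewrite -{2}(subnK kn) exprD; field; rewrite Tk.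
by [].
Qed.

Lemma logder_div_T_exp h k : om h -> h != 0 -> D h / h <~ T^-1 ->
  D (h / T ^+ k) / (h / T ^+ k) <~ T^-1.
Proof.
move=> ho h0 hT; elim: k => [|k IH]; first by rewrite expr0 divr1.
have Tk : T ^+ k != 0 by rewrite expf_neq0 ?T_neq0.
have oq : om (h / T ^+ k) by apply: omM => //; apply: omV; exact: om_exp.
have q0 : h / T ^+ k != 0 by rewrite mulf_neq0 ?invr_eq0.
rewrite exprSr invfM mulrA logder_mul ?invr_eq0 ?T_neq0//; last exact: omV.
apply: domD => //; rewrite derivV ?T_neq0// DT.
rewrite (_ : _ / T^-1 = - T^-1); first exact: domN.
by field; rewrite T_neq0.
Qed.

End IteratedDerivatives.

(** * Comparing the values at two points when the logarithmic derivative times delta is bounded *)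

Record dominance_embedding (V U : realFieldType) (om : V -> Prop) (phi : V -> U) :
    Prop := DominanceEmbedding {
  de_add : forall f g, om f -> om g -> phi (f + g) = phi f + phi g;
  de_mul : forall f g, om f -> om g -> phi (f * g) = phi f * phi g;
  de_one : phi 1 = 1;
  de_dom : forall f g, om f -> om g -> (phi f <~ phi g <-> f <~ g)
}.

Record monomial_class (V : realFieldType) (om : V -> Prop) (T : V)
    (mono : V -> Prop) : Prop := MonomialClass {
  mc_om : forall m, mono m -> om m;
  mc_neq0 : forall m, mono m -> m != 0;
  mc_one : mono 1;
  mc_inv : forall m, mono m -> mono m^-1;
  mc_div : forall m k, mono m -> mono (m / T ^+ k);
  mc_uniq : forall m k, mono m -> m >~< T ^+ k -> m = T ^+ k;
  mc_lead : forall h, om h -> h != 0 -> exists2 m, mono m & h >~< m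
}.

Section Tame.
Variables (R V U : realFieldType) (om : V -> Prop) (cst : R -> V) (D : V -> V) (T l : V).
Hypothesis ad : asymptotic_derivation om cst D T l.
Variables (mono : V -> Prop) (mc : monomial_class om T mono).
Variables (phi psi : V -> U).
Hypothesis ephi : dominance_embedding om phi.
Variable delta : U.
Hypothesis rem1_dom : forall m, mono m -> phi (D m / m) * delta <~ 1 ->
  psi m - phi m <~ phi (D m) * delta.
Implicit Types (f g h m : V).

Let omV := ad_omV ad.
Let omM := ad_omM ad.
Let om_D := ad_om_D ad.

Lemma om_logder h : om h -> om (D h / h).
Proof. by move=> ho; apply: omM; [exact: om_D|exact: omV]. Qed.

Lemma embed_asymp f g : om f -> om g -> f >~< g -> phi f >~< phi g.
Proof. by move=> fo go [fg gf]; split; apply/(de_dom ephi). Qed.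

Lemma embed_neq0 f : om f -> f != 0 -> phi f != 0.
Proof.
move=> fo f0; apply/eqP => h; have := de_mul ephi fo (omV fo).
by rewrite divff// (de_one ephi) h mul0r => /eqP; rewrite oner_eq0.
Qed.

Lemma embed_inv f : om f -> f != 0 -> phi f^-1 = (phi f)^-1.
Proof.
move=> fo f0; have p0 := embed_neq0 fo f0; apply: (mulfI p0).
by rewrite divff// -(de_mul ephi fo (omV fo)) divff// (de_one ephi).
Qed.

Lemma embed_deriv m : om m -> m != 0 -> phi (D m) = phi m * phi (D m / m).
Proof.
move=> mo m0; rewrite -(de_mul ephi mo); last exact: om_logder.
by rewrite mulrC divfK.
Qed.

Lemma tame_psi_dom m : mono m -> phi (D m / m) * delta <~ 1 -> psi m <~ phi m.
Proof.
move=> mm tm; have mo := mc_om mc mm; have m0 := mc_neq0 mc mm.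
rewrite -[psi m](subrK (phi m)); apply: domD => //.
apply: (dom_trans (rem1_dom mm tm)); rewrite embed_deriv// -mulrA.
by rewrite -[X in _ <~ X]mulr1; exact: domMl.
Qed.

End Tame.

Section TameTransfer.
Variables (R V U : realFieldType) (om : V -> Prop) (cst : R -> V) (D : V -> V) (T l : V).
Hypothesis ad : asymptotic_derivation om cst D T l.
Variables (mono : V -> Prop) (mc : monomial_class om T mono).
Variables (phi psi : V -> U).
Hypotheses (ephi : dominance_embedding om phi) (epsi : dominance_embedding om psi).
Variable delta : U.
Hypothesis delta_psi : delta <~ psi T.
Hypothesis rem1_dom : forall m, mono m -> phi (D m / m) * delta <~ 1 ->
  psi m - phi m <~ phi (D m) * delta.
Implicit Types (f g h m : V).

Let omV := ad_omV ad.
Let omM := ad_omM ad.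
Let om_D := ad_om_D ad.
Let omT := ad_omT ad.
Let psi_dom := tame_psi_dom ad mc ephi rem1_dom.

(** The bound of psi m by phi m also applies to m^-1, whose logarithmic derivative is the opposite
    one; inverting gives the converse. *)
Lemma tame_asymp m : mono m -> phi (D m / m) * delta <~ 1 -> psi m >~< phi m.
Proof.
move=> mm tm; have mo := mc_om mc mm; have m0 := mc_neq0 mc mm.
split; first exact: psi_dom.
have mV := mc_inv mc mm.
have LE : D m^-1 / m^-1 = - (D m / m) by rewrite (derivV ad)//; field.
have tV : phi (D m^-1 / m^-1) * delta <~ 1.
  have lo := om_logder ad mo.
  have pN : phi (- (D m / m)) = - phi (D m / m).
    have := de_add ephi lo (ad_omN ad lo); rewrite addrN => h.
    have p0 : phi 0 = 0.
      have o0 := om_zero ad; have := de_add ephi o0 o0; rewrite addr0 => /eqP.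
      by rewrite -subr_eq subrr => /eqP <-.
    by apply/eqP; rewrite -addr_eq0 addrC -h p0.
  by rewrite LE pN mulNr; exact: domN.
have := psi_dom mV tV; rewrite (embed_inv ad ephi mo m0) (embed_inv ad epsi mo m0) => h.
have p0 := embed_neq0 ad epsi mo m0.
by have := domV _ h; rewrite !invrK; apply; rewrite invr_eq0.
Qed.

Lemma tame_series h : om h -> h != 0 -> phi (D h / h) * delta <~ 1 -> psi h >~< phi h.
Proof.
move=> ho h0 th; have [k mk hk] := mc_lead mc ho h0.
have ko := mc_om mc mk; have k0 := mc_neq0 mc mk.
apply: (asymp_trans (embed_asymp epsi ho ko hk)).
apply: (asymp_trans _ (asymp_sym (embed_asymp ephi ho ko hk))).
have [k1|k1] := pselect (k >~< 1).
  have -> : k = 1 by have := mc_uniq mc (k := 0%N) mk; rewrite expr0; apply.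
  by rewrite (de_one ephi) (de_one epsi).
apply: tame_asymp => //.
have kh : D k / k <~ D h / h.
  have Dk : D h >~< D k by exact: (deriv_asymp ad).
  by apply: domM; [case: Dk|apply: domV => //; case: hk].
have := kh; rewrite -(de_dom ephi (om_logder ad ko) (om_logder ad ho)) => h1.
exact: dom_trans (domMr delta h1) th.
Qed.

Lemma slow_logder h : om h -> D h / h <~ T^-1 -> psi (D h / h) * delta <~ 1.
Proof.
move=> ho hT; have T0 := T_neq0 ad.
have h1 : psi (D h / h) <~ (psi T)^-1.
  rewrite -(embed_inv ad epsi omT T0); apply/(de_dom epsi) => //.
  - exact: (om_logder ad ho).
  - exact: omV.
apply: (dom_trans (domMr delta h1)).
rewrite -(mulVf (embed_neq0 ad epsi omT T0)); exact: domMl.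
Qed.

(** Put g = h'/h. If g ≼ 1/T, the claim follows from [delta <~ psi T]. Otherwise g'/g ≼ g, so g
    satisfies the boundedness condition of [tame_series] and has the same size at both points. *)
Lemma tame_transfer h : om h -> h != 0 -> phi (D h / h) * delta <~ 1 ->
  psi (D h / h) * delta <~ 1.
Proof.
move=> ho h0 th; have [hT|hT] := pselect (D h / h <~ T^-1); first exact: slow_logder.
have go := om_logder ad ho; set g := D h / h in go th hT *.
have g0 : g != 0 by exact: sdom_neq0 hT.
have gg : D g / g <~ g by exact: (big_deriv_logder ad).
have tg : phi (D g / g) * delta <~ 1.
  have := gg; rewrite -(de_dom ephi (om_logder ad go) go) => h1.
  exact: dom_trans (domMr delta h1) th.
have [pg _] := tame_series go g0 tg.
exact: dom_trans (domMr delta pg) th.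
Qed.

End TameTransfer.

(** * Taylor remainders of the terms of a series *)

Section Remainder.
Variables (R V U : realFieldType) (om : V -> Prop) (cst : R -> V) (D : V -> V) (T l : V).
Hypothesis ad : asymptotic_derivation om cst D T l.
Variables (mono : V -> Prop) (mc : monomial_class om T mono).
Variables (phi psi : V -> U).
Hypotheses (ephi : dominance_embedding om phi) (epsi : dominance_embedding om psi).
Variable delta : U.
Local Notation x := (phi T).
Hypotheses (psiT : psi T = x + delta) (delta_x : delta <~ x).

Definition remainder n f : U :=
  psi f - \sum_(i < n) phi (iter i D f) / i`!%:R * delta ^+ i.

(** Supplied by [taylor_remainder_dom]. It is applied with K = x^-1 if m'/m ≼ 1/T, and with the
    value of m'/m at x otherwise. *)
Hypothesis rem_dom : forall m (K : U), mono m -> x^-1 <~ K -> K * delta <~ 1 ->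
  phi (D m / m) <~ K -> forall j, remainder j.+1 m <~ phi (D m) * delta * (K * delta) ^+ j.
Hypothesis rem1_swap : forall m, mono m -> psi (D m / m) * - delta <~ 1 ->
  phi m - psi m <~ psi (D m) * - delta.

Implicit Types (f g h m : V).
Let omV := ad_omV ad.
Let omM := ad_omM ad.
Let om_D := ad_om_D ad.
Let omT := ad_omT ad.
Let T0 := T_neq0 ad.
Let om_it n f : om f -> om (iter n D f) := @om_iter _ _ _ _ _ _ _ ad n f.

Let oT q : om (T ^+ q) := om_exp ad q omT.

Let x0 : x != 0 := embed_neq0 ad ephi omT T0.

Lemma embed_exp f n : om f -> phi (f ^+ n) = phi f ^+ n.
Proof.
move=> fo; elim: n => [|n IH]; first by rewrite !expr0 (de_one ephi).
by rewrite !exprS (de_mul ephi) ?IH//; exact: (om_exp ad).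
Qed.

Lemma embed_zero : phi 0 = 0.
Proof.
have o0 := om_zero ad; have := de_add ephi o0 o0; rewrite addr0 => /eqP.
by rewrite -subr_eq subrr => /eqP <-.
Qed.

Lemma embed_mulrn f n : om f -> phi (f *+ n) = phi f *+ n /\ om (f *+ n).
Proof.
move=> fo; elim: n => [|n [IH1 IH2]].
  by rewrite !mulr0n embed_zero; split=> //; exact: (om_zero ad).
rewrite !mulrS (de_add ephi)// IH1; split=> //; exact: (ad_omD ad).
Qed.

Lemma delta_div : x^-1 * delta <~ 1.
Proof. by rewrite -(mulVf x0); exact: domMl. Qed.

Lemma slow_embed h : om h -> D h / h <~ T^-1 -> phi (D h / h) <~ x^-1.
Proof.
move=> ho hT; rewrite -(embed_inv ad ephi omT T0); apply/(de_dom ephi) => //.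
- exact: (om_logder ad ho).
- exact: omV.
Qed.

Lemma rem_slow m : mono m -> D m / m <~ T^-1 ->
  forall j, remainder j.+1 m <~ phi (D m) * delta * (x^-1 * delta) ^+ j.
Proof.
move=> mm mT; apply: rem_dom => //; first exact: delta_div.
by apply: slow_embed => //; exact: (mc_om mc mm).
Qed.

Lemma fast_embed h : om h -> T^-1 <<~ D h / h -> x^-1 <~ phi (D h / h).
Proof.
move=> ho hT; rewrite -(embed_inv ad ephi omT T0); apply/(de_dom ephi) => //.
- exact: omV.
- exact: (om_logder ad ho).
- exact: sdomW.
Qed.

Lemma rem_fast m : mono m -> T^-1 <<~ D m / m -> phi (D m / m) * delta <~ 1 ->
  forall j, remainder j.+1 m <~ phi (D m) * delta * (phi (D m / m) * delta) ^+ j.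
Proof.
move=> mm mT tm; apply: rem_dom => //.
by apply: fast_embed => //; exact: (mc_om mc mm).
Qed.

Lemma rem1E m : remainder 1 m = psi m - phi m.
Proof. by rewrite /remainder big_ord_recl big_ord0 fact0 divr1 expr0 mulr1 addr0. Qed.

Lemma rem1_dom m : mono m -> phi (D m / m) * delta <~ 1 ->
  psi m - phi m <~ phi (D m) * delta.
Proof.
move=> mm tm; rewrite -rem1E; have [mT|mT] := pselect (D m / m <~ T^-1).
  by have := rem_slow mm mT 0; rewrite expr0 mulr1.
by have := rem_fast mm mT tm 0; rewrite expr0 mulr1.
Qed.

Let tame_asymp' := tame_series ad mc ephi epsi rem1_dom.

(** [tame_transfer] read from the second point to the first, with increment -delta; signs do not
    matter for dominance. *)
Lemma tame_swap h : om h -> h != 0 -> psi (D h / h) * delta <~ 1 ->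
  phi (D h / h) * delta <~ 1.
Proof.
move=> ho h0 th; rewrite -[phi _ * _]opprK; apply: domN; rewrite -mulrN.
apply: (tame_transfer ad mc epsi ephi) ho h0 _; first exact: domN.
- exact: rem1_swap.
- by rewrite mulrN; exact: domN.
Qed.

(** The Leibniz rule with T'' = 0. For n = 0 the truncated predecessor is harmless because its term
    is taken 0 times. *)
Lemma iter_deriv_Tmul n f : om f -> iter n D (T * f) = T * iter n D f + iter n.-1 D f *+ n.
Proof.
move=> fo; elim: n => [|n IH]; first by rewrite mulr0n addr0.
have nat_deriv g k : om g -> D (g *+ k) = D g *+ k /\ om (g *+ k).
  move=> go; elim: k => [|k [IH1 IH2]].
    by rewrite !mulr0n (deriv_zero ad); split=> //; exact: (om_zero ad).
  rewrite !mulrS (ad_deriv_add ad)// IH1; split=> //; exact: (ad_omD ad).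
have ho := om_it n fo; have ho1 := om_it n.-1 fo.
have [n1 n2] := nat_deriv (iter n.-1 D f) n ho1.
rewrite iterS IH (ad_deriv_add ad)//; last exact: omM.
rewrite (ad_deriv_mul ad)// (ad_DT ad) mul1r n1 [n.+1.-1]/=.
rewrite mulrS -addrA addrCA; congr (_ + (_ + _)).
by case: n {IH ho ho1 n1 n2} => [|n] /=; rewrite ?mulr0n.
Qed.

Lemma fact_neq0 n : n`!%:R != 0 :> U.
Proof. by rewrite pnatr_eq0 -lt0n fact_gt0. Qed.

Lemma remainder_Tmul n f : om f ->
  remainder n.+1 (T * f) = x * remainder n.+1 f + delta * remainder n f.
Proof.
move=> fo; rewrite /remainder (de_mul epsi)// psiT.
have E i : phi (iter i D (T * f)) = x * phi (iter i D f) + phi (iter i.-1 D f) *+ i.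
  have [h1 h2] := embed_mulrn i (om_it i.-1 fo).
  rewrite iter_deriv_Tmul// (de_add ephi)//; last by apply: omM => //; exact: om_it.
  by rewrite (de_mul ephi) ?h1//; exact: om_it.
have -> : \sum_(i < n.+1) phi (iter i D (T * f)) / i`!%:R * delta ^+ i =
    x * (\sum_(i < n.+1) phi (iter i D f) / i`!%:R * delta ^+ i) +
    delta * (\sum_(i < n) phi (iter i D f) / i`!%:R * delta ^+ i).
  transitivity (\sum_(i < n.+1) x * (phi (iter i D f) / i`!%:R * delta ^+ i) +
      \sum_(i < n.+1) (phi (iter i.-1 D f) *+ i) / i`!%:R * delta ^+ i).
    rewrite -big_split; apply: eq_bigr => i _ /=; rewrite E; ring.
  rewrite -mulr_sumr; congr (_ + _).
  rewrite big_ord_recl mulr0n !mul0r add0r mulr_sumr; apply: eq_bigr => i _.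
  rewrite /= /bump /= add1n /= factS natrM -[phi _ *+ _]mulr_natr exprS ?add0n.
  have n0 : i.+1%:R != 0 :> U by rewrite pnatr_eq0.
  move: n0 (fact_neq0 i) => /=; move: (i.+1%:R) ((i`!)%:R) => a b a0 b0.
  by field; rewrite a0 b0.
by ring.
Qed.

(** The remainder of T h in order n + 1 involves that of h in order n. Since h is estimated in
    positive orders only, each factor T costs one order. The constant [B] is left free so that it
    can be 0 for h = 1. *)
Lemma remainder_T_exp h (B : U) : om h ->
  (forall j, remainder j.+1 h <~ B * delta * (x^-1 * delta) ^+ j) ->
  forall k j, remainder (k + j).+1 (T ^+ k * h) <~ B * delta * x ^+ k * (x^-1 * delta) ^+ (k + j).
Proof.
move=> ho hB; elim=> [|k IH] j; first by rewrite expr0 !mul1r mulr1; exact: hB.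
rewrite exprS -mulrA addSn remainder_Tmul; last by apply: omM => //; exact: (om_exp ad).
have E : B * delta * x ^+ k.+1 * (x^-1 * delta) ^+ (k + j).+1 =
    delta * (B * delta * x ^+ k * (x^-1 * delta) ^+ (k + j)).
  by rewrite !exprS; move: ((x^-1 * delta) ^+ (k + j)) (x ^+ k) => a b; field.
apply: domD.
  have -> : B * delta * x ^+ k.+1 * (x^-1 * delta) ^+ (k + j).+1 =
     x * (B * delta * x ^+ k * (x^-1 * delta) ^+ (k + j.+1)).
    by rewrite addnS exprS; ring.
  by apply: domMl; have := IH j.+1; rewrite addnS.
by rewrite E; exact: domMl.
Qed.

Variable f : V.
Hypotheses (fo : om f) (f0 : f != 0) (fn : non_power T f)
  (tf : phi (D f / f) * delta <~ 1).

Lemma iter_tame n : psi (iter n D f) >~< phi (iter n D f).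
Proof.
apply: tame_asymp'; [exact: om_it|exact: (iter_neq0 ad)|].
have io := om_logder ad (om_it n fo).
case: (iter_logder ad n fo f0 fn) => h.
  have := h; rewrite -(de_dom ephi io (om_logder ad fo)) => h1.
  exact: dom_trans (domMr delta h1) tf.
apply: (dom_trans (domMr delta _) delta_div).
rewrite -(embed_inv ad ephi omT T0); apply/(de_dom ephi) => //; exact: omV.
Qed.

(* A term m with m'/m delta > 1 at x has the same property at x + delta, by
   [tame_swap]; hence m (m'/m)^n, which is of the size of the n-th derivative,
   bounds m by f^(n) delta^n at both points, and there is nothing to expand.
   For a tame m with T m'/m of standard part k < n, the derivatives drop faster
   than m / T^i from i = k + 1 on; there m = T^k h with h' = o(h / T) is expanded
   through h. *)
Lemma remainder_dom n m : mono m -> m <~ f ->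
  remainder n m <~ phi (iter n D f) * delta ^+ n.
Proof.
move=> mm mf; have mo := mc_om mc mm; have m0 := mc_neq0 mc mm.
have mlo := om_logder ad mo; have oe q : om ((D m / m) ^+ q) := om_exp ad q mlo.
have itd := iter_dom ad n mo fo fn mf.
have red : phi (iter n D m) * delta ^+ n <~ phi (iter n D f) * delta ^+ n.
  by apply: domMr; apply/(de_dom ephi); [exact: om_it|exact: om_it|].
have [tm|ntm] := pselect (phi (D m / m) * delta <~ 1); last first.
  have mT : T^-1 <<~ D m / m.
    move=> h; apply: ntm; apply: (dom_trans (domMr delta _) delta_div).
    exact: slow_embed.
  have big i := big_iter ad i mo m0 mT.
  have bphi i : phi (iter i D m) * delta ^+ i >~< phi m * (phi (D m / m) * delta) ^+ i.
    have [_ h _] := big i; rewrite exprMn mulrA; apply: asympM => //.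
    rewrite -(embed_exp i mlo) -(de_mul ephi mo)//.
    by apply: (embed_asymp ephi) => //; [exact: om_it|exact: omM].
  have pow1 : forall (a : U) (q : nat), 1 <~ a -> (q <= n)%N -> a ^+ q <~ a ^+ n.
    move=> a q a1 qn; rewrite -(subnKC qn) exprD -[X in X <~ _]mulr1; apply: domMl.
    by rewrite -(expr1n _ (n - q)); exact: domX.
  rewrite {1}/remainder; apply: domB.
    have nty : psi (D m / m) * delta <~ 1 -> False by move=> /(tame_swap mo m0).
    have y1 : 1 <~ psi (D m / m) * delta.
      by have [/nty|//] := dom_total (psi (D m / m) * delta) 1.
    apply: (@dom_trans _ (psi m * (psi (D m / m) * delta) ^+ n)).
      rewrite -[X in X <~ _]mulr1; apply: domMl; rewrite -(expr0 (psi (D m / m) * delta)).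
      exact: pow1.
    have [_ h _] := big n.
    have pexp : psi ((D m / m) ^+ n) = psi (D m / m) ^+ n.
      elim: (n) => [|k IH]; first by rewrite !expr0 (de_one epsi).
      by rewrite !exprS (de_mul epsi) ?IH//; exact: (om_exp ad).
    apply: (@dom_trans _ (psi (iter n D m) * delta ^+ n)).
      rewrite exprMn mulrA; apply: domMr; rewrite -pexp -(de_mul epsi mo)//.
      apply/(de_dom epsi); [|exact: om_it|by case: h].
      by apply: omM => //; exact: (om_exp ad).
    apply: domMr; apply: dom_trans (iter_tame n).1.
    by apply/(de_dom epsi); [exact: om_it|exact: om_it|].
  apply: dom_sum => -[i ilt] _ /=.
  apply: (dom_trans _ red).
  apply: (@dom_trans _ (phi (iter i D m) * delta ^+ i)).
    apply: domMr; rewrite -[X in _ <~ X]mulr1; apply: domMl.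
    have fa : i`!%:R >~< (1 : U) by apply: natr_asymp; exact: fact_gt0.
    by have := asympV fa (fact_neq0 i); rewrite invr1 => -[].
  apply: (dom_trans (bphi i).1); apply: (dom_trans _ (bphi n).2).
  apply: domMl; apply: pow1; last exact: ltnW.
  by have [/ntm|//] := dom_total (phi (D m / m) * delta) 1.
(* [rem_dom] concerns positive orders only; in order 0 it remains to bound psi m by phi m. *)
case: n itd red => [|n] itd red.
  apply: (dom_trans _ red); rewrite expr0 mulr1 /remainder big_ord0 subr0 /=.
  exact: (tame_psi_dom ad mc ephi rem1_dom).
have [mT|mT] := pselect (D m / m <~ T^-1); last first.
  apply: (dom_trans (rem_fast mm mT tm n)); apply: (dom_trans _ red).
  have [_ [_ h] _] := big_iter ad n.+1 mo m0 mT.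
  rewrite (embed_deriv ad ephi mo m0).
  have -> : phi m * phi (D m / m) * delta * (phi (D m / m) * delta) ^+ n =
      phi (m * (D m / m) ^+ n.+1) * delta ^+ n.+1.
    rewrite (de_mul ephi mo)// embed_exp// !exprS exprMn; ring.
  apply: domMr; apply/(de_dom ephi) => //; last exact: om_it.
  by apply: omM => //; exact: (om_exp ad).
(* Here none of the factors a - i vanishes, so m^(n+1) ≍ m / T^(n+1), which is the size given by
   [rem_slow]. *)
have slow a : (forall i : nat, (i < n.+1)%N -> a != i%:R) -> lim_logder cst D T m a ->
    remainder n.+1 m <~ phi (iter n.+1 D f) * delta ^+ n.+1.
  move=> an la; apply: (dom_trans (rem_slow mm mT n)); apply: (dom_trans _ red).
  have [_ [_ h]] := lim_iter ad mo la an.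
  have Tn : om (T ^+ n.+1)^-1 by apply: omV; exact: (om_exp ad).
  have h2 : phi m * (x ^+ n.+1)^-1 <~ phi (iter n.+1 D m).
    rewrite -embed_exp// -(embed_inv ad ephi) ?expf_neq0//.
    rewrite -(de_mul ephi mo Tn); apply/(de_dom ephi) => //; [exact: omM|exact: om_it].
  apply: dom_trans (domMr (delta ^+ n.+1) h2).
  have -> : phi m / x ^+ n.+1 * delta ^+ n.+1 = phi m * x^-1 * delta * (x^-1 * delta) ^+ n.
    by rewrite exprMn exprVn !exprS invfM; ring.
  apply: domMr; apply: domMr; rewrite (embed_deriv ad ephi mo m0); apply: domMl.
  exact: slow_embed.
have [mnp|mp] := pselect (non_power T m); last first.
  have [k mk] : exists k, m >~< T ^+ k by apply: contrapT => h; apply: mp => k hk; apply: h; exists k.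
  have {}mk := mc_uniq mc mm mk.
  have [kn|nk] := ltnP k n.+1.
    (* All remainders of 1 in positive order vanish, so [B = 0] is admissible: the expansion of T^k
       is exact from order k + 1 on. *)
    have one_dom j : remainder j.+1 1 <~ 0 * delta * (x^-1 * delta) ^+ j.
      have := @rem_slow 1 (mc_one mc); rewrite (deriv_one ad) mul0r embed_zero; apply.
      exact: dom0l.
    have := remainder_T_exp (om_one ad) one_dom k (n - k); rewrite subnKC//.
    by rewrite mulr1 -mk !mul0r => /dom0r ->; exact: dom0l.
  have Dm : T * (D m / m) = k%:R.
    case: k mk nk => // k mk _; rewrite mk (deriv_T_exp ad) exprS.
    by field; rewrite expf_neq0 ?T0.
  have cn j : cst j%:R = j%:R.
    elim: j => [|j IH]; first exact: (cst0 ad).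
    by rewrite -addn1 !natrD (ad_cstD ad) IH (ad_cst1 ad).
  apply: (slow k%:R); first by move=> i ik; rewrite eqr_nat gtn_eqF// (leq_trans ik).
  by split=> //; rewrite Dm cn subrr => /dom0r/eqP; rewrite oner_eq0.
have [a la] := lim_logder_exists ad m0 mT.
have [[k kn ak]|na] := pselect (exists2 k : nat, (k < n.+1)%N & a = k%:R); last first.
  by apply: (slow a) => // i ik; apply/eqP => ai; apply: na; exists i.
rewrite ak in la.
have Tk0 : T ^+ k != 0 by rewrite expf_neq0 ?T0.
have hm := mc_div mc k mm; have hT := logder_div_T_exp ad k mo m0 mT.
have ho := mc_om mc hm.
have := remainder_T_exp ho (rem_slow hm hT) k (n - k).
rewrite [T ^+ k * _]mulrC divfK// subnKC// => h1.
apply: (dom_trans h1); apply: (dom_trans _ red).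
have [_ h2] := lim_iter_nat ad mo mnp la kn.
have io := om_it n.+1 mo; have Dho := om_D ho.
have h3 : x ^+ k.+1 * phi (D (m / T ^+ k)) <~ phi (iter n.+1 D m) * x ^+ n.+1.
  rewrite -!embed_exp// -!(de_mul ephi)//; apply/(de_dom ephi) => //.
  - by apply: omM => //; exact: (om_exp ad).
  - by apply: omM => //; exact: (om_exp ad).
apply: (dom_mul2r (expf_neq0 n.+1 x0)).
have -> : phi (D (m / T ^+ k)) * delta * x ^+ k * (x^-1 * delta) ^+ n * x ^+ n.+1 =
    x ^+ k.+1 * phi (D (m / T ^+ k)) * delta ^+ n.+1.
  rewrite exprMn exprVn !exprS; have xn : x ^+ n != 0 by rewrite expf_neq0.
  by move: (x ^+ n) (x ^+ k) (delta ^+ n) xn => a1 a2 a3 a10; field.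
rewrite [X in _ <~ X]mulrAC; exact: domMr.
Qed.

End Remainder.

(** * Strongly linear maps *)

Section Sums.
Variables (S : sizeClass) (R : realType) (d : Order.disp_t) (M : oagType d).
Local Notation H := (hahnSeries S R M).
Variable I : choiceType.
Implicit Types (F G : I -> H) (s t : H).

Lemma sums_to_coef F s m (A : set I) : sums_to F s ->
  (forall i, supp (F i) m -> A i) -> s m = \sum_(i \in A) F i m.
Proof.
move=> [_ ->] FA; apply/esym/fsbig_widen => // i [_ nA] /=.
by apply: suppPn => /FA.
Qed.

Lemma sums_toD F G s t : sums_to F s -> sums_to G t ->
  sums_to (fun i => F i + G i) (s + t).
Proof.
move=> Fs Gt; have [[sF wF fF] _] := Fs; have [[sG wG fG] _] := Gt.
have sub : \bigcup_i supp (F i + G i) `<=` \bigcup_i supp (F i) `|` \bigcup_i supp (G i).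
  by move=> m [i _ /suppD[h|h]]; [left|right]; exists i.
have fin m : finite_set ([set i | supp (F i) m] `|` [set i | supp (G i) m]).
  by rewrite finite_setU.
split; first split.
- by apply: small_subset sub _; exact: small_setU.
- by apply: well_based_sub sub _; exact: well_basedU.
- by move=> m; apply: sub_finite_set (fin m) => i /suppD.
move=> m; pose A := [set i | supp (F i) m] `|` [set i | supp (G i) m].
rewrite hcoefD (@sums_to_coef F s m A)//; last by move=> i; left.
rewrite (@sums_to_coef G t m A)//; last by move=> i; right.
rewrite -fsbig_split; last exact: fin.
apply: fsbig_widen => // i [_ nA] /=.
by apply: (@suppPn _ _ _ _ (F i + G i)) => /suppD.
Qed.

Lemma sums_toZ r F s : sums_to F s -> sums_to (fun i => const r * F i) (const r * s).
Proof.
move=> Fs; have [[sF wF fF] sE] := Fs.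
have sub : \bigcup_i supp (const r * F i) `<=` \bigcup_i supp (F i).
  by move=> m [i _ /supp_constM h]; exists i.
split; first split.
- exact: small_subset sub _.
- exact: well_based_sub sub _.
- by move=> m; apply: sub_finite_set (fF m) => i /supp_constM.
move=> m; rewrite hcoef_const sE mulr_fsumr; apply: eq_fsbigr => i _.
by rewrite hcoef_const.
Qed.

End Sums.

Section StronglyLinear.
Variables (S : sizeClass) (R : realType).

(** Relative to a set [A] of monomials because derivations and compositions are constrained on
    omega-series only. *)
Definition strongly_linear d1 (M1 : oagType d1) d2 (M2 : oagType d2)
    (A : set M1) (P : hahnSeries S R M1 -> hahnSeries S R M2) : Prop :=
  forall f, supp f `<=` A -> sums_to (fun m => const (f m) * P (monomial m)) (P f).

Section Basics.
Variables (d1 d2 : Order.disp_t) (M1 : oagType d1) (M2 : oagType d2).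
Local Notation H1 := (hahnSeries S R M1).
Local Notation H2 := (hahnSeries S R M2).
Variable A : set M1.
Implicit Types (P Q : H1 -> H2) (f g : H1).

Lemma slin_ext P Q : strongly_linear A P -> strongly_linear A Q ->
  (forall m, A m -> P (monomial m) = Q (monomial m)) ->
  forall f, supp f `<=` A -> P f = Q f.
Proof.
move=> lP lQ PQ f fA; apply: sums_to_uniq (lP f fA) _.
suff -> : (fun m => const (f m) * P (monomial m)) =
          (fun m => const (f m) * Q (monomial m)) by exact: lQ.
apply/funext => m; have [->|fm] := eqVneq (f m) 0; first by rewrite const0 !mul0r.
by rewrite PQ//; exact: fA.
Qed.

Lemma slin_congr P Q : (forall m, A m -> P (monomial m) = Q (monomial m)) ->
  (forall f, supp f `<=` A -> P f = Q f) ->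
  strongly_linear A P -> strongly_linear A Q.
Proof.
move=> PQm PQ lP f fA; rewrite -PQ//.
suff <- : (fun m => const (f m) * P (monomial m)) =
          (fun m => const (f m) * Q (monomial m)) by exact: lP.
apply/funext => m; have [->|fm] := eqVneq (f m) 0; first by rewrite const0 !mul0r.
by rewrite PQm//; exact: fA.
Qed.

Lemma slinD P f g : strongly_linear A P -> supp f `<=` A -> supp g `<=` A ->
  P (f + g) = P f + P g.
Proof.
move=> lP fA gA; have fgA : supp (f + g) `<=` A by move=> m /suppD[/fA|/gA].
apply: sums_to_uniq (lP _ fgA) _.
suff -> : (fun m => const ((f + g) m) * P (monomial m)) =
    (fun m => const (f m) * P (monomial m) + const (g m) * P (monomial m)).
  by apply: sums_toD; exact: lP.
by apply/funext => m; rewrite hcoefD constD mulrDl.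
Qed.

Lemma slinZ P r f : strongly_linear A P -> supp f `<=` A ->
  P (const r * f) = const r * P f.
Proof.
move=> lP fA; have rfA : supp (const r * f) `<=` A by move=> m /supp_constM/fA.
apply: sums_to_uniq (lP _ rfA) _.
suff -> : (fun m => const ((const r * f) m) * P (monomial m)) =
    (fun m => const r * (const (f m) * P (monomial m))).
  by apply: sums_toZ; exact: lP.
by apply/funext => m; rewrite hcoef_const constM mulrA.
Qed.

Lemma slin0 P : strongly_linear A P -> P 0 = 0.
Proof.
move=> lP; have := @slinZ P 0 0 lP; rewrite const0 !mul0r; apply.
by move=> m /supp0.
Qed.

Lemma slin_add P Q : strongly_linear A P -> strongly_linear A Q ->
  strongly_linear A (fun f => P f + Q f).
Proof.
move=> lP lQ f fA.
have -> : (fun m => const (f m) * (P (monomial m) + Q (monomial m))) =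
    (fun m => const (f m) * P (monomial m) + const (f m) * Q (monomial m)).
  by apply/funext => m; rewrite mulrDr.
by apply: sums_toD; [exact: lP|exact: lQ].
Qed.

Lemma slin_dom P f (g : H2) : strongly_linear A P -> supp f `<=` A ->
  (forall m, supp f m -> P (monomial m) <~ g) -> P f <~ g.
Proof.
move=> lP fA Pg; apply: sums_to_dom (lP f fA) _ => m.
have [->|fm] := eqVneq (f m) 0; first by rewrite const0 mul0r.
by apply: dom_constM; exact: Pg.
Qed.

Lemma slin_sdom P f (g : H2) : g != 0 -> strongly_linear A P -> supp f `<=` A ->
  (forall m, supp f m -> P (monomial m) <<~ g) -> P f <<~ g.
Proof.
move=> g0 lP fA Pg; apply: sums_to_sdom (lP f fA) _ => // m.
have [->|fm] := eqVneq (f m) 0.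
  by rewrite const0 mul0r => /dom0r/eqP; apply/negP.
by apply: sdom_constM; exact: Pg.
Qed.

End Basics.

Lemma slin_sub d1 (M1 : oagType d1) d2 (M2 : oagType d2) (A B : set M1)
    (P : hahnSeries S R M1 -> hahnSeries S R M2) :
  A `<=` B -> strongly_linear B P -> strongly_linear A P.
Proof. by move=> AB lP f fA; apply: lP; exact: subset_trans AB. Qed.

Lemma slin_mul d (M : oagType d) (u : hahnSeries S R M) :
  strongly_linear setT (fun f => u * f).
Proof.
move=> f _; pose F m := const (f m) * (u * monomial m).
have FE m k : F m k = f m * u (m^-1 * k)%g.
  by rewrite /F hcoef_const [u * _]mulrC hcoef_monomial.
have FS m k : supp (F m) k -> supp f m /\ supp u (m^-1 * k)%g.
  by rewrite /supp /mkset FE mulf_eq0 negb_or => /andP.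
have [sS sW] := is_supp_mul (is_supp_supp f) (is_supp_supp u).
have sub : \bigcup_m supp (F m) `<=` mulset (supp f) (supp u).
  move=> k [m _ /FS[fm um]]; exists m, (m^-1 * k)%g; split=> //.
  by rewrite mulVKg.
split; first split.
- exact: small_subset sub _.
- exact: well_based_sub sub _.
- move=> k; apply: (@sub_finite_set _ _ (supp f `&` [set m | supp u (m^-1 * k)%g])).
    by move=> m; exact: (FS m k).
  exact: mul_fin.
move=> k; rewrite mulrC hcoefM; apply: eq_fsbigr => m _.
by rewrite -FE.
Qed.

Section Composite.
Variables (d1 d2 d3 : Order.disp_t) (M1 : oagType d1) (M2 : oagType d2) (M3 : oagType d3).
Local Notation H1 := (hahnSeries S R M1).
Local Notation H2 := (hahnSeries S R M2).
Local Notation H3 := (hahnSeries S R M3).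
Variables (A : set M1) (B : set M2) (P : H1 -> H2) (Q : H2 -> H3).

Lemma slin_comp : strongly_linear A P ->
  (forall f, supp f `<=` A -> supp (P f) `<=` B) -> strongly_linear B Q ->
  strongly_linear A (fun f => Q (P f)).
Proof.
move=> lP PB lQ f fA.
have Am m : supp f m -> supp (monomial m : H1) `<=` A.
  by move=> fm k /supp_monomialE ->; exact: fA.
pose F m := const (f m) * P (monomial m).
have Ff : sums_to F (P f) by exact: lP.
have [[sC wC finF] _] := Ff.
pose C := \bigcup_m supp (F m).
have FP m k : supp f m -> supp (P (monomial m)) k -> supp (F m) k.
  by move=> fm Pk; rewrite /supp /mkset hcoef_const mulf_neq0.
have FP' m k : supp (F m) k -> supp f m /\ supp (P (monomial m)) k.
  by rewrite /supp /mkset hcoef_const mulf_eq0 negb_or => /andP.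
have CB : C `<=` B.
  by move=> k [m _ /FP'[fm]]; apply: PB; exact: Am.
(* The indicator series of [C], called [h] below. Its coefficients on [C] being 1, summability of
   the terms of Q h means summability of Q(k) over all k in [C], including those that cancel in P
   f. *)
pose c k : R := if `[<C k>] then 1 else 0.
have cC k : c k != 0 -> C k.
  by rewrite /c; case: asboolP => // _; rewrite eqxx.
pose h := mk_series (conj sC wC) cC.
have hE k : C k -> h k = 1 by rewrite /= /c; case: asboolP.
have hB : supp h `<=` B by move=> k /cC /CB.
pose G k := const (h k) * Q (monomial k).
have [[sG wG finG] _] : sums_to G (Q h) by exact: lQ.
have GE k n : C k -> supp (Q (monomial k)) n -> supp (G k) n.
  by move=> Ck qk; rewrite /supp /mkset hcoef_const hE// mul1r.
have PC m : supp f m -> supp (P (monomial m)) `<=` C.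
  by move=> fm k Pk; exists m => //; exact: FP.
pose W m := const (f m) * Q (P (monomial m)).
have WS m n : supp (W m) n -> exists k, supp (G k) n /\ supp (F m) k.
  rewrite /supp /mkset hcoef_const mulf_eq0 negb_or => /andP[fm /=].
  have /sums_to_supp /[apply] := lQ _ (PB _ (Am _ fm)).
  move=> [k]; rewrite /supp /mkset hcoef_const mulf_eq0 negb_or => /andP[pk qk].
  exists k; split; last exact: FP.
  by apply: GE => //; exact: (PC m).
have sub : \bigcup_m supp (W m) `<=` \bigcup_k supp (G k).
  by move=> n [m _ /WS[k [Gk _]]]; exists k.
(* Finite index sets that carry the whole double sum for the coefficient at n, so that the
   summations may be exchanged. *)
pose E n := [set k | supp (G k) n].
pose E2 n := \bigcup_(k in E n) [set m | supp (F m) k].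
have finE2 n : finite_set (E2 n).
  by apply: bigcup_finite => [|k _]; [exact: finG|exact: finF].
have subE2 n m : supp (W m) n -> E2 n m by move=> /WS[k [Gk Fk]]; exists k.
split; first split.
- exact: small_subset sub _.
- exact: well_based_sub sub _.
- by move=> n; apply: sub_finite_set (finE2 n) => m /subE2.
move=> n; pose q k := Q (monomial k) n.
have PfC : supp (P f) `<=` C.
  by move=> k /(sums_to_supp Ff)[m Fm]; exists m.
have coefQ g : supp g `<=` C -> Q g n = \sum_(k \in E n) g k * q k.
  move=> gC; have gB : supp g `<=` B by exact: subset_trans CB.
  rewrite (@sums_to_coef _ _ _ _ _ _ _ n (E n) (lQ g gB)).
    by apply: eq_fsbigr => k _; rewrite hcoef_const.
  move=> k; rewrite /supp /mkset hcoef_const mulf_eq0 negb_or => /andP[/gC Ck].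
  exact: GE.
transitivity (\sum_(k \in E n) \sum_(m \in E2 n) f m * (P (monomial m) k * q k)).
  rewrite coefQ//; apply: eq_fsbigr => k; rewrite inE => Ek.
  rewrite (@sums_to_coef _ _ _ _ _ _ _ k (E2 n) Ff); last by move=> m Fm; exists k.
  rewrite mulr_fsuml; apply: eq_fsbigr => m _.
  by rewrite hcoef_const mulrA.
rewrite exchange_fsbig//; last exact: finG.
transitivity (\sum_(m \in E2 n) W m n); last first.
  apply: fsbig_widen => // m [_ nE]; apply: (@suppPn _ _ _ _ (W m)) => /subE2; exact: nE.
apply: eq_fsbigr => m; rewrite inE => -[k _ /FP'[fm _]].
rewrite hcoef_const coefQ; last exact: PC.
by rewrite mulr_fsumr.
Qed.

End Composite.

Lemma slin_mulP d1 (M1 : oagType d1) d2 (M2 : oagType d2) (A : set M1)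
    (P : hahnSeries S R M1 -> hahnSeries S R M2) u :
  strongly_linear A P -> strongly_linear A (fun f => u * P f).
Proof.
by move=> lP; apply: (@slin_comp _ _ _ _ _ _ A setT P (fun f => u * f)) => //; exact: slin_mul.
Qed.

End StronglyLinear.

Section SumsExist.
Variables (S : sizeClass) (R : realType) (d : Order.disp_t) (M : oagType d).
Local Notation H := (hahnSeries S R M).

Lemma summable_sums (I : choiceType) (F : I -> H) :
  summable_family F -> exists s, sums_to F s.
Proof.
move=> sF; have [sS sW _] := sF; pose c m := \sum_(i \in [set: I]) F i m.
have cA m : c m != 0 -> (\bigcup_i supp (F i)) m.
  move=> cm; apply: contrapT => nF; move/eqP: cm; apply; apply: fsbig1 => i _.
  by apply: suppPn => Fi; apply: nF; exists i.
by exists (mk_series (conj sS sW) cA); split.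
Qed.

Lemma sums_to_tail (F : nat -> H) s N m : sums_to F s ->
  supp (s - \sum_(i < N) F i) m -> exists2 k, (N <= k)%N & supp (F k) m.
Proof.
move=> Fs sm; apply: contrapT => nF; move: sm; apply/negP; rewrite negbK.
rewrite hcoefB hcoef_sum (@sums_to_coef _ _ _ _ _ _ _ m `I_N Fs).
  by rewrite -(fsbig_ord _ _ (fun i => F i m)) subrr.
move=> k Fk /=; rewrite ltnNge; apply/negP => Nk; apply: nF; by exists k.
Qed.

Lemma sums_to_tail_dom (F : nat -> H) s N g : sums_to F s ->
  (forall k, (N <= k)%N -> F k <~ g) -> s - \sum_(i < N) F i <~ g.
Proof.
move=> Fs Fg; apply/dom_supp => m /(sums_to_tail Fs)[k Nk Fk].
exact: dom_trans (supp_dom Fk) (Fg k Nk).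
Qed.

End SumsExist.

(** * Logarithm and exponential of series *)

(* [ord_ge N] plays the role of the N-th power of the ideal generated by the
   infinitesimal monomials in [A].  Since these powers intersect in 0, an identity
   between power series may be checked on polynomial truncations, one order at a
   time; there it follows from its derivative in an auxiliary variable. *)
Section Filtration.
Variables (S : sizeClass) (R : realType) (d : Order.disp_t) (M : oagType d).
Local Notation H := (hahnSeries S R M).
Variable A : set M.
Hypotheses (hA : is_supp S A) (A1 : forall a, A a -> (a < 1)%O%g).
Implicit Types (f g : H) (p q : {poly H}) (N k : nat).

Definition ord_ge N f := forall m, supp f m -> exists2 k, (N <= k)%N & powset A k m.

Lemma powset_mul j k a b :
  powset A j a -> powset A k b -> powset A (j + k) (a * b)%g.
Proof.
elim: j a => [|j IH] a /=; first by move=> ->; rewrite mul1g.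
move=> [u [v [Au pv ->]]] pb; exists u, (v * b)%g; split=> //; first exact: IH.
by rewrite mulgA.
Qed.

Lemma ord_geW N k f : (N <= k)%N -> ord_ge k f -> ord_ge N f.
Proof. by move=> Nk fk m /fk[j kj pj]; exists j => //; exact: leq_trans kj. Qed.

Lemma ord_ge_zero N : ord_ge N 0.
Proof. by move=> m /supp0. Qed.

Lemma ord_geD N f g : ord_ge N f -> ord_ge N g -> ord_ge N (f + g).
Proof. by move=> fN gN m /suppD[/fN|/gN]. Qed.

Lemma ord_geN N f : ord_ge N f -> ord_ge N (- f).
Proof. by move=> fN m /suppN/fN. Qed.

Lemma ord_geB N f g : ord_ge N f -> ord_ge N g -> ord_ge N (f - g).
Proof. by move=> fN gN; apply: ord_geD => //; apply: ord_geN. Qed.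

Lemma ord_geMn N f n : ord_ge N f -> ord_ge N (f *+ n).
Proof.
move=> fN; elim: n => [|n IH]; first by rewrite mulr0n; exact: ord_ge_zero.
by rewrite mulrS; exact: ord_geD.
Qed.

Lemma ord_ge_sum N I (r : seq I) (P : pred I) (F : I -> H) :
  (forall i, P i -> ord_ge N (F i)) -> ord_ge N (\sum_(i <- r | P i) F i).
Proof.
move=> FN; elim/big_rec: _ => [|i x Pi xN]; first exact: ord_ge_zero.
by apply: ord_geD => //; exact: FN.
Qed.

Lemma ord_geM N k f g : ord_ge N f -> ord_ge k g -> ord_ge (N + k) (f * g).
Proof.
move=> fN gk m /suppM[a [b [/fN[i Ni pi] /gk[j kj pj] ->]]].
by exists (i + j)%N; [exact: leq_add|exact: powset_mul].
Qed.

Lemma ord_ge_const r : ord_ge 0 (const r).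
Proof. by move=> m /supp_const ->; exists 0%N. Qed.

Lemma ord_ge1 : ord_ge 0 1.
Proof. exact: ord_ge_const. Qed.

Lemma ord_ge_constM N r f : ord_ge N f -> ord_ge N (const r * f).
Proof. by move=> fN; rewrite -[N]add0n; apply: ord_geM => //; exact: ord_ge_const. Qed.

Lemma ord_geX N f : ord_ge 1 f -> ord_ge N (f ^+ N).
Proof.
move=> f1; elim: N => [|N IH]; first exact: ord_ge1.
by rewrite exprS -add1n; exact: ord_geM.
Qed.

Lemma ord_ge_subXX N n f g : ord_ge 0 f -> ord_ge 0 g -> ord_ge N (f - g) ->
  ord_ge N (f ^+ n - g ^+ n).
Proof.
move=> f0 g0 fg; have X0 h k : ord_ge 0 h -> ord_ge 0 (h ^+ k).
  move=> h0; elim: k => [|k IH]; first exact: ord_ge1.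
  by rewrite exprS -[0%N]addn0; exact: ord_geM.
rewrite subrXX -[N]addn0; apply: ord_geM => //; apply: ord_ge_sum => i _.
by rewrite -[0%N]addn0; apply: ord_geM; apply: X0.
Qed.

(** By Neumann's lemma a monomial is a product of k elements of A for finitely many k only. *)
Lemma ord_ge_sep f : (forall N, ord_ge N f) -> f = 0.
Proof.
move=> fN; apply: series_eqP => m; rewrite hcoef0; apply: suppPn => fm.
have /finite_seqP[s sE] := genset_finite hA.2 A1 m.
have [k Nk pk] := fN (\max_(n <- s) n).+1 m fm.
have : (k \in s) by have : [set n | powset A n m] k by []; rewrite sE.
move=> /(@leq_bigmax_seq _ s xpredT id)-/(_ isT) /= h.
by rewrite leqNgt Nk in h.
Qed.

Lemma supp_ord_ge f : supp f `<=` A -> ord_ge 1 f.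
Proof.
move=> fA m /fA Am; exists 1%N => //; exists m, 1%g; split=> //.
by rewrite mulg1.
Qed.

Lemma ord_ge_inf f : ord_ge 1 f -> infinitesimal f.
Proof.
move=> f1; apply/infinitesimalP => m /f1[[//|k] _ [a [b [Aa pb ->]]]].
have b1 : (b <= 1)%O%g by apply: (@genset_le1 _ _ A) => //; exists k.
apply: (@le_lt_trans _ _ (a * 1)%g); first by rewrite oag_le2l.
by rewrite mulg1; exact: A1.
Qed.

Definition pord_ge N p := forall i, ord_ge N p`_i.

Lemma pord_geD N p q : pord_ge N p -> pord_ge N q -> pord_ge N (p + q).
Proof. by move=> pN qN i; rewrite coefD; exact: ord_geD. Qed.

Lemma pord_geB N p q : pord_ge N p -> pord_ge N q -> pord_ge N (p - q).
Proof. by move=> pN qN i; rewrite coefB; exact: ord_geB. Qed.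

Lemma pord_geN N p : pord_ge N p -> pord_ge N (- p).
Proof. by move=> pN i; rewrite coefN; exact: ord_geN. Qed.

Lemma pord_geM N k p q : pord_ge N p -> pord_ge k q -> pord_ge (N + k) (p * q).
Proof. by move=> pN qk i; rewrite coefM; apply: ord_ge_sum => j _; exact: ord_geM. Qed.

Lemma pord_geW N k p : (N <= k)%N -> pord_ge k p -> pord_ge N p.
Proof. by move=> Nk pk i; apply: ord_geW (pk i). Qed.

Lemma pord_geC N f : ord_ge N f -> pord_ge N f%:P.
Proof. by move=> fN i; rewrite coefC; case: ifP => // _; exact: ord_ge_zero. Qed.

Lemma pord_ge_polyX : pord_ge 0 'X.
Proof. by move=> i; rewrite coefX; case: eqP => _; [exact: ord_ge1|exact: ord_ge_zero]. Qed.

Lemma pord_ge1 : pord_ge 0 1.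
Proof. exact/pord_geC/ord_ge1. Qed.

Lemma pord_ge_sum N I (r : seq I) (P : pred I) (F : I -> {poly H}) :
  (forall i, P i -> pord_ge N (F i)) -> pord_ge N (\sum_(i <- r | P i) F i).
Proof.
move=> FN; elim/big_rec: _ => [|i x Pi xN]; first by move=> i; rewrite coef0; exact: ord_ge_zero.
by apply: pord_geD => //; exact: FN.
Qed.

Lemma pord_geX N p : pord_ge 1 p -> pord_ge N (p ^+ N).
Proof.
move=> p1; elim: N => [|N IH]; first exact: pord_ge1.
by rewrite exprS -add1n; exact: pord_geM.
Qed.

Lemma pord_ge_deriv N p : pord_ge N p -> pord_ge N p^`().
Proof.
by move=> pN i; rewrite coef_deriv; apply: ord_geMn.
Qed.

(** Division by the unit 1 + q: in p = (1 + q) p - q p the last term has one order more than is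
    known of p, so each pass gains one order. *)
Lemma pord_ge_cancel N p q : pord_ge 0 p -> pord_ge 1 q ->
  pord_ge N ((1 + q) * p) -> pord_ge N p.
Proof.
move=> p0 q1 pN; suff : forall k, (k <= N)%N -> pord_ge k p by apply.
elim=> [//|k IH] kN; have -> : p = (1 + q) * p - q * p by rewrite mulrDl mul1r addrK.
apply: pord_geB; first exact: pord_geW pN.
by rewrite -add1n; apply: pord_geM => //; apply: IH; exact: ltnW.
Qed.

Lemma pord_ge_primitive N p : p`_0 = 0 -> pord_ge N p^`() -> pord_ge N p.
Proof.
move=> p0 dp [|i]; first by rewrite p0; exact: ord_ge_zero.
move=> m pm; apply: (dp i m); rewrite coef_deriv.
by rewrite /supp /mkset hcoefMn mulrn_eq0 negb_or.
Qed.

Lemma ord_ge_eval1 N p : pord_ge N p -> ord_ge N p.[1].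
Proof.
move=> pN; rewrite horner_coef; apply: ord_ge_sum => i _.
by rewrite expr1n mulr1.
Qed.

Lemma ord_summable (F : nat -> H) : (forall n, ord_ge n (F n)) -> summable_family F.
Proof.
move=> FN; have [sG wG] := is_supp_gen hA A1.
have sub : \bigcup_n supp (F n) `<=` genset A.
  by move=> m [n _ /FN[k _ pk]]; exists k.
split; [exact: small_subset sub _|exact: well_based_sub sub _|] => m.
have /finite_seqP[s sE] := genset_finite hA.2 A1 m.
apply: (@sub_finite_set _ _ `I_(\max_(n <- s) n).+1) => [n Fn|]; last exact: finite_II.
have [k nk pk] := FN n m Fn; rewrite /= ltnS; apply: leq_trans nk _.
have : (k \in s) by have : [set n | powset A n m] k by []; rewrite sE.
by move=> /(@leq_bigmax_seq _ s xpredT id)-/(_ isT).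
Qed.

Lemma ord_tail (F : nat -> H) s N : (forall n, ord_ge n (F n)) -> sums_to F s ->
  ord_ge N (s - \sum_(i < N) F i).
Proof.
move=> FN Fs m /(sums_to_tail Fs)[k Nk /FN[j kj pj]].
by exists j => //; exact: leq_trans kj.
Qed.

End Filtration.

Section LogExp.
Variables (S : sizeClass) (R : realType) (d : Order.disp_t) (M : oagType d).
Local Notation H := (hahnSeries S R M).
Implicit Types (a b e y : H).

(** Both families start with the first power: the sums are log(1 + e) and, for [exp_term], exp(y) -
    1, which are infinitesimal with e and y. *)
Definition log_term e (n : nat) : H := const ((-1) ^+ n / n.+1%:R) * e ^+ n.+1.
Definition exp_term y (n : nat) : H := const (n.+1`!%:R^-1) * y ^+ n.+1.

Definition log_poly N (Y : {poly H}) : {poly H} :=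
  \sum_(n < N) (const ((-1) ^+ n / n.+1%:R))%:P * Y ^+ n.+1.
Definition exp_poly N (Y : {poly H}) : {poly H} :=
  \sum_(n < N) (const (n.+1`!%:R^-1))%:P * Y ^+ n.+1.

Lemma deriv_expS n (Y : {poly H}) : (Y ^+ n.+1)^`() = n.+1%:R * (Y^`() * Y ^+ n).
Proof. by rewrite deriv_exp /= mulr_natl. Qed.

Lemma polyC_nat (n : nat) : (const n%:R : H)%:P = n%:R.
Proof. by rewrite const_nat polyC_natr. Qed.

Lemma deriv_monomialS (c : R) n (Y : {poly H}) :
  ((const c)%:P * Y ^+ n.+1)^`() = (const (c * n.+1%:R))%:P * (Y^`() * Y ^+ n).
Proof.
by rewrite derivM derivC mul0r add0r deriv_expS -polyC_nat !mulrA -polyCM -constM.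
Qed.

Lemma polyC_signr n : (const ((-1) ^+ n) : H)%:P = (-1) ^+ n.
Proof.
by elim: n => [|k IH]; rewrite ?expr0// !exprS constM polyCM IH constN const1 polyCN polyC1.
Qed.

Lemma log_poly_deriv N Y :
  (1 + Y) * (log_poly N Y)^`() = Y^`() * (1 - (- Y) ^+ N).
Proof.
have -> : (log_poly N Y)^`() = Y^`() * \sum_(n < N) (- Y) ^+ n.
  rewrite /log_poly raddf_sum mulr_sumr; apply: eq_bigr => n _.
  by rewrite /= deriv_monomialS divfK ?pnatr_eq0// mulrCA polyC_signr [(- Y) ^+ _]exprNn.
rewrite -[1 - _]opprB subrX1 mulrCA; congr (_ * _).
by rewrite -mulNr opprB opprK.
Qed.

Lemma exp_poly_deriv N Y :
  (exp_poly N Y)^`() = Y^`() * (1 + exp_poly N Y - (const (N`!%:R^-1))%:P * Y ^+ N).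
Proof.
elim: N => [|N IH].
  by rewrite /exp_poly !big_ord0 deriv0 addr0 fact0 invr1 const1 expr0 mulr1 subrr mulr0.
have -> : exp_poly N.+1 Y = exp_poly N Y + (const (N.+1`!%:R^-1))%:P * Y ^+ N.+1.
  by rewrite /exp_poly big_ord_recr.
rewrite derivD IH deriv_monomialS.
have -> : (N.+1`!%:R^-1 : R) * N.+1%:R = N`!%:R^-1.
  by rewrite factS natrM invfM mulrAC mulVf ?mul1r// pnatr_eq0.
rewrite addrA addrK mulrCA -mulrDr subrK//.
Qed.

Section Identities.
Variable A : set M.
Hypotheses (hA : is_supp S A) (A1 : forall m, A m -> (m < 1)%O%g).
Local Notation ordA := (@ord_ge S R d M A).
Local Notation pordA := (@pord_ge S R d M A).

Lemma ord_log_term e n : ordA 1 e -> ordA n.+1 (log_term e n).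
Proof. by move=> e1; apply: ord_ge_constM; apply: ord_geX. Qed.

Lemma ord_exp_term e n : ordA 1 e -> ordA n.+1 (exp_term e n).
Proof. by move=> e1; apply: ord_ge_constM; apply: ord_geX. Qed.

Lemma pord_log_poly N Y : pordA 1 Y -> pordA 1 (log_poly N Y).
Proof.
move=> Y1; apply: pord_ge_sum => n _; rewrite -[1%N]add0n; apply: pord_geM.
  exact/pord_geC/ord_ge_const.
by apply: (@pord_geW _ _ _ _ _ _ n.+1) => //; exact: pord_geX.
Qed.

Lemma pord_exp_poly N Y : pordA 1 Y -> pordA 1 (exp_poly N Y).
Proof.
move=> Y1; apply: pord_ge_sum => n _; rewrite -[1%N]add0n; apply: pord_geM.
  exact/pord_geC/ord_ge_const.
by apply: (@pord_geW _ _ _ _ _ _ n.+1) => //; exact: pord_geX.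
Qed.

Lemma log_poly_eval N Y x : (log_poly N Y).[x] = \sum_(n < N) log_term Y.[x] n.
Proof. by rewrite /log_poly horner_sum; apply: eq_bigr => n _; rewrite hornerM hornerC horner_exp. Qed.

Lemma exp_poly_eval N Y x : (exp_poly N Y).[x] = \sum_(n < N) exp_term Y.[x] n.
Proof. by rewrite /exp_poly horner_sum; apply: eq_bigr => n _; rewrite hornerM hornerC horner_exp. Qed.

Lemma log_terms0 N : \sum_(n < N) log_term 0 n = 0.
Proof. by rewrite big1// => n _; rewrite /log_term expr0n mulr0. Qed.

Lemma exp_terms0 N : \sum_(n < N) exp_term 0 n = 0.
Proof. by rewrite big1// => n _; rewrite /exp_term expr0n mulr0. Qed.

Lemma pord_linear c : ordA 1 c -> pordA 1 (c%:P * 'X).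
Proof.
move=> c1; rewrite -[1%N]addn0; apply: pord_geM; first exact: pord_geC.
exact: pord_ge_polyX.
Qed.

Lemma log_trunc_mul N a b : ordA 1 a -> ordA 1 b ->
  ordA N (\sum_(n < N) log_term (a + (1 + a) * b) n -
          \sum_(n < N) log_term a n - \sum_(n < N) log_term b n).
Proof.
(* Along this path 1 + Y = (1 + a)(1 + b X), so [p] is the defect of the functional equation of log
   for truncations. It vanishes at X = 0 and is wanted at X = 1. *)
move=> a1 b1; pose Y := a%:P + ((1 + a) * b)%:P * 'X; pose Z := b%:P * 'X : {poly H}.
pose p := log_poly N Y - log_poly N a%:P - log_poly N Z.
have ab1 : ordA 1 ((1 + a) * b).
  rewrite -[1%N]add0n; apply: ord_geM => //; apply: ord_geD; first exact: ord_ge1.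
  exact: ord_geW a1.
have Y1 : pordA 1 Y by apply: pord_geD; [exact: pord_geC|exact: pord_linear].
have Z1 : pordA 1 Z by exact: pord_linear.
have p1 : pordA 1 p.
  by apply: pord_geB; [apply: pord_geB|]; apply: pord_log_poly => //; exact: pord_geC.
suff pN : pordA N p.
  have := ord_ge_eval1 pN; rewrite /p !hornerD !hornerN !log_poly_eval.
  by rewrite !hornerE.
apply: pord_ge_primitive.
  by rewrite -horner_coef0 /p !hornerD !hornerN !log_poly_eval !hornerE log_terms0 subr0 subrr.
have dp0 : pordA 0 p^`() by apply: pord_ge_deriv; apply: pord_geW p1.
apply: (@pord_ge_cancel _ _ _ _ _ _ _ (a%:P + Z + a%:P * Z)) => //.
  apply: pord_geD; first by apply: pord_geD => //; exact: pord_geC.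
  by apply: (@pord_geW _ _ _ _ _ _ 2) => //; apply: (@pord_geM _ _ _ _ _ 1 1) => //; exact: pord_geC.
have YE : 1 + Y = 1 + (a%:P + Z + a%:P * Z).
  by rewrite /Y /Z polyCM polyCD polyC1; ring.
have -> : (1 + (a%:P + Z + a%:P * Z)) * p^`() =
    ((1 + a) * b)%:P * ((- Z) ^+ N - (- Y) ^+ N).
  have dY : Y^`() = ((1 + a) * b)%:P.
    by rewrite /Y derivD derivC derivM derivC derivX mul0r !add0r mulr1.
  have dZ : Z^`() = b%:P by rewrite /Z derivM derivC derivX mul0r !add0r mulr1.
  have ZE : 1 + (a%:P + Z + a%:P * Z) = (1 + a%:P) * (1 + Z) by ring.
  have da : (log_poly N a%:P)^`() = 0.
    rewrite /log_poly raddf_sum big1// => n _ /=.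
    by rewrite -polyC_exp -polyCM derivC.
  rewrite /p !derivB da subr0 mulrBr -{1}YE log_poly_deriv dY ZE -mulrA log_poly_deriv dZ.
  by rewrite polyCM polyCD polyC1; ring.
rewrite -[N]add0n; apply: pord_geM; first by apply: pord_geC; apply: ord_geW ab1.
by apply: pord_geB; apply: pord_geX; exact: pord_geN.
Qed.

Lemma log_exp_trunc N y : ordA 1 y ->
  ordA N (\sum_(n < N) log_term (\sum_(k < N) exp_term y k) n - y).
Proof.
(* [p] is the truncation of log(exp(y X)) - y X; again it vanishes at X = 0 and is wanted at X =
   1. *)
move=> y1; pose Z := y%:P * 'X : {poly H}; pose E := exp_poly N Z.
pose p := log_poly N E - Z.
have Z1 : pordA 1 Z by exact: pord_linear.
have E1 : pordA 1 E by exact: pord_exp_poly.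
have p1 : pordA 1 p by apply: pord_geB => //; apply: pord_log_poly.
suff pN : pordA N p.
  have := ord_ge_eval1 pN; rewrite /p !hornerD !hornerN log_poly_eval exp_poly_eval.
  by rewrite !hornerE.
apply: pord_ge_primitive.
  rewrite -horner_coef0 /p !hornerD !hornerN log_poly_eval exp_poly_eval !hornerE.
  by rewrite exp_terms0 log_terms0 subr0.
apply: (@pord_ge_cancel _ _ _ _ _ _ _ E) => //.
  by apply: pord_ge_deriv; apply: pord_geW p1.
have dZ : Z^`() = y%:P by rewrite /Z derivM derivC derivX mul0r !add0r mulr1.
pose c := (const (N`!%:R^-1) : H)%:P.
have -> : (1 + E) * p^`() =
    y%:P * (- (c * Z ^+ N) * (1 - (- E) ^+ N) - (1 + E) * (- E) ^+ N).
  rewrite /p derivB dZ mulrBr log_poly_deriv /E exp_poly_deriv dZ -/E -/c; ring.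
have EN : pordA N ((- E) ^+ N) by apply: pord_geX; exact: pord_geN.
have E0 : pordA 0 (1 + E) by apply: pord_geD; [exact: pord_ge1|exact: pord_geW E1].
rewrite -[N in pord_ge _ N _]add0n; apply: pord_geM; first by apply: pord_geC; apply: ord_geW y1.
apply: pord_geB; last by rewrite -[N in pord_ge _ N _]add0n; apply: pord_geM.
rewrite -[N in pord_ge _ N _]addn0; apply: pord_geM.
  apply: pord_geN; rewrite -[N in pord_ge _ N _]add0n; apply: pord_geM; last exact: pord_geX.
  exact/pord_geC/ord_ge_const.
by apply: pord_geB; [exact: pord_ge1|exact: pord_geW EN].
Qed.

End Identities.

Lemma log_sums_exist e : infinitesimal e -> exists s, sums_to (log_term e) s.
Proof.
move=> /infinitesimalP e1; apply: summable_sums.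
apply: (ord_summable (is_supp_supp e) e1) => n; apply: (@ord_geW _ _ _ _ _ _ n.+1) => //.
by apply: ord_log_term; exact: supp_ord_ge.
Qed.

Lemma exp_sums_exist e : infinitesimal e -> exists s, sums_to (exp_term e) s.
Proof.
move=> /infinitesimalP e1; apply: summable_sums.
apply: (ord_summable (is_supp_supp e) e1) => n; apply: (@ord_geW _ _ _ _ _ _ n.+1) => //.
by apply: ord_exp_term; exact: supp_ord_ge.
Qed.

(* 1 + (a + (1 + a) b) = (1 + a) (1 + b) *)
Lemma log_sums_mul a b sa sb : infinitesimal a -> infinitesimal b ->
  sums_to (log_term a) sa -> sums_to (log_term b) sb ->
  sums_to (log_term (a + (1 + a) * b)) (sa + sb).
Proof.
move=> /infinitesimalP a1 /infinitesimalP b1 Sa Sb.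
pose A := supp a `|` supp b.
have hA : is_supp S A by apply: is_suppU; exact: is_supp_supp.
have A1 m : A m -> (m < 1)%O%g by move=> [/a1|/b1].
have aA : ord_ge A 1 a by apply: supp_ord_ge; exact: subsetUl.
have bA : ord_ge A 1 b by apply: supp_ord_ge; exact: subsetUr.
have cA : ord_ge A 1 (a + (1 + a) * b).
  apply: ord_geD => //; rewrite -[1%N]add0n; apply: ord_geM => //.
  by apply: ord_geD; [exact: ord_ge1|exact: ord_geW aA].
have term e n : ord_ge A 1 e -> ord_ge A n (log_term e n).
  by move=> eA; apply: (@ord_geW _ _ _ _ _ _ n.+1) => //; exact: ord_log_term.
have [s Ss] := summable_sums (ord_summable hA A1 (fun n => term _ n cA)).
suff <- : s = sa + sb by [].
apply/eqP; rewrite -subr_eq0; apply/eqP; apply: (ord_ge_sep hA A1) => N.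
have hs := ord_tail (N := N) (fun n => term _ n cA) Ss.
have ha := ord_tail (N := N) (fun n => term _ n aA) Sa.
have hb := ord_tail (N := N) (fun n => term _ n bA) Sb.
have h := log_trunc_mul (N := N) aA bA.
have := ord_geD (ord_geB (ord_geB hs ha) hb) h.
by congr ord_ge; ring.
Qed.

Lemma log_sums_exp y e : infinitesimal y -> sums_to (exp_term y) e ->
  infinitesimal e /\ sums_to (log_term e) y.
Proof.
move=> /infinitesimalP y1 Se; pose A := supp y.
have hA := is_supp_supp y.
have yA : ord_ge A 1 y by exact: supp_ord_ge.
have eterm n : ord_ge A n (exp_term y n).
  by apply: (@ord_geW _ _ _ _ _ _ n.+1) => //; exact: ord_exp_term.
have eA : ord_ge A 1 e.
  have := ord_tail (N := 0) eterm Se; rewrite big_ord0 subr0 => e0 m.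
  move=> /(sums_to_supp Se)[n /(ord_exp_term yA)[k nk pk]].
  by exists k => //; exact: leq_trans nk.
split; first exact: ord_ge_inf eA.
have term n : ord_ge A n (log_term e n).
  by apply: (@ord_geW _ _ _ _ _ _ n.+1) => //; exact: ord_log_term.
have [s Ss] := summable_sums (ord_summable hA y1 term).
suff <- : s = y by [].
apply/eqP; rewrite -subr_eq0; apply/eqP; apply: (ord_ge_sep hA y1) => N.
have hs := ord_tail (N := N) term Ss.
have he := ord_tail (N := N) eterm Se.
have h := log_exp_trunc (N := N) yA.
pose E := \sum_(k < N) exp_term y k.
have EA : ord_ge A 0 E by apply: ord_ge_sum => n _; apply: ord_geW (eterm n).
(* The tail e - E has order N, hence so does the change of every power when e is replaced by its
   truncation E. *)
have h2 : ord_ge A N (\sum_(n < N) log_term e n - \sum_(n < N) log_term E n).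
  rewrite -sumrB; apply: ord_ge_sum => n _; rewrite /log_term -mulrBr.
  by apply: ord_ge_constM; apply: ord_ge_subXX => //; exact: ord_geW eA.
have := ord_geD (ord_geD hs h2) h.
by congr ord_ge; rewrite -/E; ring.
Qed.

End LogExp.

Section HahnSplit.
Variables (S : sizeClass) (R : realType) (d : Order.disp_t) (M : oagType d).
Local Notation H := (hahnSeries S R M).
Implicit Types (f g e : H).

Lemma lmon_1D e : infinitesimal e -> lmon (1 + e) = 1%g.
Proof.
move=> /infinitesimalP e1; have ez m : (1 <= m)%O%g -> e m = 0.
  by move=> m1; apply: suppPn => /e1; rewrite ltNge m1.
apply: lmon_eq => [|n n1].
  by rewrite hcoefD ez// addr0 [(1 : H) _]hcoef_term eqxx oner_eq0.
by rewrite hcoefD ez ?ltW// addr0 [(1 : H) _]hcoef_term (gt_eqF n1).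
Qed.

Lemma lcoef_1D e : infinitesimal e -> lcoef (1 + e) = 1.
Proof.
move=> ei; rewrite /lcoef lmon_1D// hcoefD [(1 : H) _]hcoef_term eqxx.
move/infinitesimalP : ei => e1; rewrite (suppPn (f := e)) ?addr0//.
by move=> /e1; rewrite ltxx.
Qed.

Lemma pos_split f : 0 < f -> exists e, infinitesimal e /\
  f = hterm S (lcoef f) (lmon f) * (1 + e).
Proof.
move=> f0; have f1 : f != 0 by rewrite gt_eqF.
pose t := hterm S (lcoef f) (lmon f).
have t0 : t != 0 by rewrite term_eq0 lcoef_eq0.
exists (f / t - 1); split; last by rewrite addrC subrK mulrC divfK.
have {1}-> : f / t - 1 = (f - t) / t by rewrite mulrBl divff.
rewrite /infinitesimal -(divff t0); apply: sdomMr; first by rewrite invr_eq0.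
apply: sdom_supp => // m fm.
have [tm _] := asymp_lmon t0; rewrite lmon_term ?lcoef_eq0// in tm.
apply: sdom_dom_trans _ (asymp_lmon t0).2; rewrite lmon_term ?lcoef_eq0//.
apply/sdom_monomial; rewrite ltNge; apply/negP => le; move: fm.
rewrite /supp /mkset hcoefB hcoef_term; move: le; rewrite le_eqVlt => /predU1P[<-|lt].
  by rewrite eqxx subrr eqxx.
by rewrite (gt_eqF lt) subr0 hcoef_gt_lmon ?eqxx.
Qed.

Definition inf_part f : H.
Proof.
by apply: (@mk_series _ _ _ _ (fun m => if (1 < m)%O%g then f m else 0) (supp f));
  [exact: is_supp_supp|move=> m; case: ifP => // _; rewrite eqxx].
Defined.

Lemma inf_partE f m : inf_part f m = if (1 < m)%O%g then f m else 0.
Proof. by []. Qed.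

Lemma supp_inf_part f m : supp (inf_part f) m -> (1 < m)%O%g /\ supp f m.
Proof. by rewrite /supp /mkset inf_partE; case: ifP => // _; rewrite eqxx. Qed.

Definition small_part f := f - inf_part f - const (f 1%g).

Lemma supp_small_part f m : supp (small_part f) m -> (m < 1)%O%g /\ supp f m.
Proof.
rewrite /supp /mkset !hcoefB inf_partE hcoef_term.
by case: (ltgtP m 1%g) => [m1|m1|->]; rewrite ?subr0 ?subrr ?eqxx.
Qed.

Lemma small_part_inf f : infinitesimal (small_part f).
Proof. by apply/infinitesimalP => m /supp_small_part[]. Qed.

Lemma split3 f : f = inf_part f + const (f 1%g) + small_part f.
Proof. by rewrite /small_part; ring. Qed.

Lemma infinitesimal_dom1 e : infinitesimal e -> e <~ 1.
Proof. exact: sdomW. Qed.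

Lemma log_term_dom e n : infinitesimal e -> log_term e n <~ e.
Proof.
move=> /infinitesimal_dom1 e1; apply: dom_constM; rewrite exprS -[X in _ <~ X]mulr1.
by apply: domMl; rewrite -(expr1n _ n); exact: domX.
Qed.

Lemma log_sums_inf e s : infinitesimal e -> sums_to (log_term e) s -> infinitesimal s.
Proof.
move=> ei Ss; apply: (dom_sdom_trans _ ei); apply: sums_to_dom Ss _ => n.
exact: log_term_dom.
Qed.

(** Because log(1 + e) - e ≼ e^2, a vanishing logarithm would give e ≼ e^2, impossible for e
    infinitesimal and non-zero. *)
Lemma log_sums_eq0 e : infinitesimal e -> sums_to (log_term e) 0 -> e = 0.
Proof.
move=> ei Ss; have [//|e0] := eqVneq e 0; exfalso.
have := @sums_to_tail_dom _ _ _ _ _ _ 1 (e * e) Ss.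
rewrite big_ord_recl big_ord0 addr0 sub0r /log_term expr0 invr1 mulr1 const1 mul1r expr1.
have /[swap]/[apply] : forall k, (1 <= k)%N ->
    const ((-1) ^+ k / k.+1%:R) * e ^+ k.+1 <~ e * e.
  case=> // k _; apply: dom_constM; rewrite !exprS mulrA -[X in _ <~ X]mulr1.
  by apply: domMl; rewrite -(expr1n _ k); exact: domX (infinitesimal_dom1 ei).
move=> h; apply: ei; apply: (dom_mul2l e0); rewrite mulr1.
by apply: dom_trans h; apply: domNr.
Qed.

Lemma infinitesimal0 : infinitesimal (0 : H).
Proof. by move=> /dom0r/eqP; rewrite oner_eq0. Qed.

Lemma log_sums1 : sums_to (log_term (0 : H)) 0.
Proof.
have i0 := @infinitesimal0; have [s Ss] := log_sums_exist i0.
suff s0 : s = 0 by rewrite -{2}s0.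
apply: dom0r; apply: sums_to_dom Ss _ => n; exact: log_term_dom.
Qed.

End HahnSplit.

Section LogExpField.
Variables (S : sizeClass) (R : realType) (V : transseriesField S R).
Implicit Types (f g e : V) (m : mon V).
Local Notation H := (hahnSeries S R (mon V)).

Lemma mlog1 : mlog (1%g : mon V) = 0.
Proof. by have := mlogM (1%g : mon V) 1%g; rewrite mulg1 => /eqP; rewrite -subr_eq subrr eq_sym => /eqP. Qed.

Lemma mlogV m : mlog m^-1%g = - mlog m.
Proof. by apply/eqP; rewrite -addr_eq0 -mlogM mulVg mlog1. Qed.

Lemma mlog_inj : injective (@mlog _ _ V).
Proof. by move=> a b ab; apply/eqP; rewrite eq_le -!mlog_le ab !lexx. Qed.

Lemma mlog_lt (m n : mon V) : (mlog m < mlog n) = (m < n)%O.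
Proof. by rewrite !ltNge mlog_le. Qed.

Lemma mlog_J m : purely_infinite (mlog m).
Proof. by rewrite -mlog_range; exists m. Qed.

Lemma mexp_exists (g : V) : purely_infinite g -> exists m : mon V, mlog m = g.
Proof. by rewrite -mlog_range => -[m _ <-]; exists m. Qed.

Lemma mlog_eq0 m : (mlog m == 0) = (m == 1%g).
Proof. by rewrite -mlog1 (inj_eq mlog_inj). Qed.

Lemma purely_infinite_sdom (g : V) : purely_infinite g -> g != 0 -> 1 <<~ g.
Proof.
move=> gJ g0; apply: sdom_dom_trans (asymp_lmon g0).2.
by apply/sdom_monomial; apply: gJ; exact: supp_lmon.
Qed.

Lemma tlogE r m e s : 0 < r -> infinitesimal e -> sums_to (log_term e) s ->
  tlog (hterm S r m * (1 + e) : V) = mlog m + const (ln r) + s.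
Proof.
move=> r0 ei Ss; have r1 : r != 0 by rewrite gt_eqF.
have t0 : hterm S r m != 0 by rewrite term_eq0.
have e0 : 1 + e != 0 by rewrite -lcoef_eq0 lcoef_1D// oner_eq0.
have lE : lmon (hterm S r m * (1 + e)) = m.
  by rewrite lmonM// lmon_term// lmon_1D// mulg1.
have cE : lcoef (hterm S r m * (1 + e)) = r.
  by rewrite lcoefM lcoef_term lcoef_1D// mulr1.
rewrite /tlog lE cE; congr (_ + _).
rewrite mulrAC divff// mul1r [1 + e]addrC addrK.
exact: sums_to_infsum.
Qed.

Opaque tlog.

Lemma tlog_monomial m : tlog (monomial m : V) = mlog m.
Proof.
have := tlogE m (@ltr01 R) (@infinitesimal0 S R _ (mon V)) (log_sums1 S R (mon V)).
by rewrite [1 + 0]addr0 mulr1 ln1 const0 !addr0.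
Qed.

Lemma tlogM f g : 0 < f -> 0 < g -> tlog (f * g : V) = tlog f + tlog g.
Proof.
move=> f0 g0; have [a [ai fE]] := pos_split f0; have [b [bi gE]] := pos_split g0.
have lf : 0 < lcoef f by rewrite -series_gt0.
have lg : 0 < lcoef g by rewrite -series_gt0.
have [sa Sa] := log_sums_exist ai; have [sb Sb] := log_sums_exist bi.
rewrite {2}fE {2}gE (tlogE _ lf ai Sa) (tlogE _ lg bi Sb).
have -> : f * g = hterm S (lcoef f * lcoef g) (lmon f * lmon g)%g * (1 + (a + (1 + a) * b)).
  by rewrite {1}fE {1}gE !term_const constM monomialM; ring.
have ci : infinitesimal (a + (1 + a) * b).
  apply: (sdomD ai).
  have h : 1 + a <~ 1 by apply: domD; [exact: dom_refl|exact: infinitesimal_dom1].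
  by have := domMr b h; rewrite mul1r => h2; exact: dom_sdom_trans h2 bi.
rewrite (tlogE _ _ ci (log_sums_mul ai bi Sa Sb)) ?mulr_gt0//.
by rewrite mlogM lnM ?posrE// constD; ring.
Qed.

(** A monomial, a real and a factor 1 + e account for the purely infinite, constant and
    infinitesimal parts of f. Together with [tlog_inj] this makes the choice in [texp] a true
    inverse. *)
Lemma tlog_surj f : exists g, 0 < g /\ tlog g = f.
Proof.
have [|m mE] := @mexp_exists (inf_part f); first by move=> m /supp_inf_part[].
have yi := @small_part_inf _ _ _ _ f; have [e Se] := exp_sums_exist yi.
have [ei Sl] := log_sums_exp yi Se.
have r0 : 0 < expR (f 1%g) by exact: expR_gt0.
exists (hterm S (expR (f 1%g)) m * (1 + e)); split.
  by rewrite series_gt0 lcoefM lcoef_term lcoef_1D// mulr1.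
by rewrite (tlogE _ r0 ei Sl) expRK mE -split3.
Qed.

(** The three summands of the logarithm are infinite, of the size of 1 and infinitesimal unless they
    are 0, so they vanish separately. *)
Lemma tlog_eq0 f : 0 < f -> tlog f = 0 -> f = 1.
Proof.
move=> f0; have [a [ai fE]] := pos_split f0.
have lf : 0 < lcoef f by rewrite -series_gt0.
have [sa Sa] := log_sums_exist ai; have si := log_sums_inf ai Sa.
rewrite fE (tlogE _ lf ai Sa) => E.
have m1 : mlog (lmon f) = 0.
  have [//|m0] := eqVneq (mlog (lmon f)) 0; exfalso.
  apply: (purely_infinite_sdom (@mlog_J (lmon f)) m0).
  have -> : mlog (lmon f) = - (const (ln (lcoef f)) + sa).
    by apply/eqP; rewrite -addr_eq0 addrA E.
  by apply: domN; apply: domD; [exact: const_dom|exact: infinitesimal_dom1].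
have r1 : ln (lcoef f) = 0.
  have [//|r0] := eqVneq (ln (lcoef f)) 0; exfalso.
  apply: si; apply: dom_trans (const_asymp S (mon V) r0).2 _.
  have -> : const (ln (lcoef f)) = - sa.
    by move: E; rewrite m1 add0r => /eqP; rewrite addr_eq0 => /eqP.
  exact: domN.
have s0 : sa = 0 by move: E; rewrite m1 r1 const0 !add0r.
rewrite s0 in Sa; rewrite (log_sums_eq0 ai Sa) addr0 mulr1.
have -> : lmon f = 1%g by apply/eqP; rewrite -mlog_eq0 m1.
have -> : lcoef f = 1 by apply: (@ln_inj R); rewrite ?posrE// ln1.
by [].
Qed.

Lemma tlog_inj f g : 0 < f -> 0 < g -> tlog f = tlog g -> f = g.
Proof.
move=> f0 g0 fg; have g1 : g != 0 by rewrite gt_eqF.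
have q0 : 0 < f / g by rewrite divr_gt0.
have h : tlog (f / g) = 0.
  apply: (addIr (tlog g)); rewrite -tlogM ?add0r.
  - by rewrite divfK.
  - exact: q0.
  - exact: g0.
by rewrite -[f](divfK g1) (tlog_eq0 q0 h) mul1r.
Qed.

Lemma texpP f : 0 < texp f /\ tlog (texp f) = f.
Proof. exact: (@xgetPex _ 0 [set g : V | 0 < g /\ tlog g = f] (tlog_surj f)). Qed.

Opaque texp.

Lemma texp_gt0 f : 0 < texp f. Proof. by case: (texpP f). Qed.
Lemma texpK f : tlog (texp f) = f. Proof. by case: (texpP f). Qed.
Lemma tlogK f : 0 < f -> texp (tlog f) = f.
Proof. by move=> f0; apply: tlog_inj (texp_gt0 _) f0 (texpK _). Qed.
Lemma texp_neq0 f : texp f != 0. Proof. by rewrite gt_eqF// texp_gt0. Qed.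

Lemma texpD f g : texp (f + g) = texp f * texp g.
Proof.
apply: tlog_inj; [exact: texp_gt0|exact: mulr_gt0 (texp_gt0 _) (texp_gt0 _)|].
by rewrite (tlogM (texp_gt0 _) (texp_gt0 _)) !texpK.
Qed.

Lemma tlog1 : tlog (1 : V) = 0.
Proof. by rewrite -monomial1 tlog_monomial mlog1. Qed.

Lemma texp0 : texp (0 : V) = 1.
Proof. by rewrite -tlog1 (tlogK ltr01). Qed.

Lemma texpN f : texp (- f) = (texp f)^-1.
Proof.
by apply: (mulfI (texp_neq0 f)); rewrite -texpD subrr texp0 (divff (texp_neq0 f)).
Qed.

Lemma texp_mlog m : texp (mlog m) = monomial m.
Proof. by rewrite -tlog_monomial (tlogK (monomial_gt0 _ _ m)). Qed.

Lemma texp_const r : texp (const r : V) = const (expR r).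
Proof.
apply: tlog_inj; [exact: texp_gt0|by rewrite series_gt0 lcoef_term expR_gt0|].
rewrite texpK; have := tlogE 1%g (expR_gt0 r) (@infinitesimal0 S R _ (mon V)) (log_sums1 S R (mon V)).
rewrite [1 + 0]addr0 mulr1 mlog1 expRK add0r addr0 => ->; reflexivity.
Qed.

Lemma texp_small y : infinitesimal y -> exists e,
  [/\ infinitesimal e, sums_to (exp_term y) e & texp (y : V) = 1 + e].
Proof.
move=> yi; have [e Se] := exp_sums_exist yi; have [ei Sl] := log_sums_exp yi Se.
exists e; split=> //; apply: tlog_inj; [exact: texp_gt0|by rewrite series_gt0 lcoef_1D|].
rewrite texpK.
have := tlogE 1%g (@ltr01 R) ei Sl.
by rewrite mlog1 ln1 const0 !add0r term1 mul1r => ->.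
Qed.

Lemma texp_dom1 (u : V) : u <~ 1 -> texp u <~ 1.
Proof.
move=> /dom1_split[r [e [-> ei]]]; rewrite texpD texp_const.
have [e' [e'i _ ->]] := texp_small ei.
rewrite -[X in _ <~ X]mul1r; apply: domM; first exact: const_dom.
by apply: domD => //; exact: infinitesimal_dom1.
Qed.


Lemma exp_term_dom (y : V) k n : y <~ 1 -> (n <= k)%N -> exp_term y k <~ y ^+ n.+1.
Proof.
move=> y1 nk; apply: dom_constM; rewrite -(subnKC nk) -addSn exprD.
by rewrite -[X in _ <~ X]mulr1; apply: domMl; rewrite -(expr1n _ (k - n)); exact: domX.
Qed.

(** If b ≍ 1, every term is ≼ 1 ≼ b^n; if b is infinitesimal, the difference is the tail of the
    exponential series. *)
Lemma texp_taylor (b : V) n : b <~ 1 ->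
  texp b - \sum_(i < n) const (i`!%:R^-1) * b ^+ i <~ b ^+ n.
Proof.
move=> b1; have [bu|bi] := pselect (1 <~ b).
  apply: (@dom_trans _ 1); last by rewrite -(expr1n _ n); exact: domX.
  apply: domB; first exact: texp_dom1.
  apply: dom_sum => i _; apply: dom_constM.
  by rewrite -(expr1n _ i); exact: domX.
case: n => [|n]; first by rewrite big_ord0 subr0 expr0; exact: texp_dom1.
have [e [_ Se ->]] := texp_small bi.
rewrite big_ord_recl expr0 mulr1 fact0 invr1 const1 opprD addrACA subrr add0r.
by apply: (sums_to_tail_dom (N := n) Se) => k; exact: exp_term_dom.
Qed.

(** For infinitesimal v the linear term dominates. Otherwise v has a standard part r != 0, and e^r -
    1 != 0 by injectivity of the real exponential. *)
Lemma texp_sub1 (v : V) : v <~ 1 -> texp v - 1 >~< v.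
Proof.
move=> v1; have [->|v0] := eqVneq v 0; first by rewrite texp0 subrr.
have [vu|vi] := pselect (1 <~ v); last first.
  have := texp_taylor 2 v1; rewrite !big_ord_recl big_ord0 /= addr0 expr0 expr1.
  rewrite /bump /= !invr1 const1 !mul1r => h.
  have -> : texp v - 1 = (texp v - (1 + v)) + v by ring.
  apply: asympDl; apply: dom_sdom_trans h _; rewrite expr2 -[X in _ <<~ X]mulr1.
  exact: sdomMl.
apply: asymp_trans (_ : 1 >~< v); last by split.
have [r [e [vE ei]]] := dom1_split v1; rewrite vE texpD texp_const.
have [e' [e'i _ ->]] := texp_small ei.
have r0 : r != 0.
  by apply/eqP => r0; move: vu; rewrite vE r0 const0 add0r; exact: ei.
have -> : const (expR r) * (1 + e') - 1 = const (expR r - 1) + const (expR r) * e' :> H.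
  by rewrite constD constN const1; ring.
have c1 : (const (expR r - 1) : H) >~< 1.
  by apply: const_asymp; rewrite subr_eq0 -(expR0 R) (inj_eq (@expR_inj R)).
apply: (asymp_trans _ c1); apply: asympDr; apply: sdom_constM.
exact: sdom_dom_trans e'i c1.2.
Qed.

Lemma tlog_dom1 (v : V) : 0 < v -> v >~< 1 -> tlog v <~ 1.
Proof.
move=> v0 v1; have [e [ei vE]] := pos_split v0.
have lv : 0 < lcoef v by rewrite -series_gt0.
have [s Ss] := log_sums_exist ei; rewrite vE (tlogE _ lv ei Ss).
have -> : lmon v = 1%g.
  have v2 : v != 0 by rewrite gt_eqF.
  have [h1 h2] := asymp_trans (asymp_sym v1) (asymp_lmon v2).
  by apply/eqP; rewrite eq_le; apply/andP; split; apply/(dom_monomial S R).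
rewrite mlog1 add0r; apply: domD; first exact: const_dom.
exact: infinitesimal_dom1 (log_sums_inf ei Ss).
Qed.

Section Support.
Variable G : set (mon V).
Hypotheses (G1 : G 1%g) (GM : forall a b, G a -> G b -> G (a * b)%g)
  (GV : forall a, G a -> G a^-1%g).

Lemma supp_group_mul f g : supp f `<=` G -> supp g `<=` G -> supp (f * g) `<=` G.
Proof. by move=> fG gG m /suppM[a [b [/fG Ga /gG Gb ->]]]; exact: GM. Qed.

Lemma supp_group_const r : supp (const r : V) `<=` G.
Proof. by move=> m /supp_const ->. Qed.

Lemma supp_group_exp f n : supp f `<=` G -> supp (f ^+ n) `<=` G.
Proof.
move=> fG; elim: n => [|n IH]; first exact: supp_group_const.
by rewrite exprS; exact: supp_group_mul.
Qed.

Lemma supp_group_sums (F : nat -> V) s : sums_to F s ->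
  (forall n, supp (F n) `<=` G) -> supp s `<=` G.
Proof. by move=> Fs FG m /(sums_to_supp Fs)[n /FG]. Qed.

(** Dividing f by its leading term stays within the group G, and so does the logarithm series; only
    the logarithm of the leading monomial can leave G. *)
Lemma supp_tlog f : 0 < f -> supp f `<=` G ->
  supp (tlog f) `<=` G `|` supp (mlog (lmon f)).
Proof.
move=> f0 fG; have [e [ei fE]] := pos_split f0.
have lf : 0 < lcoef f by rewrite -series_gt0.
have lf0 : lcoef f != 0 by rewrite gt_eqF.
have [s Ss] := log_sums_exist ei; rewrite {1}fE (tlogE _ lf ei Ss).
have Gl : G (lmon f) by apply: fG; apply: supp_lmon; rewrite gt_eqF.
have eG : supp e `<=` G.
  have -> : e = const (lcoef f)^-1 * (monomial (lmon f)^-1%g * f) - 1.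
    rewrite {3}fE term_const constV monomialV.
    have c0 : const (lcoef f) != 0 :> H by rewrite const_eq0.
    have m0 := monomial_neq0 S R (lmon f).
    set c := const _ in c0 *; set k := monomial _ in m0 *.
    have -> : c^-1 * (k^-1 * (c * k * (1 + e))) = (c / c) * (k / k) * (1 + e) by ring.
    by rewrite !divff// !mul1r addrC addKr.
  move=> m /suppD[|/suppN/supp_const -> //].
  apply: supp_group_mul; first exact: supp_group_const.
  apply: supp_group_mul => // k /supp_monomialE ->; exact: GV.
move=> m /suppD[/suppD[h|/supp_const ->]|h]; [by right|by left|left].
apply: (supp_group_sums Ss) h => n; apply: supp_group_mul.
  exact: supp_group_const.
exact: supp_group_exp.
Qed.

(** The purely infinite part of f exponentiates to one monomial a, and the other factor is supported
    in G. *)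
Lemma supp_texp f : supp f `<=` G -> exists2 a, supp (mlog a) `<=` G &
  supp (texp f) `<=` [set m | exists2 b, G b & m = (a * b)%g].
Proof.
move=> fG; have [|a aE] := @mexp_exists (inf_part f); first by move=> m /supp_inf_part[].
exists a; first by rewrite aE => m /supp_inf_part[_ /fG].
have yi := @small_part_inf _ _ _ _ f; have [e [ei Se tE]] := texp_small yi.
have yG : supp (small_part f) `<=` G by move=> m /supp_small_part[_ /fG].
have eG : supp e `<=` G.
  apply: (supp_group_sums Se) => n; apply: supp_group_mul.
    exact: supp_group_const.
  exact: supp_group_exp.
rewrite (_ : texp f = texp (inf_part f + const (f 1%g) + small_part f)); last by rewrite -split3.
rewrite 2!texpD -aE texp_mlog texp_const tE -mulrA.
move=> m /suppM[a' [b [/supp_monomialE -> h ->]]]; exists b => //.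
move: b h; apply: supp_group_mul; first exact: supp_group_const.
by move=> k /suppD[/supp_const ->|/eG].
Qed.

End Support.

End LogExpField.

(** * Omega-series *)

Section OmegaMonomials.
Variables (S : sizeClass) (R : realType) (V : transseriesField S R) (t : mon V).
Hypothesis t_atomic : log_atomic t.
Implicit Types (f g : V) (m a b : mon V).

Definition iter_log n : mon V :=
  xget 1%g [set a | iter n (@tlog S R V) (monomial t) = monomial a].

Lemma monomial_inj : injective (@monomial S R _ (mon V)).
Proof. by move=> a b ab; rewrite -(lmon_monomial S R a) ab lmon_monomial. Qed.

Lemma iter_logP n : iter n (@tlog S R V) (monomial t) = monomial (iter_log n).
Proof.
exact: (@xgetPex _ 1%g [set a | iter n (@tlog S R V) (monomial t) = monomial a]
  (t_atomic.2 n)).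
Qed.

Lemma iter_log0 : iter_log 0 = t.
Proof. by apply: monomial_inj; rewrite -iter_logP. Qed.

Lemma mlog_iter_log n : mlog (iter_log n) = monomial (iter_log n.+1).
Proof. by rewrite -iter_logP iterS iter_logP tlog_monomial. Qed.

Lemma iter_log_gt1 n : (1 < iter_log n)%O%g.
Proof.
case: n => [|n]; first by rewrite iter_log0; exact: t_atomic.1.
apply: (@mlog_J _ _ _ (iter_log n)); rewrite mlog_iter_log.
exact: supp_monomial.
Qed.

(* Omega-monomials are generated from the iterated logarithms of [t] by
   exponentiation alone, which makes them amenable to structural induction. *)
Inductive omega_mon : mon V -> Prop :=
  | omega_mon_log n : omega_mon (iter_log n)
  | omega_mon_exp m : (forall k, supp (mlog m) k -> omega_mon k) -> omega_mon m.

(** A one-constructor type rather than a definition, so that [om f] is not convertible to the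
    inclusion it wraps. *)
Variant om f : Prop := Om of supp f `<=` omega_mon.

Lemma omE f : om f -> supp f `<=` omega_mon.
Proof. by case. Qed.

Lemma om_mlog m : omega_mon m -> om (mlog m).
Proof.
case=> [n|{}m mG]; last exact: Om.
by apply: Om => k; rewrite mlog_iter_log => /supp_monomialE ->; constructor.
Qed.

Lemma omega_mon1 : omega_mon 1%g.
Proof. by constructor => k; rewrite mlog1 => /supp0. Qed.

Lemma omega_monM a b : omega_mon a -> omega_mon b -> omega_mon (a * b)%g.
Proof.
move=> /om_mlog/omE aG /om_mlog/omE bG; apply: omega_mon_exp => k.
by rewrite mlogM => /suppD[/aG|/bG].
Qed.

Lemma omega_monV a : omega_mon a -> omega_mon a^-1%g.
Proof.
by move=> /om_mlog/omE aG; apply: omega_mon_exp => k; rewrite mlogV => /suppN/aG.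
Qed.

Lemma om_monomial m : omega_mon m -> om (monomial m).
Proof. by move=> mG; apply: Om => k /supp_monomialE ->. Qed.

Lemma om_const r : om (const r).
Proof. by apply: Om => k /supp_const ->; exact: omega_mon1. Qed.

Lemma om0 : om 0. Proof. by apply: Om => k /supp0. Qed.
Lemma om1 : om 1. Proof. exact: om_const. Qed.

Lemma omD f g : om f -> om g -> om (f + g).
Proof. by move=> /omE fG /omE gG; apply: Om => m /suppD[/fG|/gG]. Qed.

Lemma omN f : om f -> om (- f).
Proof. by move=> /omE fG; apply: Om => m /suppN/fG. Qed.

Lemma omB f g : om f -> om g -> om (f - g).
Proof. by move=> fG gG; apply: omD => //; apply: omN. Qed.

Lemma omM f g : om f -> om g -> om (f * g).
Proof. by move=> /omE fG /omE gG; apply: Om => m /suppM[a [b [/fG Ga /gG Gb ->]]]; exact: omega_monM. Qed.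


Lemma om_tlog f : 0 < f -> om f -> om (tlog f).
Proof.
move=> f0 /omE fG; apply: Om => m.
move=> /(supp_tlog omega_mon1 omega_monM omega_monV f0 fG)[//|].
by apply: omE; apply: om_mlog; apply: fG; apply: supp_lmon; rewrite gt_eqF.
Qed.

Lemma om_texp f : om f -> om (texp f).
Proof.
move=> /omE fG; apply: Om => m; have [a aG h] := supp_texp omega_mon1 omega_monM fG.
by move=> /h[b bG ->]; apply: omega_monM bG; apply: omega_mon_exp.
Qed.

Lemma om_gt0_inv f : 0 < f -> om f -> om f^-1.
Proof.
move=> f0 fG; rewrite -[f](tlogK f0) -texpN.
exact: om_texp (omN (om_tlog f0 fG)).
Qed.

Lemma omV f : om f -> om f^-1.
Proof.
move=> fG; have [f0|f0|->] := ltrgt0P f; last by rewrite invr0; exact: om0.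
  exact: om_gt0_inv.
rewrite -[f]opprK invrN; apply/omN/om_gt0_inv; last exact: omN.
by rewrite oppr_gt0.
Qed.

Lemma om_sqrt f : 0 < f -> om f -> exists2 g, om g & g * g = f.
Proof.
move=> f0 fG; exists (texp (const 2^-1 * tlog f)).
  exact: om_texp (omM (om_const _) (om_tlog f0 fG)).
rewrite -texpD -mulrDl -constD (_ : 2^-1 + 2^-1 = 1 :> R) ?const1 ?mul1r ?tlogK//.
by rewrite -div1r -splitr.
Qed.

Lemma monomial_omega m : omega_mon m -> omega_series t (monomial m).
Proof.
elim=> {m} [n|m _ IH].
  elim: n => [|n IH]; first by rewrite iter_log0; exact: omega_var.
  rewrite -mlog_iter_log -tlog_monomial; apply: omega_log IH.
  exact: monomial_gt0.
by rewrite -texp_mlog; apply: omega_exp; apply: omega_sum.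
Qed.

(** Series over omega-monomials are already closed under exp, log and sums, so the richer rules of
    [omega_series] generate nothing new. *)
Lemma omP f : omega_series t f <-> om f.
Proof.
split=> [|/omE fG]; last by apply: omega_sum => m /fG; exact: monomial_omega.
elim=> {f} [r||f _ IH|f f0 _ IH|f _ IH].
- exact: om_const.
- by rewrite -iter_log0; apply: om_monomial; constructor.
- exact: om_texp.
- exact: om_tlog.
- by apply: Om => m fm; apply: (omE (IH m fm)); exact: supp_monomial.
Qed.

Lemma om_J m : omega_mon m -> omega_J t (mlog m).
Proof.
move=> mG k mk; split; first exact: mlog_J mk.
by apply: monomial_omega; exact: omE (om_mlog mG) k mk.
Qed.

Section Derivation.
Variables (D : V -> V) (D_deriv : is_omega_derivation t D).

Lemma om_deriv f : om f -> om (D f).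
Proof. by move=> /omP fG; apply/omP; exact: omega_deriv_closed. Qed.

Lemma deriv_slin : strongly_linear omega_mon D.
Proof. by move=> f /Om/omP fG; exact: (omega_deriv_sum D_deriv). Qed.

Lemma derivM_om f g : om f -> om g -> D (f * g) = D f * g + f * D g.
Proof. by move=> /omP fG /omP gG; exact: (omega_derivM D_deriv). Qed.

Lemma deriv_monomial m : omega_mon m -> D (monomial m) = monomial m * D (mlog m).
Proof. by move=> /om_J mJ; rewrite -texp_mlog (omega_deriv_exp D_deriv). Qed.

Lemma deriv1 : D 1 = 0.
Proof.
by have := deriv_monomial omega_mon1; rewrite mlog1 monomial1 mul1r (slin0 deriv_slin).
Qed.

Lemma deriv_const r : D (const r) = 0.
Proof.
have := slinZ r deriv_slin (omE om1).
by rewrite mulr1 deriv1 mulr0.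
Qed.

End Derivation.

Section Composition.
Variables (U : transseriesField S R) (comp : V -> U -> U).
Hypothesis comp_composition : is_omega_composition t comp.
Variables (x : U) (x_gtR : above_reals x).
Local Notation "f ^x" := (comp f x) (at level 2, format "f ^x").

Lemma comp_slin : strongly_linear omega_mon (fun f => f^x).
Proof. by move=> f /Om/omP fG; exact: (omega_comp_sum comp_composition _ x_gtR). Qed.

Lemma compD f g : om f -> om g -> (f + g)^x = f^x + g^x.
Proof. by move=> /omE fG /omE gG; exact: slinD comp_slin fG gG. Qed.

Lemma comp0 : 0^x = 0. Proof. exact: slin0 comp_slin. Qed.

Lemma comp_monomial m : omega_mon m -> (monomial m)^x = texp (mlog m)^x.
Proof. by move=> /om_J mJ; rewrite -texp_mlog (omega_comp_exp comp_composition). Qed.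

Lemma comp1 : 1^x = 1.
Proof.
rewrite -(monomial1 S R (mon V)) (comp_monomial omega_mon1) mlog1 comp0.
exact: texp0.
Qed.

Lemma comp_constM r f : om f -> (const r * f)^x = const r * f^x.
Proof. by move=> /omE; exact: slinZ comp_slin. Qed.


Lemma compN f : om f -> (- f)^x = - f^x.
Proof.
by move=> fG; have := comp_constM (-1) fG; rewrite !constN !const1 !mulN1r.
Qed.

Lemma comp_monomialM a b : omega_mon a -> omega_mon b ->
  (monomial a * monomial b)^x = (monomial a)^x * (monomial b)^x.
Proof.
move=> aG bG; rewrite -monomialM !comp_monomial//; last exact: omega_monM.
by rewrite mlogM compD ?texpD//; exact: om_mlog.
Qed.

Lemma slin_mul_om u : strongly_linear omega_mon (fun f : V => u * f).
Proof. by apply: (@slin_sub _ _ _ _ _ _ _ setT) => //; exact: slin_mul. Qed.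

(** Both sides are strongly linear in g and then in f, which reduces the claim to two monomials,
    where it is the law exp(a + b) = exp(a) exp(b). *)
Lemma compM f g : om f -> om g -> (f * g)^x = f^x * g^x.
Proof.
move=> fG /omE; move: g; apply: slin_ext.
- apply: slin_comp (slin_mul_om f) _ comp_slin => g /Om gG.
  by apply: omE; exact: omM.
- by apply: slin_mulP; exact: comp_slin.
move=> a aG; rewrite mulrC [RHS]mulrC; move: f {fG} (omE fG); apply: slin_ext.
- apply: slin_comp (slin_mul_om _) _ comp_slin => g /Om gG; apply: omE; apply: omM gG.
  exact: om_monomial.
- by apply: slin_mulP; exact: comp_slin.
- by move=> b bG; exact: comp_monomialM.
Qed.


Lemma comp_neq0 f : om f -> f != 0 -> f^x != 0.
Proof.
move=> fG f0; apply/eqP => fx0.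
have := compM fG (omV fG); rewrite divff// comp1 fx0 mul0r => /eqP.
by rewrite oner_eq0.
Qed.

(* Positive omega-series are squares, so a ring morphism preserves the order. *)
Lemma comp_gt0 f : om f -> 0 < f -> 0 < f^x.
Proof.
move=> fG f0; rewrite lt_neqAle eq_sym comp_neq0 ?gt_eqF//.
by have [g gG <-] := om_sqrt f0 fG; rewrite compM// -expr2 sqr_ge0.
Qed.

Lemma comp_ge0 f : om f -> 0 <= f -> 0 <= f^x.
Proof.
move=> fG; rewrite le_eqVlt => /predU1P[<-|f0]; first by rewrite comp0.
by apply: ltW; exact: comp_gt0.
Qed.

Lemma om_norm f : om f -> om `|f|.
Proof. by case: (ger0P f) => // _; exact: omN. Qed.

Lemma comp_norm f : om f -> `|f|^x = `|f^x|.
Proof.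
move=> fG; have [f0|/ltW f0] := ger0P f; first by rewrite ger0_norm// comp_ge0.
rewrite compN// ler0_norm// -oppr_ge0 -compN//; apply: comp_ge0; first exact: omN.
by rewrite oppr_ge0.
Qed.

Lemma comp_le f g : om f -> om g -> (f^x <= g^x) = (f <= g).
Proof.
move=> fG gG; have gfG : om (g - f) by exact: omB.
have E : (g - f)^x = g^x - f^x by rewrite compD ?compN//; exact: omN.
apply/idP/idP => [|fg]; last by rewrite -subr_ge0 -E comp_ge0// subr_ge0.
apply: contraTT; rewrite -!ltNge => fg; rewrite -subr_gt0.
have -> : f^x - g^x = (f - g)^x by rewrite compD ?compN//; exact: omN.
by apply: comp_gt0; [exact: omB|rewrite subr_gt0].
Qed.

Lemma comp_dom f g : om f -> om g -> f^x <~ g^x <-> f <~ g.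
Proof.
move=> fG gG; have aG := om_norm gG; have aE := comp_norm gG.
have bG := om_norm fG; have bE := comp_norm fG.
have fP : f <~ g <-> exists n : nat, `|f| <= n%:R * `|g| by exact: domP.
move: aG aE bG bE fP; move: `|f| `|g| => b a aG aE bG bE fP.
have E n : n%:R * `|g^x| = (const n%:R * a)^x.
  by rewrite comp_constM// const_nat -aE.
have C n : om (const n%:R * a) by apply: omM aG; exact: om_const.
have H n : (`|f^x| <= n%:R * `|g^x|) = (b <= n%:R * a).
  by rewrite E -bE (comp_le bG (C n)) const_nat.
split=> [/domP[n]|/fP[n]] fg; [apply/fP|apply/domP]; exists n.
  by rewrite -H.
by rewrite H.
Qed.

End Composition.

End OmegaMonomials.

(** * Monotonicity of the derivation for dominance *)

Section LeadingTerm.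
Variables (S : sizeClass) (R : realType).
Variables (d1 d2 : Order.disp_t) (M1 : oagType d1) (M2 : oagType d2).
Variables (A : set M1) (P : hahnSeries S R M1 -> hahnSeries S R M2).
Hypothesis P_slin : strongly_linear A P.

Lemma slin_lead f : supp f `<=` A -> f != 0 -> P (monomial (lmon f)) != 0 ->
  (forall k, supp f k -> (k < lmon f)%O -> P (monomial k) <<~ P (monomial (lmon f))) ->
  P f >~< P (monomial (lmon f)).
Proof.
move=> fA f0 P0 Pk; set n := lmon f in P0 Pk *.
have fn : supp f n by exact: supp_lmon.
pose g := f - const (f n) * monomial n.
have gS m : supp g m -> supp f m /\ (m < n)%O.
  move=> gm; have mn : m != n.
    apply: contraTneq gm => ->; rewrite /supp /mkset hcoefB hcoef_const.
    by rewrite [monomial n n]hcoef_term eqxx mulr1 subrr eqxx.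
  have fm : supp f m.
    move: gm; rewrite /supp /mkset hcoefB hcoef_const [monomial n m]hcoef_term.
    by rewrite (negPf mn) mulr0 subr0.
  by split=> //; rewrite lt_neqAle mn; exact: (lmonP f0).2.
have cA : supp (monomial n : hahnSeries S R M1) `<=` A.
  by move=> m /supp_monomialE ->; exact: fA.
have gA : supp g `<=` A by move=> m /gS[/fA].
have fE : f = const (f n) * monomial n + g by rewrite /g addrC subrK.
rewrite {1}fE (slinD P_slin) //; last by move=> m /supp_constM/cA.
rewrite (slinZ _ P_slin cA).
have cn : const (f n) * P (monomial n) >~< P (monomial n).
  by rewrite -[X in _ >~< X]mul1r; apply: asympM => //; exact: const_asymp.
apply: (asymp_trans _ cn); apply: asympDr; apply: (sdom_dom_trans _ cn.2).
apply: (slin_sdom P0 P_slin gA) => m /gS[fm mn]; exact: Pk.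
Qed.

End LeadingTerm.

Section AsymptoticDerivation.
Variables (S : sizeClass) (R : realType) (V : transseriesField S R) (t : mon V).
Hypothesis t_atomic : log_atomic t.
Variables (D : V -> V) (D_deriv : is_omega_derivation t D).
Implicit Types (f g : V) (m a b : mon V).
Local Notation H := (hahnSeries S R (mon V)).
Local Notation ell := (iter_log t).
Local Notation om := (om t).
Local Notation mono := (fun m => monomial m : V).

Lemma sdom_lt f g : 0 < g -> f <<~ g -> f < g.
Proof.
move=> g0 fg; rewrite ltNge; apply/negP => gf; apply: fg; apply: dom_le.
by rewrite (ger0_norm (ltW g0)) (ger0_norm (le_trans (ltW g0) gf)).
Qed.

Lemma mlog_gt0 m : (1 < m)%O%g -> 0 < mlog m.
Proof. by rewrite -mlog_lt mlog1. Qed.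

Lemma mlog_sdom1 m : m != 1%g -> 1 <<~ mlog m.
Proof.
move=> m1; apply: purely_infinite_sdom; first exact: mlog_J.
by rewrite mlog_eq0.
Qed.

Lemma mlog_sdom m : (1 < m)%O%g -> mlog m <<~ monomial m.
Proof.
move=> m1 h; have g0 := mlog_gt0 m1.
have l2 : mlog m ^+ 2 <~ monomial m.
  apply: dom_le; rewrite (ger0_norm (exprn_ge0 _ (ltW g0))).
  by rewrite (ger0_norm (ltW (monomial_gt0 _ _ _))) ltW// mlog_growth.
apply: (mlog_sdom1 (m := m)); first by rewrite gt_eqF.
have g1 : mlog m != 0 by rewrite gt_eqF.
by apply: (dom_mul2l g1); rewrite mulr1 -expr2; exact: dom_trans l2 h.
Qed.

Lemma monomialX m r : monomial m ^+ r = monomial (m ^+ r)%g :> H.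
Proof.
elim: r => [|r IH]; first by rewrite expr0 expg0.
by rewrite exprS IH expgS monomialM.
Qed.

Lemma mlogX m r : mlog (m ^+ r)%g = mlog m *+ r.
Proof.
elim: r => [|r IH]; first by rewrite expg0 mlog1 mulr0n.
by rewrite expgS mlogM IH mulrS.
Qed.

Lemma deriv_ell n : D (monomial (ell n)) = monomial (ell n) * D (monomial (ell n.+1)).
Proof.
rewrite -(mlog_iter_log t_atomic); apply: (deriv_monomial t_atomic D_deriv).
exact: omega_mon_log.
Qed.

Lemma ell_lt n : (ell n.+1 < ell n)%O.
Proof.
have := mlog_sdom (iter_log_gt1 t_atomic n); rewrite (mlog_iter_log t_atomic).
by move=> /sdom_monomial.
Qed.

Lemma deriv_ell0 : D (monomial (ell 0)) = 1.
Proof. by rewrite (iter_log0 t_atomic) (omega_deriv_var D_deriv). Qed.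

Lemma deriv_ell_neq0 n : D (monomial (ell n)) != 0.
Proof.
elim: n => [|n]; first by rewrite deriv_ell0 oner_eq0.
by rewrite deriv_ell mulf_eq0 negb_or => /andP[].
Qed.

Lemma ell_gt1 n : 1 <<~ mono (ell n).
Proof. by apply/sdom_monomial; exact: iter_log_gt1. Qed.

Lemma deriv_ell_lt n : D (monomial (ell n.+1)) <<~ D (monomial (ell n)).
Proof.
rewrite deriv_ell -[X in X <<~ _]mul1r.
by apply: sdomMr; [exact: deriv_ell_neq0|exact: ell_gt1].
Qed.

Lemma ell_mono i j : (i < j)%N ->
  (ell j < ell i)%O /\ D (monomial (ell j)) <<~ D (monomial (ell i)).
Proof.
elim: j => // j IH; rewrite ltnS leq_eqVlt => /predU1P[->|/IH[lt sd]].
  by split; [exact: ell_lt|exact: deriv_ell_lt].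
split; first exact: lt_trans (ell_lt j) lt.
exact: dom_sdom_trans (sdomW (@deriv_ell_lt j)) sd.
Qed.

(* Along the leading monomials of iterated logarithms every m > 1 reaches the
   tail of the sequence [ell], and m' is up to a constant the product of the
   monomials met on the way; hence this squeeze. *)
Definition deriv_path m := exists j0 : nat, forall j : nat, (j0 <= j)%N -> exists r : nat,
  D (monomial (ell j)) <~ D (monomial m) /\
  D (monomial m) <~ monomial m ^+ r * D (monomial (ell j)).

Lemma deriv_path_ell i : deriv_path (ell i).
Proof.
exists i => j; elim: j => [|j IH]; first by rewrite leqn0 => /eqP ->; exists 0%N; rewrite mul1r.
rewrite leq_eqVlt => /predU1P[->|]; first by exists 0%N; rewrite mul1r.
rewrite ltnS => ij; have [r [h1 h2]] := IH ij; exists r.+1; split.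
  exact: dom_trans (sdomW (@deriv_ell_lt j)) h1.
apply: dom_trans h2 _; rewrite deriv_ell exprSr -mulrA; apply: domMl.
apply: domMr; apply/dom_monomial.
by move: ij; rewrite leq_eqVlt => /predU1P[->//|/ell_mono[/ltW]].
Qed.

Definition deriv_monotone (X : set (mon V)) := forall a b, X a -> X b ->
  (a < b)%O -> b != 1%g -> D (monomial a) <<~ D (monomial b).

(** Conditions that survive exponentiation jointly: the second puts X inside [exp_closure X], and
    the last allows a' to be compared with b' when log a strictly dominates log b. *)
Definition good (X : set (mon V)) :=
  [/\ X `<=` omega_mon t, (forall m, X m -> supp (mlog m) `<=` X),
      deriv_monotone X & (forall m, X m -> (1 < m)%O%g -> deriv_path m)].

Definition exp_closure (X : set (mon V)) : set (mon V) :=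
  [set m | supp (mlog m) `<=` X].

Lemma good_lead X m : good X -> exp_closure X m -> m != 1%g ->
  [/\ X (lmon (mlog m)), (1 < lmon (mlog m))%O%g,
      D (monomial (lmon (mlog m))) != 0 &
      D (mlog m) >~< D (monomial (lmon (mlog m)))].
Proof.
move=> [Xom _ XF XP] Xm m1; have g0 : mlog m != 0 by rewrite mlog_eq0.
set n := lmon (mlog m); have gn : supp (mlog m) n by exact: supp_lmon.
have n1 : (1 < n)%O%g by exact: mlog_J gn.
have D0 : D (monomial n) != 0.
  have [j0 /(_ j0 (leqnn _))[r [h _]]] := XP n (Xm _ gn) n1.
  exact: dom_neq0 h (deriv_ell_neq0 _).
split=> //; first exact: Xm.
apply: (slin_lead (deriv_slin t_atomic D_deriv)) => //.
  by move=> k /Xm/Xom.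
by move=> k gk kn; apply: XF => //; [exact: Xm|exact: Xm|rewrite gt_eqF].
Qed.

Lemma good_exp_om X m : good X -> exp_closure X m -> omega_mon t m.
Proof. by move=> [Xom _ _ _] Xm; apply: omega_mon_exp => k /Xm/Xom. Qed.

Lemma good_exp_deriv X m : good X -> exp_closure X m -> m != 1%g ->
  D (monomial m) >~< monomial m * D (monomial (lmon (mlog m))).
Proof.
move=> gX Xm m1; have [_ _ _ h] := good_lead gX Xm m1.
rewrite (deriv_monomial t_atomic D_deriv (good_exp_om gX Xm)).
exact: asympM.
Qed.

(** Let a < b differ from 1 and let p, q be the leading monomials of log a, log b; then a' ≍ a p'
    and b' ≍ b q'. If p <= q, then p' ≼ q'. Otherwise the squeeze gives p' ≼ p^r q', and a p^r < b
    because log b - log a ≍ p strictly dominates r log p. *)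
Lemma good_exp_closure X : good X -> good (exp_closure X).
Proof.
move=> gX; have [Xom Xsup XF XP] := gX.
have XE : X `<=` exp_closure X by move=> m; exact: Xsup.
split.
- by move=> m; exact: good_exp_om.
- by move=> m Xm k /Xm/XE.
- move=> a b Xa Xb ab b1.
  have [Xq q1 Dq _] := good_lead gX Xb b1; have Eb := good_exp_deriv gX Xb b1.
  set q := lmon (mlog b) in Xq q1 Dq Eb.
  apply: (sdom_dom_trans _ Eb.2).
  have [->|a1] := eqVneq a 1%g.
    rewrite monomial1 (deriv1 t_atomic D_deriv) => /dom0r/eqP.
    by rewrite mulf_eq0 (negPf (monomial_neq0 _ _ _)) (negPf Dq).
  have [Xp p1 Dp _] := good_lead gX Xa a1; have Ea := good_exp_deriv gX Xa a1.
  set p := lmon (mlog a) in Xp p1 Dp Ea.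
  apply: (dom_sdom_trans Ea.1).
  have [pq|qp] := leP p q.
    have Dpq : D (monomial p) <~ D (monomial q).
      move: pq; rewrite le_eqVlt => /predU1P[->//|pq].
      by apply: sdomW; apply: XF => //; rewrite gt_eqF.
    apply: (dom_sdom_trans (domMl (monomial a) Dpq)).
    by apply: sdomMr => //; apply/sdom_monomial.
  have [jp hp] := XP p Xp p1; have [jq hq] := XP q Xq q1.
  have [r [_ h2]] := hp _ (leq_maxl jp jq).
  have [_ [h1 _]] := hq _ (leq_maxr jp jq).
  have Dpq : D (monomial p) <~ monomial p ^+ r * D (monomial q).
    by apply: dom_trans h2 _; exact: domMl.
  apply: (dom_sdom_trans (domMl (monomial a) Dpq)); rewrite mulrA.
  apply: sdomMr => //; rewrite monomialX -monomialM; apply/sdom_monomial.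
  rewrite -mlog_lt mlogM mlogX addrC -ltrBrDr.
  have a0 : mlog a != 0 by rewrite mlog_eq0.
  have b0 : mlog b != 0 by rewrite mlog_eq0.
  have ba : mlog b - mlog a >~< monomial p.
    apply: (@asymp_trans _ (- mlog a)).
      apply: asympDl; apply: (sdom_dom_trans _ (asympN _).2).
      apply: (dom_sdom_trans (asymp_lmon b0).1).
      by apply: (sdom_dom_trans _ (asymp_lmon a0).2); apply/sdom_monomial.
    by apply: (asymp_trans (asympN _)); exact: asymp_lmon.
  apply: sdom_lt; first by rewrite subr_gt0 mlog_lt.
  apply: (sdom_dom_trans _ ba.2); apply: (dom_sdom_trans _ (mlog_sdom p1)).
  exact: domMnl.
- move=> m Xm m1; have m1' : m != 1%g by rewrite gt_eqF.
  have [Xn n1 _ _] := good_lead gX Xm m1'; have [E1 E2] := good_exp_deriv gX Xm m1'.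
  set n := lmon (mlog m) in Xn n1 E1 E2.
  have [j0 h] := XP n Xn n1; exists j0 => j /h[r [h1 h2]].
  have m2 : 1 <~ mono m by apply: sdomW; apply/sdom_monomial.
  exists r.+1; split.
    apply: (dom_trans h1); apply: (dom_trans _ E2).
    by rewrite -[X in X <~ _]mul1r; exact: domMr.
  apply: (dom_trans E1); rewrite exprS -mulrA; apply: domMl.
  apply: (dom_trans h2); apply: domMr; apply: domX.
  have g0 : mlog m != 0 by rewrite mlog_eq0.
  apply: (dom_trans (asymp_lmon g0).2); exact: sdomW (mlog_sdom m1).
Qed.

Lemma good_ell : good (range ell).
Proof.
split.
- by move=> _ [n _ <-]; exact: omega_mon_log.
- move=> _ [n _ <-] k; rewrite (mlog_iter_log t_atomic) => /supp_monomialE ->.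
  by exists n.+1.
- move=> _ _ [i _ <-] [j _ <-] ij _.
  have [/ell_mono[_ //]|ji] := ltnP j i; exfalso; move: ij.
  rewrite ltNge; apply/negP; rewrite negbK.
  by move: ji; rewrite leq_eqVlt => /predU1P[->//|/ell_mono[/ltW]].
- by move=> _ [n _ <-] _; exact: deriv_path_ell.
Qed.

(* A maximal good set is closed under exponentiation, hence contains all
   omega-monomials. *)
Lemma good_omega_mon : good (omega_mon t).
Proof.
(* Adjoining [L] inside [P] makes the empty chain, whose union is empty, satisfy [P]. *)
pose L := range ell; pose P X := good (X `|` L).
have [|A [PA Amax]] := @Zorn_bigcup (mon V) P.
  move=> F FP Ftot.
  have pick a : (\bigcup_(X in F) X `|` L) a -> good L /\ L a \/
      exists X, [/\ F X, P X & (X `|` L) a].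
    by move=> [[X FX Xa]|La]; [right; exists X; split; [|exact: FP|left]|left; split; [exact: good_ell|]].
  have pair a b : (\bigcup_(X in F) X `|` L) a -> (\bigcup_(X in F) X `|` L) b ->
      exists Y, [/\ good Y, Y `<=` \bigcup_(X in F) X `|` L, Y a & Y b].
    move=> /pick ha /pick hb.
    have sub X : F X -> X `|` L `<=` \bigcup_(X in F) X `|` L.
      by move=> FX k [Xk|Lk]; [left; exists X|right].
    case: ha => [[gL La]|[X [FX PX Xa]]]; case: hb => [[_ Lb]|[Y [FY PY Yb]]].
    - by exists L; split=> // k Lk; right.
    - by exists (Y `|` L); split=> //; [exact: sub|right].
    - by exists (X `|` L); split=> //; [exact: sub|right].
    - have [XY|YX] := Ftot X Y FX FY.
        exists (Y `|` L); split=> //; first exact: sub.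
        by case: Xa => [/XY|]; [left|right].
      exists (X `|` L); split=> //; first exact: sub.
      by case: Yb => [/YX|]; [left|right].
  split.
  - by move=> a Fa; have [Y [[Yom _ _ _] _ Ya _]] := pair a a Fa Fa; exact: Yom.
  - move=> a Fa k ak; have [Y [[_ Ys _ _] sY Ya _]] := pair a a Fa Fa.
    by apply: sY; exact: Ys ak.
  - move=> a b Fa Fb; have [Y [[_ _ YF _] _ Ya Yb]] := pair a b Fa Fb.
    exact: YF.
  - by move=> a Fa; have [Y [[_ _ _ YP] _ Ya _]] := pair a a Fa Fa; exact: YP.
have gE := good_exp_closure PA; set E := exp_closure _ in gE.
have LE : L `<=` E.
  by move=> a La; have [_ As _ _] := PA; apply: As; right.
have EA : E `<=` A.
  apply: contrapT => nEA; apply: (Amax E).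
    split=> // a Aa; have [_ As _ _] := PA; apply: As; by left.
  rewrite /P (_ : E `|` L = E)//; apply/seteqP; split=> a; last by left.
  by case=> // /LE.
suff <- : A `|` L = omega_mon t by [].
apply/seteqP; split; first by case: PA.
move=> m; elim=> {m} [n|m _ IH]; first by right; exists n.
by left; apply: EA.
Qed.

End AsymptoticDerivation.

(** * Dominance and derivatives of omega-series *)

Section OmegaAsymptotics.
Variables (S : sizeClass) (R : realType) (V : transseriesField S R) (t : mon V).
Hypothesis t_atomic : log_atomic t.
Variables (D : V -> V) (D_deriv : is_omega_derivation t D).
Implicit Types (f g h : V) (m a b : mon V).
Local Notation om := (om t).

Lemma deriv_monomial_sdom a b : omega_mon t a -> omega_mon t b ->
  (a < b)%O -> b != 1%g -> D (monomial a) <<~ D (monomial b).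
Proof. by have [_ _ h _] := good_omega_mon t_atomic D_deriv; exact: h. Qed.

(** Strictly dominating anything forces b' != 0: the comparison is with b^2 if b < 1, and with 1 if
    b > 1. *)
Lemma deriv_monomial_neq0 b : omega_mon t b -> b != 1%g -> D (monomial b) != 0.
Proof.
move=> bG b1; have [b2|b2|b2] := ltgtP b 1%g; last by rewrite b2 eqxx in b1.
- apply: (@sdom_neq0 _ (D (monomial (b * b)%g))).
  apply: deriv_monomial_sdom => //; first exact: omega_monM.
  by rewrite -[X in (_ < X)%O]mulg1 oag_lt2l.
- apply: (@sdom_neq0 _ (D (monomial 1%g))).
  by apply: deriv_monomial_sdom => //; exact: omega_mon1.
Qed.

Lemma om_lmon f : om f -> f != 0 -> omega_mon t (lmon f).
Proof. by move=> /omE fG f0; apply: fG; exact: supp_lmon. Qed.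

Lemma lmon_neq1 f : f != 0 -> ~ f >~< 1 -> lmon f != 1%g.
Proof.
move=> f0 f1; apply/eqP => l1; apply: f1; have := asymp_lmon f0.
by rewrite l1 monomial1.
Qed.

Lemma deriv_lead g : om g -> g != 0 -> ~ g >~< 1 ->
  D g >~< D (monomial (lmon g)).
Proof.
move=> gG g0 g1; have l1 := lmon_neq1 g0 g1; have lG := om_lmon gG g0.
apply: (slin_lead (deriv_slin t_atomic D_deriv) (omE gG) g0).
  exact: deriv_monomial_neq0.
by move=> k gk kl; apply: deriv_monomial_sdom => //; exact: (omE gG).
Qed.

Lemma deriv_dom f g : om f -> om g -> f <~ g -> ~ g >~< 1 -> D f <~ D g.
Proof.
move=> fG gG fg g1; have [g0|g0] := eqVneq g 0.
  move: fg; rewrite g0 => /dom0r ->; exact: dom_refl.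
apply: (dom_trans _ (deriv_lead gG g0 g1).2).
apply: (slin_dom (deriv_slin t_atomic D_deriv) (omE fG)) => m fm.
have lG := om_lmon gG g0; have mG := omE fG fm.
have : (m <= lmon g)%O.
  apply/(dom_monomial S R); apply: (dom_trans (supp_dom fm)).
  exact: dom_trans fg (asymp_lmon g0).1.
rewrite le_eqVlt => /predU1P[->|ml]; first exact: dom_refl.
by apply: sdomW; apply: deriv_monomial_sdom => //; exact: lmon_neq1.
Qed.

Lemma deriv_sdom f g : om f -> om g -> f <<~ g -> ~ g >~< 1 -> D f <<~ D g.
Proof.
move=> fG gG fg g1; have g0 : g != 0 by exact: sdom_neq0 fg.
have lG := om_lmon gG g0; have l1 := lmon_neq1 g0 g1.
apply: (sdom_dom_trans _ (deriv_lead gG g0 g1).2).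
apply: (slin_sdom _ (deriv_slin t_atomic D_deriv) (omE fG)).
  exact: deriv_monomial_neq0.
move=> m fm; apply: deriv_monomial_sdom => //; first exact: omE fG _ fm.
apply/(sdom_monomial S R); apply: (dom_sdom_trans (supp_dom fm)).
exact: sdom_dom_trans fg (asymp_lmon g0).1.
Qed.

Lemma standard_part f : f <~ 1 -> exists r, f - const r <<~ 1.
Proof.
by move=> /dom1_split[r [e [-> ei]]]; exists r; rewrite addrC addKr.
Qed.

Lemma logder_lead h : om h -> h != 0 -> ~ h >~< 1 ->
  D (mlog (lmon h)) >~< D h / h.
Proof.
move=> hG h0 h1; have lG := om_lmon hG h0.
have -> : D (mlog (lmon h)) = D (monomial (lmon h)) / monomial (lmon h).
  rewrite (deriv_monomial t_atomic D_deriv lG) mulrAC divff ?mul1r//.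
  exact: monomial_neq0.
apply: asympM; first exact: asymp_sym (deriv_lead hG h0 h1).
by apply: asympV; [exact: asymp_sym (asymp_lmon h0)|exact: monomial_neq0].
Qed.

Lemma log_exists h : om h -> h != 0 -> ~ h >~< 1 ->
  exists g, [/\ om g, 1 <<~ g & D g >~< D h / h].
Proof.
move=> hG h0 h1; have lG := om_lmon hG h0; exists (mlog (lmon h)); split.
- exact: om_mlog.
- by apply: mlog_sdom1; exact: lmon_neq1.
- exact: logder_lead.
Qed.

(** Up to size, both sides are derivatives of the logarithms of the leading monomials, and these
    logarithms are ordered as the monomials are. *)
Lemma logder_dom f g : om f -> om g -> 1 <<~ f -> f <~ g -> D f / f <~ D g / g.
Proof.
move=> fG gG f1 fg; have f0 : f != 0 by exact: sdom_neq0 f1.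
have g1 : 1 <<~ g by exact: sdom_dom_trans f1 fg.
have g0 : g != 0 by exact: sdom_neq0 g1.
have nf := sdom1_nasymp f1; have ng := sdom1_nasymp g1.
have fl : (1 < lmon f)%O%g.
  by apply/(sdom_monomial S R); exact: sdom_dom_trans f1 (asymp_lmon f0).1.
have lfg : (lmon f <= lmon g)%O by apply/dom_lmon.
apply: (dom_trans (logder_lead fG f0 nf).2).
apply: (dom_trans _ (logder_lead gG g0 ng).1).
apply: deriv_dom.
- exact: (om_mlog t_atomic (om_lmon fG f0)).
- exact: (om_mlog t_atomic (om_lmon gG g0)).
- have p : 0 < mlog (lmon f) by exact: mlog_gt0.
  have q : mlog (lmon f) <= mlog (lmon g) by rewrite mlog_le.
  by apply: dom_le; rewrite (ger0_norm (ltW p)) (ger0_norm (le_trans (ltW p) q)).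
- by apply: sdom1_nasymp; apply: mlog_sdom1; exact: (lmon_neq1 g0 ng).
Qed.

Lemma T_sdom : 1 <<~ (monomial t : V).
Proof. by apply/sdom_monomial; case: t_atomic. Qed.

Lemma logT_sdom : 1 <<~ (monomial (iter_log t 1) : V).
Proof. exact: ell_gt1. Qed.

Lemma deriv_T : D (monomial t) = 1.
Proof. exact: omega_deriv_var D_deriv. Qed.

Lemma deriv_logT : D (monomial (iter_log t 1)) = (monomial t)^-1.
Proof.
have := deriv_ell t_atomic D_deriv 0; rewrite deriv_ell0// (iter_log0 t_atomic) => h.
by apply: (mulfI (monomial_neq0 S R t)); rewrite -h divff// monomial_neq0.
Qed.

Lemma om_T : om (monomial t).
Proof.
apply: om_monomial; have := omega_mon_log t 0.
by rewrite (iter_log0 t_atomic).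
Qed.

Lemma om_logT : om (monomial (iter_log t 1)).
Proof. by apply: om_monomial; exact: omega_mon_log. Qed.

End OmegaAsymptotics.

(** * Taylor expansion of omega-monomials *)

Section Leibniz.
Variables (K : fieldType) (om : K -> Prop) (D : K -> K).
Hypotheses (nat_neq0 : forall n : nat, n.+1%:R != 0 :> K)
  (omM : forall f g, om f -> om g -> om (f * g))
  (om_D : forall f, om f -> om (D f))
  (D_mul : forall f g, om f -> om g -> D (f * g) = D f * g + f * D g)
  (D_sum : forall (n : nat) (F : nat -> K), (forall i, om (F i)) ->
     D (\sum_(i < n) F i) = \sum_(i < n) D (F i))
  (om_scale : forall (n : nat) f, om f -> om (f / n`!%:R))
  (D_scale : forall (n : nat) f, om f -> D (f / n`!%:R) = D f / n`!%:R).

(** The Taylor coefficient; with the factorial built in, the Leibniz rule becomes a Cauchy product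
    without binomials. *)
Definition tderiv n f := iter n D f / n`!%:R.


Lemma om_tderiv n f : om f -> om (tderiv n f).
Proof. by move=> fo; apply: om_scale; elim: n => //= n; exact: om_D. Qed.

Lemma D_tderiv n f : om f -> D (tderiv n f) = n.+1%:R * tderiv n.+1 f.
Proof.
move=> fo; rewrite /tderiv D_scale; last by elim: n => //= n; exact: om_D.
by rewrite factS natrM invfM /= [RHS]mulrCA mulVKf.
Qed.

Lemma tderiv_D n f : tderiv n (D f) = n.+1%:R * tderiv n.+1 f.
Proof. by rewrite /tderiv factS natrM invfM -iterSr [RHS]mulrCA mulVKf. Qed.

Lemma tderiv_mul n f g : om f -> om g ->
  tderiv n (f * g) = \sum_(i < n.+1) tderiv i f * tderiv (n - i) g.
Proof.
move=> fo go; elim: n => [|n IH].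
  by rewrite big_ord_recl big_ord0 /tderiv /= fact0 !divr1 addr0.
apply: (mulfI (nat_neq0 n)); rewrite -D_tderiv; last exact: omM.
rewrite IH (@D_sum _ (fun i => tderiv i f * tderiv (n - i) g)); last first.
  by move=> i; apply: omM; exact: om_tderiv.
pose a i := tderiv i f; pose b i := tderiv i g.
(* The weight n + 1 splits as i + (n + 1 - i), the parts coming from differentiating f and g
   respectively. *)
transitivity (\sum_(i < n.+2) i%:R * (a i * b (n.+1 - i)%N) +
              \sum_(i < n.+2) (n.+1 - i)%:R * (a i * b (n.+1 - i)%N)).
  rewrite [X in _ = X + _]big_ord_recl mul0r add0r.
  rewrite [X in _ = _ + X]big_ord_recr /= subnn mul0r addr0 -big_split.
  apply: eq_bigr => i _ /=.
  rewrite D_mul ?D_tderiv//; try exact: om_tderiv.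
  have E1 : (n.+1 - i)%N = (n - i).+1 by rewrite subSn// -ltnS.
  rewrite /bump leq0n add1n subSS E1 /a /b -[LHS]/(_ + _).
  by rewrite -[X in X + _ = _]mulrA [X in _ + X = _]mulrCA.
rewrite -big_split mulr_sumr; apply: eq_bigr => i _ /=.
by rewrite -mulrDl -natrD subnKC// -ltnS.
Qed.

End Leibniz.

(** * Taylor estimates through exponential and logarithm *)

Section ExpRemainder.
Variables (S : sizeClass) (R : realType) (U : transseriesField S R).
Implicit Types b v s B : U.

Lemma exp_remainder b v s B : b <~ 1 -> B <~ 1 -> v <~ B ->
  texp b - s <~ B -> texp (b + v) - s <~ B.
Proof.
move=> b1 B1 vB bs; rewrite texpD.
have -> : texp b * texp v - s = texp b * (texp v - 1) + (texp b - s) by ring.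
apply: domD; last exact: bs.
rewrite -[X in _ <~ X]mul1r; apply: domM; first exact: texp_dom1.
exact: dom_trans (texp_sub1 (dom_trans vB B1)).1 vB.
Qed.

Lemma log_remainder b v s B : b <~ 1 -> v <~ 1 ->
  texp b - s <~ B -> texp (b + v) - s <~ B -> v <~ B.
Proof.
move=> b1 v1 bs bvs; apply: (dom_trans (texp_sub1 v1).2).
have -> : texp v - 1 = texp (- b) * ((texp (b + v) - s) - (texp b - s)).
  have -> : texp (b + v) - s - (texp b - s) = texp b * (texp v - 1).
    by rewrite texpD; ring.
  by rewrite mulrA -texpD addNr texp0 mul1r.
rewrite -[X in _ <~ X]mul1r; apply: domM; first exact: texp_dom1 (domN b1).
exact: domB.
Qed.

End ExpRemainder.

Section ExpTaylor.
Variables (S : sizeClass) (R : realType) (U : transseriesField S R).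
Local Notation H := (hahnSeries S R (mon U)).
Variables (w K delta : H).
Hypotheses (wK : w <~ K) (Kd : K * delta <~ 1).

Definition coef_bound (p : {poly H}) := p`_0 = 0 /\ forall j, p`_j.+1 <~ w * K ^+ j.

Lemma coef_boundD p q : coef_bound p -> coef_bound q -> coef_bound (p + q).
Proof.
move=> [p0 pj] [q0 qj]; split=> [|j]; first by rewrite coefD p0 q0 addr0.
by rewrite coefD; apply: domD.
Qed.

(** In the coefficient of order j + 1 the two factors contribute w^2 K^(j-1), and w ≼ K turns this
    into w K^j. *)
Lemma coef_boundM p q : coef_bound p -> coef_bound q -> coef_bound (p * q).
Proof.
move=> [p0 pj] [q0 qj]; split=> [|j].
  by rewrite coefM big_ord_recl big_ord0 p0 mul0r addr0.
rewrite coefM; apply: dom_sum => -[[|i] ij] _ /=; first by rewrite p0 mul0r; exact: dom0l.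
rewrite subSS; case E : (j - i)%N => [|k]; first by rewrite q0 mulr0; exact: dom0l.
have jE : j = (i + k.+1)%N by rewrite -E subnKC//; move: ij; rewrite !ltnS => /ltnW.
rewrite jE exprD exprS; apply: (dom_trans (domM (pj i) (qj k))).
have -> : w * K ^+ i * (w * K ^+ k) = (w * K ^+ i * K ^+ k) * w by ring.
have -> : w * (K ^+ i * (K * K ^+ k)) = (w * K ^+ i * K ^+ k) * K by ring.
exact: domMl.
Qed.

Lemma coef_boundC r p : coef_bound p -> coef_bound ((const r)%:P * p).
Proof.
move=> [p0 pj]; split=> [|j]; rewrite coefCM; first by rewrite p0 mulr0.
exact: dom_constM.
Qed.

Lemma coef_boundXS p n : coef_bound p -> coef_bound (p ^+ n.+1).
Proof.
move=> hp; elim: n => [|n IH]; first by rewrite expr1.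
by rewrite exprS; exact: coef_boundM.
Qed.

Lemma coef_bound_exp_poly p n : coef_bound p -> coef_bound (exp_poly n p).
Proof.
move=> hp; elim: n => [|n IH].
  rewrite /exp_poly big_ord0; split=> [|j]; rewrite coef0//; exact: dom0l.
rewrite /exp_poly big_ord_recr; apply: coef_boundD; first exact: IH.
by apply: coef_boundC; exact: coef_boundXS.
Qed.

Lemma term_dom j n : (n <= j)%N -> w * K ^+ j * delta ^+ j.+1 <~ w * delta * (K * delta) ^+ n.
Proof.
move=> nj; rewrite -(subnKC nj) -addnS exprD exprD exprS.
have -> : w * (K ^+ n * K ^+ (j - n)) * (delta ^+ n * (delta * delta ^+ (j - n))) =
   w * delta * (K * delta) ^+ n * (K * delta) ^+ (j - n) by rewrite !exprMn; ring.
by rewrite -[X in _ <~ X]mulr1; apply: domMl; rewrite -(expr1n _ (j - n)); exact: domX.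
Qed.

Lemma low_coef_expS (p : {poly H}) n i : p`_0 = 0 -> (i < n)%N -> (p ^+ n)`_i = 0.
Proof.
move=> p0; elim: n i => // n IH i ij; rewrite exprS coefM big1// => -[[|k] ki] _ /=.
  by rewrite p0 mul0r.
rewrite IH ?mulr0//; apply: (@leq_trans i); last by rewrite -ltnS.
by rewrite ltn_subrL /=; move: ki; rewrite ltnS; exact: leq_ltn_trans.
Qed.

Variables (g c : nat -> H) (n : nat).
Hypotheses (c0 : c 0%N = 1)
  (cS : forall j, j.+1%:R * c j.+1 = \sum_(i < j.+1) (i.+1%:R * g i.+1) * c (j - i)%N).

(* [g] and [c] are the Taylor coefficients of a function and of its exponential
   divided by its value; [cS] is the coefficientwise form of (e^g)' = g' e^g. *)
Section Forward.
Hypothesis g_dom : forall j, g j.+1 <~ w * K ^+ j.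

Let p : {poly H} := \poly_(i < n.+1) (if i == 0%N then 0 else g i).
Let b := \sum_(i < n) g i.+1 * delta ^+ i.+1.

Let p_bound : coef_bound p.
Proof.
split=> [|j]; rewrite coef_poly; first by [].
by case: ifP => _ /=; [exact: g_dom|exact: dom0l].
Qed.

Let E := 1 + exp_poly n p.

(** [E] solves E' = p' E up to a multiple of p' p^n. As p has no constant term, this error has no
    coefficient below degree n, so the coefficients of [E] satisfy the recursion [cS] up to n. *)
Let E_coef j : (j <= n)%N -> E`_j = c j.
Proof.
have [e0 ej] := coef_bound_exp_poly n p_bound; have [p0 pj] := p_bound.
elim/ltn_ind: j => -[|j] IH jn; first by rewrite coefD e0 coef1 addr0 c0.
have j1 : j.+1%:R != 0 :> H by rewrite pnatr_eq0.
apply: (mulfI j1); rewrite cS mulr_natl -coef_deriv /E derivD derivC add0r.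
rewrite exp_poly_deriv -/E mulrBr coefB [X in _ - X](_ : _ = 0).
  rewrite subr0 coefM; apply: eq_bigr => -[i ij] _ /=.
  rewrite IH ?ltnS ?leq_subr//; last exact: leq_trans (leq_subr _ _) (ltnW jn).
  congr (_ * _); rewrite coef_deriv coef_poly /= mulr_natl.
  by rewrite ltnS (leq_trans _ jn).
rewrite mulrCA coefCM coefM big1 ?mulr0// => -[i ij] _ /=.
rewrite (low_coef_expS (n := n)) ?mulr0//.
exact: leq_ltn_trans (leq_subr _ _) jn.
Qed.

Lemma exp_coef_dom j : (j < n)%N -> c j.+1 <~ w * K ^+ j.
Proof.
move=> jn; rewrite -E_coef// coefD coef1 add0r.
by have [_] := coef_bound_exp_poly n p_bound; apply.
Qed.

Lemma exponent_dom : b <~ 1.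
Proof.
apply: dom_sum => i _; apply: (dom_trans (domMr _ (g_dom i))).
apply: (dom_trans (term_dom (leq0n i))); rewrite expr0 mulr1.
exact: dom_trans (domMr delta wK) Kd.
Qed.

(** Both terms are compared with E(delta). The exponential differs from it by b^(n+1) ≼ (w
    delta)^(n+1), and [E] has the coefficients c up to degree n and coefficients bounded by
    [coef_bound] beyond. *)
Lemma exp_taylor : texp (b : U) - \sum_(i < n.+1) c i * delta ^+ i <~
  w * delta * (K * delta) ^+ n.
Proof.
have pd : p.[delta] = b.
  rewrite (@horner_coef_wide _ n.+1); last exact: size_poly.
  rewrite big_ord_recl coef_poly /= mul0r add0r; apply: eq_bigr => i _.
  by rewrite coef_poly /bump /= add1n ltnS ltn_ord.
have wd : w * delta <~ 1 by exact: dom_trans (domMr delta wK) Kd.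
have bw : b <~ w * delta.
  apply: dom_sum => i _; apply: (dom_trans (domMr _ (g_dom i))).
  by have := term_dom (leq0n i); rewrite expr0 mulr1.
have b1 := exponent_dom.
have h1 : texp (b : U) - E.[delta] <~ w * delta * (K * delta) ^+ n.
  have -> : E.[delta] = \sum_(i < n.+1) const (i`!%:R^-1) * b ^+ i.
    rewrite /E hornerD hornerC exp_poly_eval pd big_ord_recl.
    by rewrite fact0 invr1 const1 expr0 mulr1.
  apply: (dom_trans (texp_taylor n.+1 b1)); rewrite exprS; apply: domM => //.
  by apply: domX; apply: dom_trans bw _; exact: domMr.
have h2 : E.[delta] - \sum_(i < n.+1) c i * delta ^+ i <~ w * delta * (K * delta) ^+ n.
  rewrite (@horner_coef_wide _ (n.+1 + size E)); last exact: leq_addl.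
  rewrite big_split_ord /= [X in X + _ - _](_ : _ = \sum_(i < n.+1) c i * delta ^+ i); last first.
    by apply: eq_bigr => i _; rewrite E_coef// -ltnS.
  rewrite addrC addKr; apply: dom_sum => i _.
  rewrite addSn coefD coef1 add0r.
  have [_ ej] := coef_bound_exp_poly n p_bound.
  by apply: (dom_trans (domMr _ (ej _))); apply: term_dom; exact: leq_addr.
rewrite -(subrK E.[delta] (texp _)) -addrA; exact: domD.
Qed.

End Forward.

(** As c 0 = 1, the last summand of [cS] isolates g (j + 1), and strong induction controls the
    others. *)
Lemma log_coef_dom : (forall j, c j.+1 <~ w * K ^+ j) -> forall j, g j.+1 <~ w * K ^+ j.
Proof.
move=> c_dom; elim/ltn_ind => j IH.
have j1 : j.+1%:R != 0 :> H by rewrite pnatr_eq0.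
have := cS j; rewrite big_ord_recr /= subnn c0 mulr1 addrC => /eqP.
rewrite -subr_eq => /eqP E; apply: (dom_mul2l j1).
have [j2 j3] : j.+1%:R >~< (1 : H) by exact: natr_asymp.
apply: (@dom_trans _ (w * K ^+ j)); last by rewrite -[X in X <~ _]mul1r; exact: domMr.
rewrite -E; apply: domB.
  by rewrite -[X in _ <~ X]mul1r; apply: domM => //; exact: c_dom.
apply: dom_sum => -[i ij] _ /=.
case E2 : (j - i)%N => [|k]; first by move: ij; rewrite -subn_gt0 E2.
have jE : j = (i + k.+1)%N by rewrite -E2 subnKC// ltnW.
have gi : i.+1%:R * g i.+1 <~ w * K ^+ i.
  by rewrite -[X in _ <~ X]mul1r; apply: domM; [exact: dom_nat|exact: IH].
apply: (dom_trans (domM gi (c_dom k))).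
rewrite jE exprD exprS.
have -> : w * K ^+ i * (w * K ^+ k) = (w * K ^+ i * K ^+ k) * w by ring.
have -> : w * (K ^+ i * (K * K ^+ k)) = (w * K ^+ i * K ^+ k) * K by ring.
exact: domMl.
Qed.

End ExpTaylor.

(** * Taylor coefficients and remainders of omega-monomials *)

Section DerivationIterates.
Variables (S : sizeClass) (R : realType) (V : transseriesField S R) (t : mon V).
Hypothesis t_atomic : log_atomic t.
Variables (D : V -> V) (D_deriv : is_omega_derivation t D).
Implicit Types (f g : V) (m : mon V).
Local Notation om := (om t).

Lemma om_iter_deriv n f : om f -> om (iter n D f).
Proof. by move=> fo; elim: n => //= n; exact: (om_deriv t_atomic D_deriv). Qed.

Lemma iter_deriv_slin n : strongly_linear (omega_mon t) (iter n D).
Proof.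
elim: n => [|n IH].
  apply: (@slin_congr _ _ _ _ _ _ _ (fun f => 1 * f)).
  - by move=> m _; rewrite mul1r.
  - by move=> f _; rewrite mul1r.
  - exact: slin_mul_om.
apply: (slin_comp IH _ (deriv_slin t_atomic D_deriv)) => f /Om fo.
exact: omE (om_iter_deriv n fo).
Qed.

Lemma div_natE f n : f / n%:R = const n%:R^-1 * f.
Proof. by rewrite constV const_nat mulrC. Qed.

Lemma om_div_nat n f : om f -> om (f / n%:R).
Proof. by move=> fo; rewrite div_natE; apply: omM => //; exact: om_const. Qed.

Lemma deriv_div_nat n f : om f -> D (f / n%:R) = D f / n%:R.
Proof.
move=> /omE fo; rewrite !div_natE; exact: (slinZ _ (deriv_slin t_atomic D_deriv)).
Qed.

Lemma om_sum n (F : nat -> V) : (forall i, om (F i)) -> om (\sum_(i < n) F i).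
Proof.
move=> Fo; elim: n => [|n IH]; first by rewrite big_ord0; exact: om0.
by rewrite big_ord_recr; exact: omD.
Qed.

Lemma deriv_sum n (F : nat -> V) : (forall i, om (F i)) ->
  D (\sum_(i < n) F i) = \sum_(i < n) D (F i).
Proof.
move=> Fo; have Ds := deriv_slin t_atomic D_deriv; elim: n => [|n IH].
  by rewrite !big_ord0 (slin0 Ds).
rewrite !big_ord_recr -IH /= (slinD Ds)//; last exact: omE.
by apply: omE; exact: om_sum.
Qed.

Lemma tderiv_mul_om n f g : om f -> om g ->
  tderiv D n (f * g) = \sum_(i < n.+1) tderiv D i f * tderiv D (n - i) g.
Proof.
apply: (@tderiv_mul _ om D).
- by move=> k; rewrite pnatr_eq0.
- by move=> a b; exact: omM.
- by move=> a; exact: om_deriv.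
- by move=> a b; exact: derivM_om.
- by move=> k F; exact: deriv_sum.
- by move=> k a; exact: om_div_nat.
- by move=> k a; exact: deriv_div_nat.
Qed.

Lemma om_tderiv_deriv n f : om f -> om (tderiv D n f).
Proof. by move=> fo; apply: om_div_nat; exact: om_iter_deriv. Qed.

End DerivationIterates.

Section Taylor.
Variables (S : sizeClass) (R : realType) (V U : transseriesField S R) (t : mon V).
Hypothesis t_atomic : log_atomic t.
Variables (D : V -> V) (D_deriv : is_omega_derivation t D).
Variables (comp : V -> U -> U) (comp_composition : is_omega_composition t comp).
Variables (x delta : U) (x_gtR : above_reals x) (xdelta_gtR : above_reals (x + delta)).
Implicit Types (f g : V) (m : mon V) (w : U).
Local Notation om := (om t).
Local Notation phi := (fun f => comp f x).
Local Notation psi := (fun f => comp f (x + delta)).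

Let phi_slin := comp_slin t_atomic comp_composition x_gtR.
Let psi_slin := comp_slin t_atomic comp_composition xdelta_gtR.

Definition taylor_rem n f : U :=
  comp f (x + delta) - \sum_(i < n) comp (iter i D f) x / i`!%:R * delta ^+ i.

Lemma slin_sum n (F : nat -> V -> U) :
  (forall i, strongly_linear (omega_mon t) (F i)) ->
  strongly_linear (omega_mon t) (fun f => \sum_(i < n) F i f).
Proof.
move=> Fl; elim: n => [|n IH].
  apply: (@slin_congr _ _ _ _ _ _ _ (fun f => 0 * comp f x)).
  - by move=> m _; rewrite big_ord0 mul0r.
  - by move=> f _; rewrite big_ord0 mul0r.
  - exact: slin_mulP phi_slin.
apply: (@slin_congr _ _ _ _ _ _ _ (fun f => (\sum_(i < n) F i f) + F n f)).
- by move=> m _; rewrite big_ord_recr.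
- by move=> f _; rewrite big_ord_recr.
- exact: slin_add.
Qed.

Lemma phi_iter_slin n : strongly_linear (omega_mon t) (fun f => comp (iter n D f) x).
Proof.
apply: (slin_comp (iter_deriv_slin t_atomic D_deriv n) _ phi_slin) => f /Om fo.
exact: omE (om_iter_deriv t_atomic D_deriv n fo).
Qed.

Lemma rem_slin n : strongly_linear (omega_mon t) (taylor_rem n).
Proof.
pose Q f := \sum_(i < n) (delta ^+ i / i`!%:R) * comp (iter i D f) x.
have Ql : strongly_linear (omega_mon t) Q.
  apply: (@slin_sum n (fun i f => (delta ^+ i / i`!%:R) * comp (iter i D f) x)) => i.
  by apply: slin_mulP; exact: phi_iter_slin.
have E f : comp f (x + delta) + (-1) * Q f = taylor_rem n f.
  rewrite mulN1r; congr (_ - _); apply: eq_bigr => i _.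
  by rewrite mulrC mulrA mulrAC.
apply: (@slin_congr _ _ _ _ _ _ _ (fun f => comp f (x + delta) + (-1) * Q f)).
- by move=> m _; exact: E.
- by move=> f _; exact: E.
- by apply: slin_add => //; exact: slin_mulP.
Qed.

Lemma phi_div_nat n f : om f -> comp (f / n%:R) x = comp f x / n%:R.
Proof. by move=> fo; rewrite !div_natE (comp_constM t_atomic comp_composition x_gtR). Qed.

Lemma phi_nat n f : om f -> comp (n%:R * f) x = n%:R * comp f x.
Proof.
by move=> fo; rewrite -!const_nat (comp_constM t_atomic comp_composition x_gtR).
Qed.

Lemma phi_sum n (F : nat -> V) : (forall i, om (F i)) ->
  comp (\sum_(i < n) F i) x = \sum_(i < n) comp (F i) x.
Proof.
move=> Fo; elim: n => [|n IH]; first by rewrite !big_ord0 (comp0 t_atomic comp_composition).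
rewrite !big_ord_recr -IH (compD t_atomic comp_composition x_gtR) //.
exact: om_sum.
Qed.

Lemma remE n f : om f ->
  taylor_rem n f = comp f (x + delta) - \sum_(i < n) comp (tderiv D i f) x * delta ^+ i.
Proof.
move=> fo; congr (_ - _); apply: eq_bigr => i _; rewrite phi_div_nat//.
exact: om_iter_deriv.
Qed.

Lemma tderiv0 f : tderiv D 0 f = f.
Proof. by rewrite /tderiv fact0 divr1. Qed.

Lemma rem1 f : om f -> taylor_rem 1 f = comp f (x + delta) - comp f x.
Proof.
by move=> fo; rewrite remE// big_ord_recl big_ord0 expr0 mulr1 addr0 tderiv0.
Qed.

Lemma fact_series_neq0 n : n`!%:R != 0 :> hahnSeries S R (mon U).
Proof. by rewrite pnatr_eq0 -lt0n fact_gt0. Qed.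

Lemma fact_asymp n : n`!%:R >~< (1 : hahnSeries S R (mon U)).
Proof. by apply: natr_asymp; exact: fact_gt0. Qed.

Lemma tderiv_phi_dom n f (B : U) : om f ->
  comp (tderiv D n f) x <~ B <-> comp (iter n D f) x <~ B.
Proof.
move=> fo; rewrite phi_div_nat; last exact: om_iter_deriv.
have h := fact_asymp n; have n0 := fact_series_neq0 n.
split=> fB.
  rewrite -[comp _ _](divfK n0) -[B]mulr1; apply: domM => //; exact: h.1.
rewrite -[B]mulr1; apply: domM => //; have := asympV h n0.
by rewrite invr1 => -[].
Qed.

Section Monomial.
Variable m : mon V.
Hypothesis mG : omega_mon t m.
Local Notation gm := (mlog m).
Let c j := comp (tderiv D j (monomial m)) x / comp (monomial m) x.
Let g j := comp (tderiv D j (mlog m)) x.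

Let om_m : om (monomial m) := om_monomial mG.
Let om_g : om (mlog m) := om_mlog t_atomic mG.

Let phim_neq0 : comp (monomial m) x != 0.
Proof. by apply: (comp_neq0 t_atomic comp_composition x_gtR om_m); exact: monomial_neq0. Qed.

Let c_0 : c 0%N = 1.
Proof. by rewrite /c tderiv0 divff. Qed.

(** The Leibniz rule for m' = (log m)' m, evaluated at x and divided by m(x). *)
Let c_S j : j.+1%:R * c j.+1 = \sum_(i < j.+1) (i.+1%:R * g i.+1) * c (j - i)%N.
Proof.
have om_td n f : om f -> om (tderiv D n f) by exact: om_tderiv_deriv.
have natV n : n.+1%:R != 0 :> hahnSeries S R (mon V) by rewrite pnatr_eq0.
have := tderiv_mul_om t_atomic D_deriv j (om_deriv t_atomic D_deriv om_g) om_m.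
rewrite mulrC -(deriv_monomial t_atomic D_deriv mG).
rewrite (tderiv_D _ natV) => /(congr1 (fun f => comp f x)).
rewrite phi_nat; last exact: (om_td _ _ om_m).
rewrite (@phi_sum j.+1 (fun i => tderiv D i (D (mlog m)) * tderiv D (j - i) (monomial m))); last first.
  move=> i; apply: (omM t_atomic); last exact: (om_td _ _ om_m).
  by apply: om_td; exact: om_deriv.
move=> E; rewrite /c mulrA E mulr_suml; apply: eq_bigr => i _.
rewrite (compM t_atomic comp_composition x_gtR); last 2 first.
- by apply: om_td; exact: om_deriv.
- exact: (om_td _ _ om_m).
rewrite (tderiv_D _ natV) phi_nat; last exact: (om_td _ _ om_g).
by rewrite -mulrA.
Qed.

Let psi_m : comp (monomial m) (x + delta) =
  comp (monomial m) x * texp (comp (mlog m) (x + delta) - comp (mlog m) x).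
Proof.
rewrite (comp_monomial t_atomic comp_composition xdelta_gtR mG).
rewrite (comp_monomial t_atomic comp_composition x_gtR mG) -texpD.
by congr texp; rewrite [RHS]addrC subrK.
Qed.

Let rem_log n : comp (mlog m) (x + delta) - comp (mlog m) x =
  \sum_(i < n) g i.+1 * delta ^+ i.+1 + taylor_rem n.+1 (mlog m).
Proof.
rewrite remE// big_ord_recl expr0 mulr1 tderiv0.
pose s := \sum_(i < n) g i.+1 * delta ^+ i.+1; rewrite -/s.
transitivity (s + (comp gm (x + delta) - (comp gm x + s))); first by ring.
by congr (_ + (_ - (_ + _))); apply: eq_bigr.
Qed.

Let rem_m n : taylor_rem n (monomial m) = comp (monomial m) x *
  (texp (comp (mlog m) (x + delta) - comp (mlog m) x) - \sum_(i < n) c i * delta ^+ i).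
Proof.
rewrite remE// psi_m mulrBr; congr (_ - _); rewrite mulr_sumr; apply: eq_bigr => i _.
by rewrite mulrA; congr (_ * _); rewrite /c mulrC (divfK phim_neq0).
Qed.

Variables (w K : U).
Hypotheses (wK : w <~ K) (Kd : K * delta <~ 1).

(* K bounds all relevant logarithmic derivatives and w the first derivative.
   Using w instead of K f keeps the bound sharp for slowly varying f such as
   log T. *)
Definition taylor_bound w' K' f := forall j,
  comp (iter j.+1 D f) x <~ w' * K' ^+ j /\
  taylor_rem j.+1 f <~ w' * delta * (K' * delta) ^+ j.

Let small_bound j : w * delta * (K * delta) ^+ j <~ 1.
Proof.
rewrite -[X in _ <~ X]mul1r; apply: domM; first exact: dom_trans (domMr delta wK) Kd.
by rewrite -(expr1n _ j); exact: domX.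
Qed.

(** The ratio m(x + delta) / m(x) is the exponential of the increment of log m: [exp_taylor] treats
    the Taylor polynomial of log m and [exp_remainder] absorbs its remainder. The factor m(x) in the
    new bound reflects m' = m (log m)'. *)
Lemma taylor_bound_exp : taylor_bound w K (mlog m) ->
  taylor_bound (comp (monomial m) x * w) K (monomial m).
Proof.
move=> hb; have g_dom j : g j.+1 <~ w * K ^+ j.
  by apply/tderiv_phi_dom => //; case: (hb j).
move=> j; split.
  apply/tderiv_phi_dom => //.
  have h : c j.+1 <~ w * K ^+ j.
    exact: (@exp_coef_dom _ _ U w K wK g c j.+1 c_0 c_S g_dom j (ltnSn j)).
  rewrite (_ : comp _ x = comp (monomial m) x * c j.+1).
    by rewrite -mulrA; exact: domMl h.
  by rewrite /c mulrC (divfK phim_neq0).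
rewrite rem_m -!mulrA; apply: domMl; rewrite mulrA (rem_log j).
apply: exp_remainder.
- exact: (@exponent_dom _ _ U w K delta wK Kd g j g_dom).
- exact: small_bound.
- by case: (hb j).
- exact: (@exp_taylor _ _ U w K delta wK Kd g c j c_0 c_S g_dom).
Qed.

(** Inverts the exponential step. The hypothesis m(x + delta) ≍ m(x) makes the increment of log m
    bounded, so that the remainder v of log m is bounded and can be recovered from e^v - 1 ≍ v. *)
Lemma taylor_bound_log : comp (monomial m) (x + delta) >~< comp (monomial m) x ->
  taylor_bound (comp (monomial m) x * w) K (monomial m) ->
  taylor_bound w K (mlog m).
Proof.
move=> mm hb; have c_dom j : c j.+1 <~ w * K ^+ j.
  apply: (dom_mul2r phim_neq0); rewrite (divfK phim_neq0).
  have -> : w * K ^+ j * comp (monomial m) x = comp (monomial m) x * w * K ^+ j by ring.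
  by apply/tderiv_phi_dom => //; case: (hb j).
have g_dom j : g j.+1 <~ w * K ^+ j by exact: (@log_coef_dom _ _ U w K wK g c c_0 c_S).
move=> j; split; first by apply/tderiv_phi_dom; [exact: om_g|exact: g_dom].
have b1 : \sum_(i < j) g i.+1 * delta ^+ i.+1 <~ 1.
  exact: (@exponent_dom _ _ U w K delta wK Kd g j g_dom).
have u1 : comp (mlog m) (x + delta) - comp (mlog m) x <~ 1.
  rewrite -[X in X <~ _]texpK; apply: tlog_dom1; first exact: texp_gt0.
  have -> : texp (comp (mlog m) (x + delta) - comp (mlog m) x) =
      comp (monomial m) (x + delta) / comp (monomial m) x.
    by rewrite psi_m mulrAC (divff phim_neq0) mul1r.
  by rewrite -(divff phim_neq0); exact: asympM mm (asymp_refl _).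
have vE : taylor_rem j.+1 (mlog m) = (comp (mlog m) (x + delta) - comp (mlog m) x) -
   \sum_(i < j) g i.+1 * delta ^+ i.+1 by rewrite (rem_log j) addrC addKr.
have v1 : taylor_rem j.+1 (mlog m) <~ 1 by rewrite vE; exact: domB.
apply: (@log_remainder _ _ U _ _ (\sum_(i < j.+1) c i * delta ^+ i) _ b1 v1).
  exact: (@exp_taylor _ _ U w K delta wK Kd g c j c_0 c_S g_dom).
rewrite -rem_log; apply: (dom_mul2l phim_neq0); rewrite -rem_m.
have -> : comp (monomial m) x * (w * delta * (K * delta) ^+ j) =
   comp (monomial m) x * w * delta * (K * delta) ^+ j by rewrite !mulrA.
by case: (hb j).
Qed.

End Monomial.

Hypothesis xdelta_asymp : x + delta >~< x.
Local Notation T := (monomial t : V).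

Let om_td n f : om f -> om (tderiv D n f).
Proof. exact: om_tderiv_deriv. Qed.

Lemma phi_T : comp T x = x.
Proof. exact: omega_comp_var comp_composition _ x_gtR. Qed.

Lemma psi_T : comp T (x + delta) = x + delta.
Proof. exact: omega_comp_var comp_composition _ xdelta_gtR. Qed.

Lemma iter_deriv_T j : iter j.+2 D T = 0.
Proof.
have D0 : D 0 = 0 by exact: slin0 (deriv_slin t_atomic D_deriv).
elim: j => [|j IH]; first by rewrite /= (deriv_T D_deriv) (deriv1 t_atomic D_deriv).
by rewrite iterS IH.
Qed.

Lemma phi_one : comp 1 x = 1.
Proof. exact: (comp1 t_atomic comp_composition x_gtR). Qed.

(** Derivatives of T of order at least 2 vanish, so the expansion is exact after the linear term and
    K is arbitrary. *)
Lemma taylor_bound_T K : taylor_bound 1 K T.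
Proof.
have omT := om_T t_atomic; have phi0 := comp0 t_atomic comp_composition x_gtR.
have t1 : tderiv D 1 T = 1 by rewrite /tderiv factS fact0 muln1 divr1; exact: (deriv_T D_deriv).
have t2 i : tderiv D i.+2 T = 0 by rewrite /tderiv iter_deriv_T mul0r.
case=> [|j]; split.
- by rewrite [iter 1 D T](deriv_T D_deriv) phi_one expr0 mulr1; exact: dom_refl.
- rewrite rem1// phi_T psi_T expr0 mulr1 mul1r [x + _]addrC addrK.
  exact: dom_refl.
- by rewrite iter_deriv_T phi0; exact: dom0l.
rewrite remE// psi_T big_ord_recl big_ord_recl big1; last first.
  by move=> i _; rewrite (t2 i) phi0 mul0r.
rewrite expr0 expr1 mulr1 addr0 tderiv0 phi_T [tderiv _ _ _](t1) phi_one mul1r subrr.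
exact: dom0l.
Qed.

Variable K : U.
Hypotheses (xK : x^-1 <~ K) (Kd : K * delta <~ 1).

Let ell i : V := monomial (iter_log t i).

Let phi_dom f g : om f -> om g -> f <~ g -> comp f x <~ comp g x.
Proof.
by move=> fo go; have [_] := comp_dom t_atomic comp_composition x_gtR fo go; apply.
Qed.


Lemma phi_inv f : om f -> f != 0 -> comp f^-1 x = (comp f x)^-1.
Proof.
move=> fo f0; have fx := comp_neq0 t_atomic comp_composition x_gtR fo f0.
apply: (mulfI fx); rewrite (divff fx).
rewrite -(compM t_atomic comp_composition x_gtR fo (omV t_atomic fo)).
by rewrite (divff f0) phi_one.
Qed.

Lemma phi_deriv_monomial m : omega_mon t m ->
  comp (D (monomial m)) x = comp (monomial m) x * comp (D (mlog m)) x.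
Proof.
move=> mG; rewrite (deriv_monomial t_atomic D_deriv mG).
apply: (compM t_atomic comp_composition x_gtR); first exact: om_monomial.
by apply: (om_deriv t_atomic D_deriv); exact: om_mlog.
Qed.

(** For i > 0 the derivative of [ell i] is ≼ (log T)' = 1/T, hence ≼ K at x. The second conjunct
    feeds the next logarithmic step; for i > 0 it holds because [ell i] moves by a bounded amount
    and is infinite. *)
Lemma taylor_bound_iter_log i :
  taylor_bound (comp (D (ell i)) x) K (ell i) /\
  comp (ell i) (x + delta) >~< comp (ell i) x.
Proof.
elim: i => [|i [IH1 IH2]].
  rewrite /ell (iter_log0 t_atomic) (deriv_T D_deriv) phi_one phi_T psi_T.
  by split=> //; exact: taylor_bound_T.
have mG := omega_mon_log t i; have mlogE := mlog_iter_log t_atomic i.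
have eG := omega_mon_log t i.+1.
have eo : om (ell i.+1) by exact: om_monomial.
have wK : comp (D (ell i.+1)) x <~ K.
  have xT : comp T^-1 x = x^-1.
    by rewrite phi_inv ?phi_T//; [exact: om_T|exact: monomial_neq0].
  apply: (dom_trans _ xK); rewrite -xT; apply: phi_dom.
  - exact: (om_deriv t_atomic D_deriv).
  - by apply: (omV t_atomic); exact: om_T.
  rewrite -(deriv_logT t_atomic D_deriv); apply: (deriv_dom t_atomic D_deriv).
  - exact: eo.
  - exact: om_logT.
  - apply/dom_monomial; case: i {IH1 IH2 mG mlogE eG eo} => [//|i].
    by apply: ltW; case: (@ell_mono _ _ _ _ t_atomic _ D_deriv 1 i.+2 (ltn0Sn i)).
  - exact/sdom1_nasymp/logT_sdom.
have hb : taylor_bound (comp (D (ell i.+1)) x) K (ell i.+1).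
  have E := phi_deriv_monomial mG; rewrite mlogE in E.
  have := @taylor_bound_log _ mG _ _ wK Kd IH2; rewrite -[X in taylor_bound X _ _]E mlogE.
  by apply; exact: IH1.
split; first exact: hb.
have [_] := hb 0%N; rewrite rem1// expr0 mulr1 => r1.
have e1 : 1 <<~ comp (ell i.+1) x.
  rewrite -phi_one => h; apply: (ell_gt1 t_atomic (n := i.+1)).
  by have [h2 _] := comp_dom t_atomic comp_composition x_gtR eo (@om1 S R V t); exact: h2.
rewrite -[comp _ (x + delta)](subrK (comp (ell i.+1) x)); apply: asympDl.
apply: (dom_sdom_trans _ e1); apply: (dom_trans r1).
exact: dom_trans (domMr delta wK) Kd.
Qed.

(** A monomial k of log m is infinite, so at x one has (log k)' ≼ k (log k)' = k' ≼ (log m)' ≼ K and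
    the induction hypothesis applies to k. Its bounds, weakened from k' to (log m)', are summed by
    strong linearity and then exponentiated. *)
Lemma taylor_bound_monomial m : omega_mon t m ->
  comp (D (mlog m)) x <~ K -> taylor_bound (comp (D (monomial m)) x) K (monomial m).
Proof.
elim=> {m} [i _|m kG IH mK]; first by case: (taylor_bound_iter_log i).
have mG : omega_mon t m by exact: omega_mon_exp.
rewrite phi_deriv_monomial//; apply: taylor_bound_exp => //.
have gG := omE (om_mlog t_atomic mG); have go := Om gG.
have Dk k : supp (mlog m) k -> comp (D (monomial k)) x <~ comp (D (mlog m)) x.
  move=> gk; have ko : om (monomial k) by apply: om_monomial; exact: gG.
  apply: phi_dom; [exact: om_deriv|exact: om_deriv|].
  apply: (deriv_dom t_atomic D_deriv ko go (supp_dom gk)).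
  apply: sdom1_nasymp; apply: mlog_sdom1; apply: contraTneq gk => ->.
  by rewrite mlog1; apply/negP; exact: supp0.
have hk k : supp (mlog m) k -> taylor_bound (comp (D (mlog m)) x) K (monomial k).
  move=> gk; have kG' := gG _ gk; have kK : comp (D (mlog k)) x <~ K.
    apply: (dom_trans _ mK); apply: (dom_trans _ (Dk k gk)).
    rewrite phi_deriv_monomial// -[X in X <~ _]mul1r; apply: domMr.
    rewrite -phi_one; apply: phi_dom; [exact: om1|exact: om_monomial|].
    by apply: sdomW; apply/sdom_monomial; exact: mlog_J gk.
  move=> j; have [h1 h2] := IH k gk kK j; split.
    exact: dom_trans h1 (domMr _ (Dk k gk)).
  exact: dom_trans h2 (domMr _ (domMr _ (Dk k gk))).
move=> j; split.
- by apply: (slin_dom (phi_iter_slin j.+1) gG) => k gk; case: (hk k gk j).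
- by apply: (slin_dom (rem_slin j.+1) gG) => k gk; case: (hk k gk j).
Qed.

End Taylor.

(** * From omega-series to the abstract estimates *)

Section Instances.
Variables (S : sizeClass) (R : realType) (V U : transseriesField S R) (t : mon V).
Hypothesis t_atomic : log_atomic t.
Variables (D : V -> V) (D_deriv : is_omega_derivation t D).
Variables (comp : V -> U -> U) (comp_composition : is_omega_composition t comp).
Local Notation om := (om t).
Local Notation T := (monomial t : V).

Lemma omega_asymptotic_derivation :
  asymptotic_derivation om (@const S R _ (mon V)) D T (monomial (iter_log t 1)).
Proof.
split.
- by move=> f g; exact: omD.
- by move=> f; exact: omN.
- by move=> f g; exact: omM.
- by move=> f; exact: omV.
- by move=> r; exact: om_const.
- exact: const1.
- exact: constN.
- exact: constD.
- by move=> r; exact: const_asymp.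
- by move=> f; exact: standard_part.
- by move=> f; exact: om_deriv.
- move=> f g /omE fG /omE gG; exact: (slinD (deriv_slin t_atomic D_deriv)).
- by move=> f g; exact: derivM_om.
- by move=> r; exact: (deriv_const t_atomic D_deriv).
- by move=> f g; exact: deriv_dom.
- by move=> f g; exact: deriv_sdom.
- by move=> h; exact: log_exists.
- by move=> f g; exact: logder_dom.
- exact: om_T.
- exact: T_sdom.
- exact: deriv_T D_deriv.
- exact: om_logT.
- exact: logT_sdom.
- exact: deriv_logT.
Qed.

Definition omega_monomial (f : V) : Prop := exists2 m, omega_mon t m & f = monomial m.

Lemma omega_mon_t : omega_mon t t.
Proof. by have := omega_mon_log t 0; rewrite (iter_log0 t_atomic). Qed.

Lemma omega_monX m k : omega_mon t m -> omega_mon t (m ^+ k)%g.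
Proof.
move=> mG; elim: k => [|k IH]; first exact: omega_mon1.
by rewrite expgS; exact: omega_monM.
Qed.

Lemma omega_monomial_class : monomial_class om T omega_monomial.
Proof.
split.
- by move=> _ [m mG ->]; exact: om_monomial.
- by move=> _ [m _ ->]; exact: monomial_neq0.
- by exists 1%g; [exact: omega_mon1|].
- move=> _ [m mG ->]; exists m^-1%g; [exact: omega_monV|].
  by rewrite monomialV.
- move=> _ k [m mG ->]; exists (m * (t ^+ k)^-1)%g.
    apply: (omega_monM t_atomic) => //; apply: (omega_monV t_atomic).
    exact: omega_monX omega_mon_t.
  by rewrite monomialM monomialV monomialX.
- move=> _ k [m mG ->]; rewrite monomialX => -[h1 h2]; congr monomial.
  by apply/eqP; rewrite eq_le; apply/andP; split; apply/(dom_monomial S R).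
- move=> h ho h0; exists (monomial (lmon h)); last exact: asymp_lmon.
  by exists (lmon h) => //; exact: om_lmon.
Qed.

Lemma comp_embedding x : above_reals x -> dominance_embedding om (fun f => comp f x).
Proof.
move=> xR; split.
- by move=> f g; exact: compD.
- by move=> f g; exact: compM.
- exact: (comp1 t_atomic comp_composition xR).
- by move=> f g; exact: comp_dom.
Qed.

(** Stated for two points x and y so that it also covers the exchanged situation, from x + delta
    back to x with increment -delta. *)
Lemma taylor_remainder_dom x y delta : above_reals x -> above_reals y ->
  y = x + delta -> y >~< x -> forall f K, omega_monomial f ->
  (comp T x)^-1 <~ K -> K * delta <~ 1 -> comp (D f / f) x <~ K ->
  forall j, remainder D (fun f => comp f x) (fun f => comp f y) delta j.+1 f <~
    comp (D f) x * delta * (K * delta) ^+ j.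
Proof.
move=> xR yR yE; rewrite yE in yR *; move=> yx f K [m mG ->].
rewrite (phi_T comp_composition xR) => xK Kd.
have -> : D (monomial m) / monomial m = D (mlog m).
  rewrite (deriv_monomial t_atomic D_deriv mG) mulrAC divff ?mul1r//.
  exact: monomial_neq0.
move=> mK j.
by case: (taylor_bound_monomial t_atomic D_deriv comp_composition xR yR yx xK Kd mG mK j).
Qed.

End Instances.

Theorem theorem3 (S : sizeClass) (R : realType) (V U : transseriesField S R)
  (t : mon V) (t_atomic : log_atomic t)
  (D : V -> V) (D_deriv : is_omega_derivation t D)
  (comp : V -> U -> U) (comp_composition : is_omega_composition t comp)
  (f : V) (f_omega : omega_series t f) (f_neq0 : f != 0)
  (f_not_power : forall k : nat, ~ asymp_eq f (monomial t ^+ k))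
  (x delta : U) (x_gtR : above_reals x) (xdelta_gtR : above_reals (x + delta))
  (xdelta_asymp : asymp_eq (x + delta) x)
  (delta_small : dominated (comp (D f) x / comp f x * delta) 1)
  (n : nat) :
  exists2 e : U,
    dominated e (comp (iter n D f) x * delta ^+ n) &
    comp f (x + delta) =
      \sum_(0 <= i < n) comp (iter i D f) x / i`!%:R * delta ^+ i + e.
Proof.
have fo : om t f by apply/omP.
have ad := omega_asymptotic_derivation t_atomic D_deriv.
have mc := omega_monomial_class t_atomic.
have ex := comp_embedding t_atomic comp_composition x_gtR.
have ey := comp_embedding t_atomic comp_composition xdelta_gtR.
have xT := phi_T comp_composition x_gtR.
have yT := phi_T comp_composition xdelta_gtR.
have dx : delta <~ x.
  rewrite -[delta](addrK x) [delta + x]addrC; apply: domB; last exact: dom_refl.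
  by case: xdelta_asymp.
have dy : delta <~ x + delta by apply: dom_trans dx _; case: xdelta_asymp.
have remx := taylor_remainder_dom t_atomic D_deriv comp_composition
  x_gtR xdelta_gtR (erefl (x + delta)) xdelta_asymp.
have remy := taylor_remainder_dom t_atomic D_deriv comp_composition
  xdelta_gtR x_gtR (esym (addrK delta x)) (asymp_sym xdelta_asymp).
(* The first-order estimate seen from x + delta; it serves to carry boundedness of m'/m times delta
   back to x. *)
have rem1y m : omega_monomial t m -> comp (D m / m) (x + delta) * - delta <~ 1 ->
    comp m x - comp m (x + delta) <~ comp (D m) (x + delta) * - delta.
  apply: (rem1_dom ad mc ey _ remy).
  by rewrite yT; apply: domN.
exists (taylor_rem D comp x delta n f); last by rewrite big_mkord [RHS]addrC /taylor_rem subrK.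
apply: (slin_dom (rem_slin t_atomic D_deriv comp_composition x_gtR xdelta_gtR n) (omE fo)).
move=> m fm; apply: (remainder_dom ad mc ex ey _ _ remx rem1y fo f_neq0 f_not_power).
- by rewrite xT yT.
- by rewrite xT.
- have fi := embed_inv ad ex fo f_neq0.
  by rewrite (de_mul ex (om_deriv t_atomic D_deriv fo) (omV t_atomic fo)) fi.
- by exists m => //; exact: (omE fo).
- exact: supp_dom.
Qed.
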